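(* Let $R$ be a commutative noetherian local ring, and let $M\in \mathsf{D}^{\mathsf{b}}_{\mathsf{f}}(R)$ be a nonzero object (i.e. $\mathrm{H}(M)\neq 0$) such that $\operatorname{id}_R(\mathrm{H}(M)^{\oplus}) < \infty$. Let $\mathsf{I}$ be the collection of all injective $R$-modules. Then $$\operatorname{level}_R^{\mathsf{I}}(M) = \operatorname{depth}(R) + 1 .$$
   Context: $\mathsf{D}(R)$ is the derived category of $R$; $\mathsf{D}^{\mathsf{b}}_{\mathsf{f}}(R)$ is the full subcategory of complexes $M$ with bounded homology ($\mathrm{H}_i(M)=0$ for all $|i|\gg 0$) such that every $\mathrm{H}_i(M)$ is finitely generated. Complexes are graded homologically. $\mathrm{H}(M)^{\oplus} = \bigoplus_{i\in\mathbb{Z}} \mathrm{H}_i(M)$, an $R$-module; $\operatorname{id}_R$ is injective dimension. Level: for a nonempty collection $\mathsf{C}$ of objects of $\mathsf{D}(R)$ (modules are viewed as complexes concentrated in degree $0$), set $\operatorname{thick}_R^0(\mathsf{C}) = \{0\}$; $\operatorname{thick}_R^1(\mathsf{C})$ is the smallest collection of objects containing $\mathsf{C}$ and closed under isomorphism, shifts, finite direct sums and direct summands; for $n\ge 2$, $\operatorname{thick}_R^n(\mathsf{C})$ consists of all $M\in \mathsf{D}(R)$ for which there is a distinguished triangle $K \to L\oplus M \to N \to$ (for some object $L$) with $K\in \operatorname{thick}_R^1(\mathsf{C})$ and $N \in \operatorname{thick}_R^{n-1}(\mathsf{C})$. Then $\operatorname{level}_R^{\mathsf{C}}(M) = \inf\{n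 \mid M\in \operatorname{thick}_R^n(\mathsf{C})\}$ (equal to $\infty$ if no such $n$ exists). *)

(* Defs.v *)
From HB Require Import structures.
From mathcomp Require Import all_boot all_order all_algebra.
From mathcomp Require Import boolp classical_sets.

Set Implicit Arguments.
Unset Strict Implicit.
Unset Printing Implicit Defensive.

Import GRing.Theory.
Local Open Scope ring_scope.
Local Open Scope quotient_scope.

(* Extended natural numbers are [option nat], with [None] as infinity. *)
Definition einf (P : nat -> Prop) : option nat :=
  if pselect (exists n, `[<P n>]) is left h then Some (ex_minn h) else None.

Definition esup (P : nat -> Prop) : option nat :=
  einf (fun n => forall k, P k -> (k <= n)%N).

Definition esucc (n : option nat) : option nat := omap succn n.

Section CommutativeAlgebra.
Variable R : comNzRingType.

Definition is_ideal (I : set R) : Prop :=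
  I 0 /\ forall a x y, I x -> I y -> I (a * x + y).

Definition ideal_gen (s : seq R) : set R :=
  [set x | exists c : 'I_(size s) -> R, x = \sum_i c i * s`_i].

Definition noetherian : Prop :=
  forall I, is_ideal I -> exists s, I = ideal_gen s.

Definition maximal_ideal (I : set R) : Prop :=
  [/\ is_ideal I, ~ I 1 &
      forall J, is_ideal J -> ~ J 1 -> (I `<=` J)%classic -> J = I].

Definition local_with (m : set R) : Prop :=
  forall I, maximal_ideal I <-> I = m.

Definition regular_seq (s : seq R) : Prop :=
  ~ ideal_gen s 1 /\
  forall i, (i < size s)%N -> forall a,
    ideal_gen (take i s) (s`_i * a) -> ideal_gen (take i s) a.

(* Meant for a local ring with maximal ideal [m]: supremum of the lengths of
   the regular sequences contained in [m]. *)
Definition depth (m : set R) : option nat :=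
  esup (fun n => exists s,
    [/\ size s = n, forall x, x \in s -> m x & regular_seq s]).

Definition fin_gen (V : lmodType R) : Prop :=
  exists s : seq V, forall v, exists c : 'I_(size s) -> R,
    v = \sum_i c i *: s`_i.

Definition injective_module (I : lmodType R) : Prop :=
  forall (A B : lmodType R) (f : {linear A -> B}) (g : {linear A -> I}),
    injective f -> exists h : {linear B -> I}, forall a, h (f a) = g a.

Definition lin_of (U V : lmodType R) (f : U -> V) (lf : linear f) :
  {linear U -> V} := HB.pack f (GRing.isLinear.Build R U V _ f lf).

End CommutativeAlgebra.

Section QuotientModule.
Variables (R : comNzRingType) (V : lmodType R).
Variables (S : pred V) (hS : submod_closed S).

Definition zmod_of_submod : zmodClosed V :=
  HB.pack S (GRing.isZmodClosed.Build V S (GRing.submod_closedB hS)).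
Definition quotmod := Quotient.quot zmod_of_submod.
HB.instance Definition _ := GRing.Zmodule.on quotmod.
HB.instance Definition _ :=
  EqQuotient.copy quotmod (Quotient.quot zmod_of_submod).

Definition quot_scale (a : R) (x : quotmod) : quotmod :=
  \pi_quotmod (a *: repr x).

Lemma quot_eqP (x y : V) :
  \pi_quotmod x = \pi_quotmod y <-> x - y \in S.
Proof.
by rewrite (Quotient.idealrBE zmod_of_submod x y); split=> [h|/eqP]; first exact/eqP.
Qed.

Lemma pi_scale a (x : V) : quot_scale a (\pi_quotmod x) = \pi_quotmod (a *: x).
Proof.
apply/quot_eqP; rewrite -scalerBr -[_ *: _]addr0; apply: hS.2; last exact: hS.1.
by apply: (iffLR (quot_eqP _ _)); rewrite reprK.
Qed.

Lemma pi_addE (x y : V) : \pi_quotmod (x + y) = \pi_quotmod x + \pi_quotmod y.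
Proof. exact: (Quotient.pi_add zmod_of_submod). Qed.

Lemma quot_ind (P : quotmod -> Prop) :
  (forall v, P (\pi_quotmod v)) -> forall x, P x.
Proof. by move=> h x; rewrite -[x]reprK. Qed.

Lemma quot_scaleA a b v : quot_scale a (quot_scale b v) = quot_scale (a * b) v.
Proof. by elim/quot_ind: v => v; rewrite !pi_scale scalerA. Qed.
Lemma quot_scale1 : left_id 1 quot_scale.
Proof. by elim/quot_ind => v; rewrite pi_scale scale1r. Qed.
Lemma quot_scaleDr : right_distributive quot_scale +%R.
Proof.
move=> a; elim/quot_ind => u; elim/quot_ind => v.
by rewrite -pi_addE !pi_scale scalerDr pi_addE.
Qed.
Lemma quot_scaleDl v : {morph quot_scale^~ v : a b / a + b}.
Proof.
by move=> a b; elim/quot_ind: v => v; rewrite !pi_scale scalerDl pi_addE.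
Qed.

HB.instance Definition _ := GRing.Zmodule_isLmodule.Build R quotmod
  quot_scaleA quot_scale1 quot_scaleDr quot_scaleDl.

End QuotientModule.

Section DirectSum.
Variables (R : comNzRingType) (T : eqType) (V : T -> lmodType R).

Record dsum := DSum {
  dsum_val :> forall i, V i;
  dsum_fin : exists s : seq T, forall i, i \notin s -> dsum_val i = 0 }.

HB.instance Definition _ := gen_eqMixin dsum.
HB.instance Definition _ := gen_choiceMixin dsum.

Lemma dsum_eq (x y : dsum) : (forall i, x i = y i) -> x = y.
Proof.
case: x y => [x px] [y py] /= h; have e : x = y by exact: functional_extensionality_dep.
by case: _ / e py => py; congr DSum; exact: Prop_irrelevance.
Qed.

Program Definition dsum0 := @DSum (fun=> 0) _.
Next Obligation. by exists [::]. Qed.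
Program Definition dsumN (x : dsum) := @DSum (fun i => - x i) _.
Next Obligation.
by case: (dsum_fin x) => s h; exists s => i /h ->; rewrite oppr0.
Qed.
Program Definition dsumD (x y : dsum) := @DSum (fun i => x i + y i) _.
Next Obligation.
case: (dsum_fin x) (dsum_fin y) => s h [t k]; exists (s ++ t) => i.
by rewrite mem_cat negb_or => /andP[/h -> /k ->]; rewrite addr0.
Qed.
Program Definition dsumZ (a : R) (x : dsum) := @DSum (fun i => a *: x i) _.
Next Obligation.
by case: (dsum_fin x) => s h; exists s => i /h ->; rewrite scaler0.
Qed.

Lemma dsumA : associative dsumD.
Proof. by move=> x y z; apply: dsum_eq => i /=; rewrite addrA. Qed.
Lemma dsumC : commutative dsumD.
Proof. by move=> x y; apply: dsum_eq => i /=; rewrite addrC. Qed.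
Lemma dsum0D : left_id dsum0 dsumD.
Proof. by move=> x; apply: dsum_eq => i /=; rewrite add0r. Qed.
Lemma dsumND : left_inverse dsum0 dsumN dsumD.
Proof. by move=> x; apply: dsum_eq => i /=; rewrite addNr. Qed.
HB.instance Definition _ :=
  GRing.isZmodule.Build dsum dsumA dsumC dsum0D dsumND.

Lemma dsumZA a b v : dsumZ a (dsumZ b v) = dsumZ (a * b) v.
Proof. by apply: dsum_eq => i /=; rewrite scalerA. Qed.
Lemma dsumZ1 : left_id 1 dsumZ.
Proof. by move=> v; apply: dsum_eq => i /=; rewrite scale1r. Qed.
Lemma dsumZDr : right_distributive dsumZ +%R.
Proof. by move=> a u v; apply: dsum_eq => i /=; rewrite scalerDr. Qed.
Lemma dsumZDl v : {morph dsumZ^~ v : a b / a + b}.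
Proof. by move=> a b; apply: dsum_eq => i /=; rewrite scalerDl. Qed.
HB.instance Definition _ := GRing.Zmodule_isLmodule.Build R dsum
  dsumZA dsumZ1 dsumZDr dsumZDl.

End DirectSum.

Section Complexes.
Variable R : comNzRingType.

Record complex := Complex {
  ob :> int -> lmodType R;
  diff : forall i, {linear ob i -> ob (i - 1)};
  diffK : forall i x, diff (i - 1) (diff i x) = 0 }.

Record chain_map (A B : complex) := ChainMap {
  cmap :> forall i, {linear A i -> B i};
  cmapP : forall i x, cmap (i - 1) (diff A i x) = diff B i (cmap i x) }.

Program Definition cid_map (A : complex) : chain_map A A :=
  @ChainMap A A (fun i => idfun) _.

Program Definition ccomp (A B C : complex) (g : chain_map B C)
    (f : chain_map A B) : chain_map A C :=
  @ChainMap A C (fun i => g i \o f i) _.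
Next Obligation. by rewrite /= !cmapP. Qed.

(* The homotopy is indexed so that its component [h i] has degree [i - 1] in
   the source; every integer is of the form [i - 1], so all degrees occur. *)
Definition homotopic (A B : complex) (f g : chain_map A B) : Prop :=
  exists h : forall i : int, {linear A (i - 1) -> B i},
  forall i (x : A (i - 1)),
    f (i - 1) x - g (i - 1) x
    = diff B i (h i x) + h (i - 1) (diff A (i - 1) x).

(* Indexed family, so that no transport along [(i + 1) - 1 = i] is needed. *)
Variant boundary (M : complex) : forall i, M i -> Prop :=
  Boundary i (y : M i) : boundary (diff M i y).

Lemma boundaryE (M : complex) j (z : M (j - 1)) :
  boundary z <-> exists y, diff M j y = z.
Proof.
split=> [bz|[y <-]]; last exact: Boundary.
suff : forall k (w : M k), boundary w -> forall e : k = j - 1,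
    exists y, diff M j y = ecast k (M k) e w by move=> /(_ _ _ bz erefl).
move=> k w; case=> {w}l y e; have kj : l = j by apply: (addIr (-1)); exact: e.
by case: _ / kj e => e; exists y; rewrite (eq_axiomK e).
Qed.

Lemma boundary0 (M : complex) i : boundary (0 : M i).
Proof.
have B j : boundary (0 : M (j - 1)) by rewrite -(linear0 (diff M j)).
by have := B (i + 1); rewrite addrK.
Qed.

Lemma boundaryZD (M : complex) i a (x y : M i) :
  boundary x -> boundary y -> boundary (a *: x + y).
Proof.
move=> bx; case: bx y => j w y /boundaryE[z <-].
by rewrite -linearP; exact: Boundary.
Qed.

Section Homology.
Variables (M : complex) (i : int).

Definition is_cycle : pred (M i) := fun z => diff M i z == 0.

Lemma is_cycle_submod : submod_closed is_cycle.
Proof.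
split=> [|a x y]; rewrite !unfold_in /is_cycle ?linear0 // => /eqP dx /eqP dy.
by rewrite linearP dx dy scaler0 addr0.
Qed.
HB.instance Definition _ :=
  GRing.isSubmodClosed.Build R (M i) is_cycle is_cycle_submod.

Record cycle := Cycle { cycle_val : M i; _ : is_cycle cycle_val }.
HB.instance Definition _ := [isSub for cycle_val].
HB.instance Definition _ := [Choice of cycle by <:].
HB.instance Definition _ := [SubChoice_isSubLmodule of cycle by <:].

Definition is_boundary : pred cycle := fun z => `[< boundary (val z) >].
Lemma is_boundary_submod : submod_closed is_boundary.
Proof.
split=> [|a x y]; rewrite !unfold_in /is_boundary.
  by apply/asboolP; exact: boundary0.
by move=> /asboolP bx /asboolP b_y; apply/asboolP; exact: boundaryZD.
Qed.

Definition homology : lmodType R := quotmod is_boundary_submod.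

End Homology.

Section HomologyMap.
Variables (A B : complex) (f : chain_map A B) (i : int).

Lemma cycle_map_subproof (z : cycle A i) : is_cycle (f i (val z)).
Proof. by rewrite /is_cycle -cmapP (eqP (valP z)) linear0. Qed.

Definition cycle_map (z : cycle A i) : cycle B i :=
  Cycle (cycle_map_subproof z).

Definition homology_map (x : homology A i) : homology B i :=
  \pi_(quotmod (is_boundary_submod B i)) (cycle_map (repr x)).

End HomologyMap.

Definition quasi_iso (A B : complex) (f : chain_map A B) : Prop :=
  forall i, bijective (@homology_map A B f i).

Lemma homology_eqP (M : complex) i (z w : cycle M i) :
  \pi_(quotmod (is_boundary_submod M i)) z
  = \pi_(quotmod (is_boundary_submod M i)) w
  <-> boundary (val z - val w).
Proof.
have -> : val z - val w = val (z - w) by rewrite raddfB.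
by split=> [/quot_eqP/asboolP|/asboolP h]; last exact/quot_eqP.
Qed.

Lemma cmap_boundary (A B : complex) (f : chain_map A B) i (z : A i) :
  boundary z -> boundary (f i z).
Proof. by case=> j y; rewrite cmapP; exact: Boundary. Qed.

Lemma homology_map_pi (A B : complex) (f : chain_map A B) i (z : cycle A i) :
  homology_map f (\pi_(quotmod (is_boundary_submod A i)) z)
  = \pi_(quotmod (is_boundary_submod B i)) (cycle_map f z).
Proof.
apply/homology_eqP; rewrite /= -raddfB; apply: cmap_boundary.
by apply/homology_eqP; rewrite reprK.
Qed.

Lemma quasi_isoP (A B : complex) (f : chain_map A B) :
  quasi_iso f <-> forall i,
    (forall z, diff A i z = 0 -> boundary (f i z) -> boundary z) /\
    (forall w, diff B i w = 0 ->
       exists2 z, diff A i z = 0 & boundary (f i z - w)).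
Proof.
split=> qf i; last first.
  have [inj surj] := qf i.
  have finj : injective (@homology_map _ _ f i).
    elim/quot_ind => z; elim/quot_ind => w.
    rewrite !homology_map_pi => /homology_eqP /=; rewrite -raddfB => h.
    have /eqP dz := valP z; have /eqP dw := valP w.
    by apply/homology_eqP/inj => //; rewrite linearB /= dz dw subrr.
  have fsurj y : exists x, homology_map f x = y :> homology B i.
    elim/quot_ind: y => w.
    have [z /eqP dz bz] := surj _ (eqP (valP w)).
    exists (\pi_(quotmod (is_boundary_submod A i)) (Cycle dz)).
    by rewrite homology_map_pi; apply/homology_eqP.
  have [g gK] := choice fsurj.
  by exists g => // x; apply: finj; rewrite gK.
have [g fK gK] := qf i; split=> [z /eqP dz bz|w /eqP dw].
  have /homology_eqP : \pi_(quotmod (is_boundary_submod A i)) (Cycle dz)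
       = \pi_(quotmod (is_boundary_submod A i)) 0.
    apply: (can_inj fK); rewrite !homology_map_pi; apply/homology_eqP.
    by rewrite /= linear0 subr0.
  by rewrite /= subr0.
move: (gK (\pi_(quotmod (is_boundary_submod B i)) (Cycle dw))).
elim/quot_ind: (g _) => z; rewrite homology_map_pi => /homology_eqP h.
by exists (val z) => //; exact: (eqP (valP z)).
Qed.

Lemma shift_linear (M : complex) i :
  linear (fun x : M (i - 1) => - diff M (i - 1) x).
Proof. by move=> a x y; rewrite linearP opprD scalerN. Qed.

Program Definition shift (M : complex) : complex :=
  @Complex (fun i => M (i - 1)) (fun i => lin_of (@shift_linear M i)) _.
Next Obligation. by rewrite linearN diffK !oppr0. Qed.

Program Definition shift_map (A B : complex) (f : chain_map A B) :
  chain_map (shift A) (shift B) :=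
  @ChainMap (shift A) (shift B) (fun i => f (i - 1)) _.
Next Obligation. by rewrite linearN cmapP. Qed.

Lemma zero_linear (U V : lmodType R) : linear (fun _ : U => 0 : V).
Proof. by move=> a x y; rewrite scaler0 addr0. Qed.

Definition stalk_ob (N : lmodType R) (i : int) : lmodType R :=
  if i is Posz 0 then N else 'rV[R]_0.

(* A module as a complex concentrated in degree 0. *)
Definition stalk (N : lmodType R) : complex :=
  @Complex (stalk_ob N) (fun i => lin_of (@zero_linear _ _)) (fun _ _ => erefl).

Definition zero_complex : complex := stalk 'rV[R]_0.

Section DirectSumOfTwo.
Variables A B : complex.

Lemma csum_linear i : linear (fun p : A i * B i =>
  (diff A i p.1, diff B i p.2) : A (i - 1) * B (i - 1)).
Proof. by move=> a [x y] [z t] /=; rewrite !linearP. Qed.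

Program Definition csum : complex :=
  @Complex (fun i => (A i * B i)%type : lmodType R)
    (fun i => lin_of (@csum_linear i)) _.
Next Obligation. by rewrite !diffK. Qed.

End DirectSumOfTwo.

Section MappingCone.
Variables (A B : complex) (f : chain_map A B).

Lemma cone_linear i : linear (fun p : A (i - 1) * B i =>
  (- diff A (i - 1) p.1, diff B i p.2 + f (i - 1) p.1)
  : A (i - 1 - 1) * B (i - 1)).
Proof.
move=> a [x y] [z t] /=; congr (_, _).
  by rewrite linearP opprD -scalerN.
by rewrite /= !linearP scalerDr addrACA.
Qed.

Program Definition cone : complex :=
  @Complex (fun i => (A (i - 1) * B i)%type : lmodType R)
    (fun i => lin_of (@cone_linear i)) _.
Next Obligation.
rewrite linearD /= diffK add0r -cmapP (linearN (f (i - 1 - 1))) subrr.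
by rewrite (linearN (diff A (i - 1 - 1))) diffK !oppr0.
Qed.

Lemma cone_in_linear i : linear (fun y : B i => (0, y) : A (i - 1) * B i).
Proof. by move=> a x y; congr (_, _); rewrite /= scaler0 addr0. Qed.

Program Definition cone_in : chain_map B cone :=
  @ChainMap B cone (fun i => lin_of (@cone_in_linear i)) _.
Next Obligation.
by rewrite (linear0 (diff A (i - 1))) (linear0 (f (i - 1))) oppr0 addr0.
Qed.

Lemma cone_out_linear i : linear (fun p : A (i - 1) * B i => p.1).
Proof. by []. Qed.

Program Definition cone_out : chain_map cone (shift A) :=
  @ChainMap cone (shift A) (fun i => lin_of (@cone_out_linear i)) _.

End MappingCone.

(* Morphisms X -> Y of the derived category: roofs X <- Z -> Y whose left leg
   is a quasi-isomorphism, taken up to [dmor_eq]. *)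
Record dmor (X Y : complex) := DMor {
  apex : complex;
  left_leg : chain_map apex X;
  right_leg : chain_map apex Y;
  left_legP : quasi_iso left_leg }.

Definition dmor_eq (X Y : complex) (f g : dmor X Y) : Prop :=
  exists W (u : chain_map W (apex f)) (v : chain_map W (apex g)),
    [/\ quasi_iso (ccomp (left_leg f) u),
        homotopic (ccomp (left_leg f) u) (ccomp (left_leg g) v) &
        homotopic (ccomp (right_leg f) u) (ccomp (right_leg g) v)].

Lemma quasi_iso_id (A : complex) : quasi_iso (cid_map A).
Proof.
apply/quasi_isoP => i; split=> // w dw; exists w => //.
by rewrite /= subrr; exact: boundary0.
Qed.

Lemma quasi_iso_comp (A B C : complex) (g : chain_map B C) (f : chain_map A B) :
  quasi_iso g -> quasi_iso f -> quasi_iso (ccomp g f).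
Proof.
move=> /quasi_isoP qg /quasi_isoP qf; apply/quasi_isoP => i.
have [gi gs] := qg i; have [fi fs] := qf i; split=> [z dz /gi h|w dw].
  by apply: fi => //; apply: h; rewrite -cmapP dz linear0.
have [y dy gy] := gs w dw; have [z dz fz] := fs y dy; exists z => //=.
rewrite -[g i _](subrK (g i y)) -raddfB -addrA -[X in boundary (X + _)]scale1r.
by apply: boundaryZD => //; exact: cmap_boundary.
Qed.

Lemma shift_boundary (M : complex) i (z : shift M i) :
  boundary z <-> boundary (z : M (i - 1)).
Proof.
have e : i = i + 1 - 1 by rewrite addrK.
suff H j : forall z : shift M (j - 1),
    boundary z <-> boundary (z : M (j - 1 - 1)).
  by move: z; rewrite e; exact: H.
move=> {e} w; rewrite !boundaryE; split=> -[y <-]; exists (- y) => /=.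
  by rewrite linearN.
by rewrite linearN opprK.
Qed.

Lemma quasi_iso_shift (A B : complex) (f : chain_map A B) :
  quasi_iso f -> quasi_iso (shift_map f).
Proof.
move=> /quasi_isoP qf; apply/quasi_isoP => i; have [fi fs] := qf (i - 1).
split=> [z /eqP dz|w /eqP dw].
  by rewrite !shift_boundary; apply: fi; apply/eqP; rewrite -oppr_eq0.
have [|z dz bz] := fs w; first by apply/eqP; rewrite -oppr_eq0.
by exists z; [rewrite /= dz oppr0 | rewrite shift_boundary].
Qed.

Definition dmor_of (A B : complex) (f : chain_map A B) : dmor A B :=
  DMor f (quasi_iso_id A).

Definition dmor_id (A : complex) : dmor A A := dmor_of (cid_map A).

Definition dmor_shift (X Y : complex) (f : dmor X Y) :
  dmor (shift X) (shift Y) :=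
  DMor (shift_map (right_leg f)) (quasi_iso_shift (left_legP f)).

(* [dmor_comp g f h]: h is the composite g \o f, obtained by completing the two
   roofs to a homotopy-commutative square. *)
Definition dmor_comp (X Y Z : complex) (g : dmor Y Z) (f : dmor X Y)
    (h : dmor X Z) : Prop :=
  exists W (t : chain_map W (apex f)) (k : chain_map W (apex g))
    (qt : quasi_iso t),
    homotopic (ccomp (right_leg f) t) (ccomp (left_leg g) k) /\
    dmor_eq h (DMor (ccomp (right_leg g) k)
                 (quasi_iso_comp (left_legP f) qt)).

Definition dmor_iso (X Y : complex) (f : dmor X Y) : Prop :=
  exists g : dmor Y X,
    dmor_comp g f (dmor_id X) /\ dmor_comp f g (dmor_id Y).

Definition diso (X Y : complex) : Prop := exists f : dmor X Y, dmor_iso f.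

Definition dsquare (X Y X' Y' : complex) (f : dmor X Y) (f' : dmor X' Y')
    (a : dmor X X') (b : dmor Y Y') : Prop :=
  exists h : dmor X Y', dmor_comp b f h /\ dmor_comp f' a h.

(* A triangle is distinguished when it is isomorphic in the derived category to
   the triangle A -> B -> cone phi -> shift A of some chain map phi. *)
Definition distinguished (X Y Z : complex)
    (f : dmor X Y) (g : dmor Y Z) (h : dmor Z (shift X)) : Prop :=
  exists (A B : complex) (phi : chain_map A B)
    (a : dmor A X) (b : dmor B Y) (c : dmor (cone phi) Z),
    [/\ dmor_iso a, dmor_iso b & dmor_iso c] /\
    [/\ dsquare (dmor_of phi) f a b,
        dsquare (dmor_of (cone_in phi)) g b c &
        dsquare (dmor_of (cone_out phi)) h c (dmor_shift a)].

Section Level.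
Variable C : complex -> Prop.

(* [thick1_iso] and [thick1_unshift] together give closure under the inverse
   shift; [thick1_zero] is the empty direct sum. *)
Inductive thick1 : complex -> Prop :=
| thick1_in X : C X -> thick1 X
| thick1_iso X Y : diso X Y -> thick1 X -> thick1 Y
| thick1_shift X : thick1 X -> thick1 (shift X)
| thick1_unshift X : thick1 (shift X) -> thick1 X
| thick1_zero : thick1 zero_complex
| thick1_sum X Y : thick1 X -> thick1 Y -> thick1 (csum X Y)
| thick1_summand X Y : thick1 (csum X Y) -> thick1 X.

Fixpoint thick (n : nat) (M : complex) : Prop :=
  match n with
  | 0 => diso M zero_complex
  | 1 => thick1 M
  | n'.+1 => exists (K L N : complex) (f : dmor K (csum L M))
      (g : dmor (csum L M) N) (h : dmor N (shift K)),
      [/\ distinguished f g h, thick1 K & thick n' N]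
  end.

Definition level (M : complex) : option nat := einf (thick ^~ M).

End Level.

Definition bounded_fg_homology (M : complex) : Prop :=
  (exists n : nat, forall i : int, (n < `|i|)%N ->
     forall x : homology M i, x = 0) /\
  (forall i, fin_gen (homology M i)).

Definition total_homology (M : complex) : lmodType R := dsum (homology M).

(* Homological grading: an injective resolution of length [n] lives in degrees
   [- n] to [0]. *)
Definition injective_resolution (N : lmodType R) (I : complex) (n : nat) :=
  (exists e : chain_map (stalk N) I, quasi_iso e) /\
  forall i, injective_module (I i) /\
    (~~ (- n%:Z <= i <= 0) -> forall x : I i, x = 0).

Definition inj_dim (N : lmodType R) : option nat :=
  einf (fun n => exists I, injective_resolution N I n).

Definition injectives (X : complex) : Prop :=
  exists I : lmodType R, injective_module I /\ X = stalk I.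

End Complexes.

(* Main.v *)
(** Lower bound: for a regular sequence [x_1, ..., x_n] in the maximal ideal, let
    [koszul j M] be the [j]-fold iterated mapping cone of the homotheties
    [x_1, ..., x_j].  When all [H_i M] are injective modules, [x_(j+1)] acts
    surjectively on [H (koszul j M)], so [koszul j M -> koszul j.+1 M] vanishes in
    homology; by the ghost lemma [M -> koszul n M] vanishes in homology for every
    [M] of level at most [n].  In the lowest degree [i] with [H_i M <> 0], however,
    its kernel lies in [m H_i M], which is proper by Nakayama's lemma.

    Upper bound: let [N] be the total homology, [J] a finite injective resolution
    of it and [d] the depth.  As in Bass's formula [id N = d], one shows
    [Ext^(j+1) (R / a, N) = 0] for all [j >= d] and all ideals [a] by noetherian
    induction on [a] (Nakayama's lemma when some [x] in the maximal ideal is regular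
    on [R / a], an exact sequence otherwise, and a socle element modulo a maximal
    regular sequence for [R / m]), so that the [d]-th cocycles of [J] are injective
    by Baer's criterion.  Hence every [H_i M] has injective dimension at most [d].
    Embedding the homology of [M] into injective modules and iterating on the cone
    then builds [M] from [d + 1] objects of [thick1]. *)

From HB Require Import structures.
From mathcomp Require Import all_boot all_order all_algebra.
From mathcomp Require Import boolp classical_sets.
From mathcomp Require Import ring zify.
Require Import Defs.

Set Implicit Arguments.
Unset Strict Implicit.
Unset Printing Implicit Defensive.

Import Order.TTheory GRing.Theory Num.Theory.
Local Open Scope ring_scope.
Local Open Scope quotient_scope.

(** * Modules and injective dimension *)


(** The ghost lemma runs on concrete data: [koszul] is a functor on complexes that preserves
    quasi-isomorphisms, so a roof acts on the homology of Koszul complexes by inverting its left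
    leg. Surjectivity of x_(j+1) on this homology persists because H (koszul j M) is injective over
    R / (x_1, ..., x_j), and passing to the kernel of x_(j+1) gives injectivity over the next
    quotient.

    In the upper bound, Nakayama's lemma requires Ext (R / a, N) to be finitely generated. The
    dimension shift that proves this passes from R / a to its syzygies, hence it is done for all
    finitely generated modules R^r / B. Ext itself appears as cocycles of J modulo coboundaries.

    A map from the homology of M to injective modules extends to a chain map from M itself to a
    complex with zero differential. Iterating on the cone presents M with its pieces in [thick1]
    split off as quotients, whereas [thick] wants them as the first term of a triangle. An
    octahedral exchange of coordinates in iterated cones reorders them, and an Ore square turns the
    resulting maps into roofs that end in M. *)

Section Modules.
Variable R : comNzRingType.
Implicit Types U V W I J C N : lmodType R.

Definition submod V (S : set V) : Prop :=
  S 0 /\ forall a x y, S x -> S y -> S (a *: x + y).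

Lemma submodD V (S : set V) x y : submod S -> S x -> S y -> S (x + y).
Proof. by move=> hS Sx Sy; rewrite -[x]scale1r; apply: hS.2. Qed.

Lemma submodZ V (S : set V) a x : submod S -> S x -> S (a *: x).
Proof. by move=> hS Sx; rewrite -[_ *: _]addr0; apply: hS.2 => //; apply: hS.1. Qed.

Lemma submodB V (S : set V) x y : submod S -> S x -> S y -> S (x - y).
Proof. by move=> hS Sx Sy; rewrite addrC -scaleN1r; apply: hS.2. Qed.

Lemma quotient_ex V (S : set V) : submod S ->
  exists (Q : lmodType R) (p : {linear V -> Q}),
    (forall q, exists v, p v = q) /\ forall v, p v = 0 <-> S v.
Proof.
move=> hS; pose P : pred V := fun v => `[< S v >].
have hP : submod_closed P.
  split=> [|a x y]; rewrite !unfold_in /P; first by apply/asboolP; exact: hS.1.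
  by move=> /asboolP Sx /asboolP Sy; apply/asboolP; exact: hS.2.
have lp : linear (fun v => \pi_(quotmod hP) v).
  by move=> a x y; rewrite pi_addE -pi_scale.
exists (quotmod hP), (lin_of lp); split=> [q|v].
  by elim/quot_ind: q => v; exists v.
have -> : 0 = \pi_(quotmod hP) 0 :> quotmod hP by have /= -> := linear0 (lin_of lp).
split=> [/quot_eqP|Sv]; first by rewrite subr0 => /asboolP.
by apply/quot_eqP; rewrite subr0; apply/asboolP.
Qed.

Lemma surj_factor V U W (p : {linear V -> U}) (g : {linear V -> W}) :
  (forall u, exists v, p v = u) -> (forall v, p v = 0 -> g v = 0) ->
  exists h : {linear U -> W}, forall v, h (p v) = g v.
Proof.
move=> /choice[s sK] pg.
have gp v : g (s (p v)) = g v.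
  by apply/subr0_eq; rewrite -linearB; apply: pg; rewrite linearB sK subrr.
have lh : linear (fun u => g (s u)).
  by move=> a x y; rewrite -linearP -[RHS]gp linearP !sK.
by exists (lin_of lh).
Qed.

(** Both maps factor through U / ker f, on which [f] becomes injective. *)
Lemma inj_ext V U I (f : {linear U -> V}) (g : {linear U -> I}) :
  injective_module I -> (forall u, f u = 0 -> g u = 0) ->
  exists h : {linear V -> I}, forall u, h (f u) = g u.
Proof.
move=> injI fg; have hS : submod [set u | f u = 0].
  split=> [|a x y /= fx fy]; first by rewrite /= linear0.
  by rewrite linearP fx fy scaler0 addr0.
have [Q [p [psurj pE]]] := quotient_ex hS.
have [|f' f'p] := @surj_factor _ _ _ p f psurj; first by move=> v /pE.
have [|g' g'p] := @surj_factor _ _ _ p g psurj; first by move=> v /pE/fg.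
have f'inj : injective f'.
  move=> x y; have [u <-] := psurj x; have [v <-] := psurj y.
  rewrite !f'p => e; apply/subr0_eq; rewrite -linearB; apply/pE.
  by rewrite /= linearB e subrr.
have [h hf] := injI _ _ f' g' f'inj.
by exists h => u; rewrite -f'p hf g'p.
Qed.

(** Stands in for isomorphism throughout: injectivity, vanishing and bounds on injective dimension
    all descend to retracts. *)
Definition retract V W : Prop :=
  exists (i : {linear V -> W}) (r : {linear W -> V}), cancel i r.

Lemma retract_injective V I : retract V I -> injective_module I -> injective_module V.
Proof.
move=> [i [r iK]] injI A B f g injf.
have [h hf] := injI A B f (i \o g) injf.
by exists (r \o h) => a /=; rewrite hf /= iK.
Qed.

Lemma lin_bij_retract V W (f : {linear V -> W}) :
  injective f -> (forall w, exists v, f v = w) -> retract V W /\ retract W V.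
Proof.
move=> finj /[dup] fsurj /choice[s sK].
have [|h hf] := @surj_factor V W V f idfun fsurj.
  by move=> v fv /=; apply: finj; rewrite fv linear0.
split; first by exists f, h.
by exists h, f => w; rewrite -(sK w) hf.
Qed.

Lemma bij_ker0_retract V W (f : {linear V -> W}) :
  (forall v, f v = 0 -> v = 0) -> (forall w, exists v, f v = w) ->
  retract V W /\ retract W V.
Proof.
move=> f0; apply: lin_bij_retract => x y e.
by apply/subr0_eq/f0; rewrite linearB e subrr.
Qed.

Lemma cokernel_retract V U W (p : {linear V -> U}) (q : {linear V -> W}) :
  (forall u, exists v, p v = u) -> (forall u, exists v, q v = u) ->
  (forall v, p v = 0 <-> q v = 0) -> retract W U.
Proof.
move=> psurj qsurj pq.
have [|h hp] := surj_factor psurj (g := q); first by move=> v /pq.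
have [|k kq] := surj_factor qsurj (g := p); first by move=> v /pq.
by exists k, h => w; have [v <-] := qsurj w; rewrite kq hp.
Qed.

Lemma retract_zero V W : retract V W -> (forall w : W, w = 0) -> forall v : V, v = 0.
Proof. by move=> [i [r iK]] W0 v; rewrite -(iK v) (W0 (i v)) linear0. Qed.

Lemma zero_injective V : (forall v : V, v = 0) -> injective_module V.
Proof.
move=> V0 A B f g _; exists (lin_of (@zero_linear R B V)) => a /=.
by rewrite [RHS]V0.
Qed.

Lemma pair_linear U V W (f : {linear U -> V}) (g : {linear U -> W}) :
  linear (fun u => (f u, g u) : V * W).
Proof. by move=> a x y; rewrite !linearP. Qed.

Lemma copair_linear U V W (f : {linear U -> W}) (g : {linear V -> W}) :
  linear (fun p : U * V => f p.1 + g p.2).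
Proof. by move=> a x y; rewrite /= !linearP scalerDr addrACA. Qed.

Lemma fst_linear U V : linear (fun p : U * V => p.1).
Proof. by []. Qed.
Lemma snd_linear U V : linear (fun p : U * V => p.2).
Proof. by []. Qed.

Lemma prod_injective I J :
  injective_module I -> injective_module J -> injective_module (I * J)%type.
Proof.
move=> injI injJ A B f g injf.
have [h hf] := injI A B f (lin_of (@fst_linear I J) \o g) injf.
have [k kf] := injJ A B f (lin_of (@snd_linear I J) \o g) injf.
by exists (lin_of (pair_linear h k)) => a /=; rewrite hf kf /=; case: (g a).
Qed.

(** Injective dimension at most [n], by cosyzygies instead of whole resolutions, so that bounds are
    proved by induction on [n]. *)
Fixpoint id_le (n : nat) V : Prop :=
  if n is n'.+1 then
    exists (I C : lmodType R) (e : {linear V -> I}) (p : {linear I -> C}),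
      [/\ injective_module I, injective e, forall c, exists y, p y = c,
          forall y, p y = 0 <-> exists v, e v = y & id_le n' C]
  else injective_module V.

Lemma id_le_prod n C I : id_le n C -> injective_module I -> id_le n (C * I)%type.
Proof.
case: n => [|n] /=; first exact: prod_injective.
move=> [J [D [e [p [injJ inje psurj pE dD]]]]] injI.
exists (J * I)%type, D.
exists (lin_of (pair_linear (e \o lin_of (@fst_linear C I)) (lin_of (@snd_linear C I)))).
exists (p \o lin_of (@fst_linear J I)); split=> //=.
- exact: prod_injective.
- by move=> [x y] [z t] /= [/inje -> ->].
- by move=> c; have [y <-] := psurj c; exists (y, 0).
- move=> [y t] /=; split; first by move=> /pE[v <-]; exists (v, t).
  by move=> [[v t'] /= [<- _]]; apply/pE; exists v.
Qed.

(* Schanuel's lemma for a retract [r \o i = id]: with [eps] extending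
   [e \o i \o r] to [I], the map [y |-> (p y, y - eps y)] exhibits [I / V] as a
   retract of [C * I]. *)
Lemma id_le_retract n V N : retract V N -> id_le n N -> id_le n V.
Proof.
elim: n V N => [|n IH] V N; first exact: retract_injective.
move=> [i [r iK]] /= [I [C [e [p [injI inje psurj pE dC]]]]].
have [eps epsE] := injI _ _ e (e \o i \o r) inje.
have hS : submod [set y | exists v, e (i v) = y].
  split=> [|a x y [u <-] [v <-]]; first by exists 0; rewrite !linear0.
  by exists (a *: u + v); rewrite !linearP.
have [D [q [qsurj qE]]] := quotient_ex hS.
exists I, D, (e \o i), q; split=> //.
  by apply: inj_comp => //; exact: can_inj iK.
apply: (IH _ (C * I)%type); last exact: id_le_prod.
have lk : linear (fun y => y - eps y).
  by move=> a x y; rewrite linearP scalerBr opprD addrACA.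
have [|k kq] := @surj_factor _ _ (C * I)%type q (lin_of (pair_linear p (lin_of lk))) qsurj.
  move=> y /qE[v <-] /=; rewrite epsE /= iK subrr.
  by congr (_, _); apply/pE; exists (i v).
have [|s sp] := @surj_factor _ _ D p (q \o eps) psurj.
  move=> y /pE[v <-] /=; apply/qE; exists (r v).
  by rewrite epsE.
(* The retraction is (c, y) |-> s c + q y: on k (q y) it gives q (eps y) + q (y - eps y) = q y. *)
exists k, (lin_of (copair_linear s q)) => d; have [y <-] := qsurj d.
by rewrite kq /= sp /= linearB addrC subrK.
Qed.

Lemma id_le_zero n V : (forall v : V, v = 0) -> id_le n V.
Proof.
elim: n V => [|n IH] V V0; first exact: zero_injective.
exists V, V, idfun, idfun; split=> //; first exact: zero_injective.
- by move=> c; exists c.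
- by move=> y; split=> [_|_]; [exists y | exact: V0].
- exact: IH.
Qed.

(** Choosing I = 0 when V = 0 keeps the complex of injectives picked degree by degree in
    [adams_step] bounded. *)
Lemma id_le_step n V : id_le n.+1 V ->
  exists (I C : lmodType R) (e : {linear V -> I}) (p : {linear I -> C}),
    [/\ injective_module I, injective e, forall c, exists y, p y = c,
        forall y, p y = 0 <-> exists v, e v = y & id_le n C] /\
    ((forall v : V, v = 0) -> forall y : I, y = 0).
Proof.
case: (pselect (forall v : V, v = 0)) => [V0 _|V0]; last first.
  by move=> [I [C [e [p h]]]]; exists I, C, e, p; split.
exists V, V, idfun, idfun; split=> //; split=> //.
- exact: zero_injective.
- by move=> c; exists c.
- by move=> y; split=> [_|_]; [exists y | exact: V0].
- exact: id_le_zero.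
Qed.

End Modules.

(** * Noetherian local rings *)


Section Span.
Variables (R : comNzRingType) (V : lmodType R).
Implicit Types (s t : seq V) (S : set V).

(** Recursive, so that arguments can remove one generator at a time; [lspanE] gives back the indexed
    sums of [fin_gen] and [ideal_gen]. *)
Fixpoint lspan s : set V :=
  if s is v :: s' then [set u | exists c w, lspan s' w /\ u = c *: v + w]
  else [set 0].

Lemma submod_sum S n (F : 'I_n -> V) :
  submod S -> (forall i, S (F i)) -> S (\sum_i F i).
Proof.
move=> hS SF; elim/big_ind: _ => //; first exact: hS.1.
by move=> x y; exact: submodD.
Qed.

Lemma lspanE s u : lspan s u <-> exists c : 'I_(size s) -> R, u = \sum_i c i *: s`_i.
Proof.
elim: s u => [|v s IH] u /=.
  split=> [->|[c ->]]; last by rewrite big_ord0.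
  by exists (fun=> 0); rewrite big_ord0.
split=> [[c [w [/IH[c' ->] ->]]]|[c ->]]; last first.
  rewrite big_ord_recl /=; exists (c ord0), (\sum_(i < size s) c (lift ord0 i) *: s`_i).
  by split=> //; apply/IH; exists (fun i => c (lift ord0 i)).
exists (fun i => if unlift ord0 i is Some j then c' j else c).
rewrite big_ord_recl unlift_none /=; congr (_ + _).
by apply: eq_bigr => i _; rewrite liftK.
Qed.

Lemma lspan_submod s : submod (lspan s).
Proof.
elim: s => [|v s IH]; first by split=> [|a x y -> ->] //=; rewrite scaler0 addr0.
split=> [|a x y [c [w [sw ->]]] [c' [w' [sw' ->]]]].
  by exists 0, 0; split; [exact: IH.1 | rewrite scale0r addr0].
exists (a * c + c'), (a *: w + w'); split; first exact: IH.2.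
by rewrite scalerDr scalerDl addrACA scalerA.
Qed.

Lemma lspan_mem s v : v \in s -> lspan s v.
Proof.
elim: s => // w s IH; rewrite inE => /predU1P[->|/IH sv].
  by exists 1, 0; split; [exact: (lspan_submod s).1 | rewrite scale1r addr0].
by exists 0, v; rewrite scale0r add0r.
Qed.

Lemma lspan_min S s : submod S -> (forall v, v \in s -> S v) -> (lspan s `<=` S)%classic.
Proof.
move=> hS; elim: s => [_ v ->|w s IH hs v [c [u [su ->]]]]; first exact: hS.1.
apply: hS.2; first by apply: hs; rewrite mem_head.
by apply: IH => // x xs; apply: hs; rewrite inE xs orbT.
Qed.

Lemma lspan_sub s t : {subset s <= t} -> (lspan s `<=` lspan t)%classic.
Proof.
by move=> st; apply: lspan_min; [exact: lspan_submod | move=> v /st/lspan_mem].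
Qed.

End Span.

Section Noetherian.
Variables (R : comNzRingType) (R_noetherian : noetherian R).
Implicit Types (I J : set R).

Lemma ideal_genE (s : seq R) : ideal_gen s = lspan (s : seq R^o).
Proof. by apply/seteqP; split=> x /= /(lspanE (s : seq R^o)). Qed.

Lemma ideal_gen_ideal (s : seq R) : is_ideal (ideal_gen s).
Proof. by rewrite ideal_genE; exact: lspan_submod. Qed.

Lemma ideal_submod I : is_ideal I -> submod (I : set R^o).
Proof. by []. Qed.

Lemma ideal_mull I a x : is_ideal I -> I x -> I (a * x).
Proof. by move=> /ideal_submod hI Ix; exact: (@submodZ _ R^o I a x). Qed.

Lemma ideal_mulr I a x : is_ideal I -> I x -> I (x * a).
Proof. by move=> hI Ix; rewrite mulrC; exact: ideal_mull. Qed.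

Lemma ideal_add I x y : is_ideal I -> I x -> I y -> I (x + y).
Proof. by move=> /ideal_submod; exact: submodD. Qed.

Lemma ideal_sub I x y : is_ideal I -> I x -> I y -> I (x - y).
Proof. by move=> /ideal_submod; exact: submodB. Qed.

Lemma ideal_gen_min I (s : seq R) :
  is_ideal I -> (forall x, x \in s -> I x) -> (ideal_gen s `<=` I)%classic.
Proof. by rewrite ideal_genE => hI; exact: (@lspan_min R R^o I s). Qed.

Lemma ideal_gen_mem (s : seq R) x : x \in s -> ideal_gen s x.
Proof. by rewrite ideal_genE; exact: (@lspan_mem R R^o). Qed.

(** Otherwise choice yields a strictly increasing chain of counterexamples; generators of its union
    already lie in one term, where the chain stops growing. *)
Lemma noetherian_ind (P : set R -> Prop) :
  (forall I, is_ideal I ->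
    (forall J, is_ideal J -> (I `<=` J)%classic -> J <> I -> P J) -> P I) ->
  forall I, is_ideal I -> P I.
Proof.
move=> step I0 hI0; apply: contrapT => nP0.
pose T := {I | is_ideal I /\ ~ P I}.
have next (t : T) : exists t' : T, (sval t `<=` sval t')%classic /\ sval t' <> sval t.
  case: t => I [hI nPI] /=; apply: contrapT => no; apply: nPI.
  apply: step => // J hJ IJ JI; apply: contrapT => nPJ; apply: no.
  by exists (exist _ J (conj hJ nPJ)).
have [f fP] := choice next.
pose F n := sval (iter n f (exist _ I0 (conj hI0 nP0))).
have Fid n : is_ideal (F n) by rewrite /F; case: (iter _ _ _) => I [].
have Fle n k : (n <= k)%N -> (F n `<=` F k)%classic.
  elim: k => [|k IH]; first by rewrite leqn0 => /eqP ->.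
  rewrite leq_eqVlt => /predU1P[->//|/IH nk] x /nk; exact: (fP _).1.
pose U : set R := [set x | exists n, F n x]%classic.
have hU : is_ideal U.
  split=> [|a x y [n Fx] [k Fy]]; first by exists 0%N; exact: (Fid 0%N).1.
  exists (maxn n k); apply: (Fid _).2.
    by apply: Fle Fx; exact: leq_maxl.
  by apply: Fle Fy; exact: leq_maxr.
have [s Us] := R_noetherian hU.
have [K sK] : exists K, forall x, x \in s -> F K x.
  have : forall x, x \in s -> U x by move=> x; rewrite Us; exact: ideal_gen_mem.
  elim: (s) => [|y t IH] h; first by exists 0%N.
  have [K tK] := IH (fun x xt => h x (mem_behead (s := y :: t) xt)).
  have [n Fy] := h y (mem_head _ _); exists (maxn n K) => x.
  rewrite inE => /predU1P[->|/tK Fx]; first exact: Fle (leq_maxl _ _) _ Fy.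
  exact: Fle (leq_maxr _ _) _ Fx.
have UK : (U `<=` F K)%classic by rewrite Us; exact: ideal_gen_min.
apply: (fP (iter K f (exist _ I0 (conj hI0 nP0)))).2.
rewrite -[RHS]/(F K) -[LHS]/(F K.+1); apply/seteqP; split; last exact: Fle.
by move=> x Fx; apply: UK; exists K.+1.
Qed.

(** Induction on [s]: the coefficients of [v] in elements of S form an ideal. Lifts of its
    generators to S, together with generators of the part of S inside [lspan s], generate S. *)
Lemma noetherian_submod (V : lmodType R) (s : seq V) (S : set V) :
  submod S -> (S `<=` lspan s)%classic -> exists t, S = lspan t.
Proof.
elim: s S => [|v s IH] S hS Ss.
  by exists [::]; apply/seteqP; split=> // x ->; exact: hS.1.
pose I : set R := [set c | exists2 w, lspan s w & S (c *: v + w)]%classic.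
have hI : is_ideal I.
  split=> [|a x y [w sw Sw] [w' sw' Sw']].
    by exists 0; [exact: (lspan_submod s).1 | rewrite scale0r addr0; exact: hS.1].
  exists (a *: w + w'); first exact: (lspan_submod s).2.
  by rewrite scalerDl addrACA -scalerA -scalerDr; exact: hS.2.
have [||t St] := IH [set w | S w /\ lspan s w]%classic; last 1 first.
- have [g Ig] := R_noetherian hI.
  have lift x : exists w, I x -> lspan s w /\ S (x *: v + w).
    by case: (pselect (I x)) => [[w ? ?]|?]; [exists w | exists 0].
  have [f fP] := choice lift.
  have fS x : x \in g -> lspan s (f x) /\ S (x *: v + f x).
    by move=> xg; apply: fP; rewrite Ig; exact: ideal_gen_mem.
  exists ([seq x *: v + f x | x <- g] ++ t); apply/seteqP; split; last first.
    apply: lspan_min => // y; rewrite mem_cat => /orP[/mapP[x xg ->]|yt].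
      exact: (fS x xg).2.
    by have [] : [set w | S w /\ lspan s w]%classic y by rewrite St; exact: lspan_mem.
  move=> y /[dup] Sy /Ss[c [w [sw yE]]].
  have : I c by exists w; rewrite -?yE.
  rewrite Ig => -[k cE].
  (* [z] has the same coefficient [c] at [v] as [y], so [y - z] falls into [lspan s]. *)
  pose z := \sum_i k i *: (g`_i *: v + f g`_i).
  have zt : lspan ([seq x *: v + f x | x <- g] ++ t) z.
    apply: submod_sum => [|i]; first exact: lspan_submod.
    apply: submodZ; first exact: lspan_submod.
    by apply: lspan_mem; rewrite mem_cat (map_f (fun x => x *: v + f x)) // mem_nth.
  have Sz : S z.
    apply: submod_sum => // i; apply: submodZ => //; apply: (fS _ _).2; exact: mem_nth.
  have sz : lspan s (z - c *: v).
    rewrite cE scaler_suml -sumrB.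
    apply: submod_sum => [|i]; first exact: lspan_submod.
    rewrite scalerDr scalerA addrC addKr.
    apply: submodZ; first exact: lspan_submod.
    by apply: (fS _ _).1; exact: mem_nth.
  rewrite -[y](subrK z); apply: submodD => //; first exact: lspan_submod.
  apply: (@lspan_sub _ _ t); first by move=> x xt; rewrite mem_cat xt orbT.
  rewrite -St /=; split; first exact: submodB.
  have -> : y - z = w - (z - c *: v) by rewrite yE opprB addrA [w + _]addrC.
  by apply: submodB => //; exact: lspan_submod.
- split=> [|a x y /= [Sx sx] [Sy sy]]; split; first exact: hS.1.
  + exact: (lspan_submod s).1.
  + exact: hS.2.
  + exact: (lspan_submod s).2.
- by move=> x [].
Qed.

End Noetherian.

Section Local.
Variables (R : comNzRingType) (m : set R).
Hypotheses (R_noetherian : noetherian R) (R_local : local_with m).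
Implicit Types (I J : set R).

Lemma local_max : maximal_ideal m. Proof. exact/R_local. Qed.
Lemma local_ideal : is_ideal m. Proof. by have [] := local_max. Qed.
Lemma local_proper : ~ m 1. Proof. by have [] := local_max. Qed.

(** Noetherian induction replaces Zorn's lemma: a proper ideal is maximal or strictly contained in a
    larger proper one. *)
Lemma proper_sub_local I : is_ideal I -> ~ I 1 -> (I `<=` m)%classic.
Proof.
move: I; apply: (noetherian_ind R_noetherian) => I hI IH I1.
case: (pselect (maximal_ideal I)) => [/R_local -> //|nmax].
apply: contrapT => nsub; apply: nmax; split=> // J hJ J1 IJ.
by apply: contrapT => JI; apply: nsub => x /IJ; exact: IH.
Qed.

Lemma local_unit a : m a -> exists b, b * (1 - a) = 1.
Proof.
move=> ma; pose I : set R := [set x | exists b, x = b * (1 - a)]%classic.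
have hI : is_ideal I.
  split=> [|c x y [b ->] [b' ->]]; first by exists 0; rewrite mul0r.
  by exists (c * b + b'); rewrite [RHS]mulrDl mulrA.
case: (pselect (I 1)) => [[b e]|nI1]; first by exists b.
case: local_proper; rewrite -[1](subrK a); apply: (ideal_add local_ideal) => //.
by apply: (proper_sub_local hI nI1); exists 1; rewrite mul1r.
Qed.

Lemma nakayama (V : lmodType R) (S U0 : set V) (s : seq V) :
  submod S -> submod U0 -> (U0 `<=` S)%classic ->
  (forall v, v \in s -> S v) ->
  (forall v, S v -> exists2 u, U0 u & lspan s (v - u)) ->
  ~ (S `<=` U0)%classic ->
  exists U, [/\ submod U, (U0 `<=` U)%classic, exists2 v, S v & ~ U v &
    forall a v, m a -> S v -> U (a *: v)].
Proof.
move=> hS hU US; elim: s => [|v s IH] sS gen nS.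
  by case: nS => x /gen[u Uu /subr0_eq ->].
pose W : set V := [set x | exists a u t, [/\ m a, U0 u, lspan s t & x = a *: v + (u + t)]]%classic.
have hs := lspan_submod s; have hm := local_ideal.
have hW : submod W.
  split=> [|c x y [a [u [t [ma Uu st ->]]]] [a' [u' [t' [ma' Uu' st' ->]]]]].
    exists 0, 0, 0; split; [exact: hm.1 | exact: hU.1 | exact: hs.1 |].
    by rewrite scale0r !addr0.
  exists (c * a + a'), (c *: u + u'), (c *: t + t').
  split; [exact: hm.2 | exact: hU.2 | exact: hs.2 |].
  by rewrite !scalerDr scalerDl scalerA addrACA [in RHS](addrACA (c *: u)).
case: (pselect (W v)) => [|nW]; last first.
  exists W; split=> //.
  - move=> u Uu; exists 0, u, 0; split=> //; [exact: hm.1 | exact: hs.1 |].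
    by rewrite scale0r add0r addr0.
  - by exists v => //; apply: sS; rewrite mem_head.
  - move=> a x ma /gen[u Uu [c [w [sw /(canRL (subrK _)) ->]]]].
    exists (a * c), (a *: u), (a *: w); split.
    + exact: ideal_mulr.
    + exact: submodZ.
    + exact: submodZ.
    + by rewrite !scalerDr scalerA -addrA [a *: w + _]addrC.
move=> [a [u [t [ma Uu st vE]]]].
have [b bE] := local_unit ma.
have {}vE : v = b *: u + b *: t.
  by rewrite -scalerDr -[LHS]scale1r -bE -scalerA scalerBl scale1r {1}vE addrC addKr.
apply: IH => //; first by move=> x xs; apply: sS; rewrite inE xs orbT.
move=> x /gen[u' Uu' [c [w [sw xE]]]].
exists (u' + (c * b) *: u); first by apply: submodD => //; exact: submodZ.
rewrite opprD addrA xE vE scalerDr !scalerA addrC addrA addKr.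
by apply: submodD => //; exact: submodZ.
Qed.

(** * Associated primes and socle elements of R / J *)

Section Socle.
Variable J : set R.
Hypotheses (hJ : is_ideal J).

Definition colon (s : R) : set R := [set x | J (x * s)]%classic.

Lemma colon_ideal s : is_ideal (colon s).
Proof.
split=> [|a x y Jx Jy]; rewrite /colon /=; first by rewrite mul0r; exact: hJ.1.
by rewrite mulrDl -mulrA; exact: hJ.2.
Qed.

(** [colon s] annihilates the class of [s] in R / J. The maximal annihilators of nonzero classes are
    the maximal associated primes of R / J. *)
Definition colon_max (s : R) : Prop :=
  ~ J s /\ forall t, ~ J t -> (colon s `<=` colon t)%classic -> colon t = colon s.

Lemma colon_max_ex s : ~ J s -> exists2 t, colon_max t & (colon s `<=` colon t)%classic.
Proof.
suff H : forall I, is_ideal I -> forall s, I = colon s -> ~ J s ->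
    exists2 t, colon_max t & (colon s `<=` colon t)%classic.
  by move=> ns; exact: (H _ (colon_ideal s)).
apply: (noetherian_ind R_noetherian) => I hI IH {}s IE ns.
case: (pselect (colon_max s)) => [smax|nmax]; first by exists s.
have [t [nt st ts]] : exists t, [/\ ~ J t, (colon s `<=` colon t)%classic & colon t <> colon s].
  apply: contrapT => no; apply: nmax; split=> // t nt st.
  by apply: contrapT => ts; apply: no; exists t.
have [||u umax tu] := IH (colon t) (colon_ideal t) _ _ t erefl nt.
- by rewrite IE.
- by rewrite IE.
by exists u => // x /st/tu.
Qed.

(** The class of y s is nonzero and its annihilator contains that of [s], so the two agree by
    maximality. *)
Lemma colon_max_prime s x y : colon_max s -> colon s (x * y) -> ~ colon s y -> colon s x.
Proof.
move=> [ns smax] sxy ny; rewrite -(smax (y * s)) => //; last first.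
  by move=> z /= Jz; rewrite /colon /= mulrCA; exact: ideal_mull.
by rewrite /colon /= mulrA.
Qed.

Lemma avoid_one (I : set R) s (t : seq R) :
  is_ideal I -> colon_max s -> ~ (I `<=` colon s)%classic ->
  (forall r, r \in t -> ~ (colon r `<=` colon s)%classic) ->
  exists y, [/\ I y, ~ colon s y & forall r, r \in t -> colon r y].
Proof.
move=> hI smax Is; elim: t => [_|r t IH ht].
  have [y Iy ny] : exists2 y, I y & ~ colon s y.
    by apply: contrapT => no; apply: Is => y Iy; apply: contrapT => ny; apply: no; exists y.
  by exists y; split.
have [|y [Iy ny yt]] := IH.
  by move=> u ut; apply: ht; rewrite inE ut orbT.
have [z rz nz] : exists2 z, colon r z & ~ colon s z.
  apply: contrapT => no; apply: (ht r (mem_head _ _)) => z rz.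
  by apply: contrapT => nz; apply: no; exists z.
exists (y * z); split; first exact: ideal_mulr.
  by move=> h; apply: ny; exact: colon_max_prime smax h nz.
move=> u; rewrite inE => /predU1P[->|/yt uy].
  by apply: ideal_mull => //; exact: colon_ideal.
by apply: ideal_mulr => //; exact: colon_ideal.
Qed.

(** If the [x] found for the tail lies in [colon s], it is corrected by an element outside [colon s]
    lying in all the other primes. *)
Lemma prime_avoidance (I : set R) (t : seq R) :
  is_ideal I -> (forall r, r \in t -> colon_max r /\ ~ (I `<=` colon r)%classic) ->
  exists2 x, I x & forall r, r \in t -> ~ colon r x.
Proof.
move=> hI; elim: t => [_|s t IH ht]; first by exists 0; [exact: hI.1|].
have [|x Ix xt] := IH; first by move=> r rt; apply: ht; rewrite inE rt orbT.
have [smax Is] := ht s (mem_head _ _).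
case: (pselect (colon s x)) => [sx|nsx]; last first.
  by exists x => // r; rewrite inE => /predU1P[->|/xt].
have [|y [Iy ny yt]] := avoid_one (t := t) hI smax Is.
  move=> r rt rs; apply: (xt r rt).
  have [rmax _] : colon_max r /\ ~ (I `<=` colon r)%classic.
    by apply: ht; rewrite inE rt orbT.
  by rewrite -(rmax.2 s smax.1 rs).
exists (x + y); first exact: ideal_add.
move=> r; rewrite inE => /predU1P[->|rt] h.
  apply: ny; rewrite -[y](addKr x) addrC.
  by apply: ideal_sub => //; exact: colon_ideal.
apply: (xt r rt); rewrite -[x](addrK y).
by apply: ideal_sub => //; [exact: colon_ideal | exact: yt].
Qed.

(** Every element of m annihilates a nonzero class, hence lies in some maximal annihilator. These
    are finitely many, so by prime avoidance m is contained in one of them. *)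
Lemma socle_ex : (forall x, m x -> exists2 a, ~ J a & J (x * a)) ->
  exists2 s, ~ J s & forall x, m x -> J (x * s).
Proof.
move=> zd.
pose K : set R := [set x | exists2 t : seq R, (forall r, r \in t -> colon_max r) & ideal_gen t x]%classic.
have gen_cat (t t' : seq R) x : ideal_gen t x -> ideal_gen (t ++ t') x /\ ideal_gen (t' ++ t) x.
  by rewrite !ideal_genE => tx; split; apply: (lspan_sub _ tx) => r rt; rewrite mem_cat rt ?orbT.
have hK : is_ideal K.
  split=> [|a x y [t tm tx] [t' t'm t'y]].
    by exists [::] => //; exact: (ideal_gen_ideal _).1.
  exists (t ++ t'); first by move=> r; rewrite mem_cat => /orP[/tm|/t'm].
  by apply: (ideal_gen_ideal _).2; [exact: (gen_cat t t' x tx).1 | exact: (gen_cat t' t y t'y).2].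
have [g Kg] := R_noetherian hK.
have [t tmax tK] : exists2 t : seq R, (forall r, r \in t -> colon_max r) & (K `<=` ideal_gen t)%classic.
  have : forall x, x \in g -> K x by move=> x; rewrite Kg; exact: ideal_gen_mem.
  have -> : (exists2 t : seq R, (forall r, r \in t -> colon_max r) & (K `<=` ideal_gen t)%classic)
    = (exists2 t : seq R, (forall r, r \in t -> colon_max r) & (forall x, x \in g -> ideal_gen t x)).
    apply/propext; split=> -[t tm h]; exists t => //.
      by move=> x xg; apply: h; rewrite Kg; exact: ideal_gen_mem.
    by rewrite Kg; apply: ideal_gen_min => //; exact: ideal_gen_ideal.
  elim: (g) => [|x g' IH] h; first by exists [::].
  have [|t tm tg] := IH; first by move=> y yg; apply: h; rewrite inE yg orbT.
  have [t' t'm t'x] := h x (mem_head _ _).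
  exists (t ++ t'); first by move=> r; rewrite mem_cat => /orP[/tm|/t'm].
  move=> y; rewrite inE => /predU1P[->|/tg ty]; first exact: (gen_cat t' t x t'x).2.
  exact: (gen_cat t t' y ty).1.
(* Finiteness: if [colon s] were none of the [colon r], some [y] outside [colon s] would lie in
   every [colon r]; but [s] is in the ideal generated by [t], so [y] would annihilate its class. *)
have colonE s : colon_max s -> exists2 r, r \in t & colon s = colon r.
  move=> smax; apply: contrapT => no.
  have [|||y [_ ny yt]] := @avoid_one setT s t _ smax.
  - by split.
  - by move=> /(_ 1 I); rewrite /colon /= mul1r; exact: smax.1.
  - move=> r rt rs; apply: no; exists r => //.
    by apply: (tmax r rt).2 => //; exact: smax.1.
  apply: ny; rewrite /colon /=.
  have ts : ideal_gen t s.
    apply: tK; exists [:: s]; first by move=> r; rewrite inE => /eqP ->.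
    by apply: ideal_gen_mem; rewrite mem_head.
  have : (ideal_gen t `<=` [set z | J (y * z)])%classic; last exact.
  apply: ideal_gen_min; last by move=> r /yt.
  split=> [|a u v Ju Jv] /=; first by rewrite mulr0; exact: hJ.1.
  by rewrite mulrDr mulrCA; exact: hJ.2.
apply: contrapT => no.
have [|x mx xt] := prime_avoidance (t := t) local_ideal.
  move=> r rt; split; first exact: tmax.
  by move=> mr; apply: no; exists r; [exact: (tmax r rt).1 | exact: mr].
have [a na xa] := zd x mx.
have [s smax as_] := colon_max_ex na.
have [r rt sr] := colonE s smax.
by apply: (xt r rt); rewrite -sr; apply: as_.
Qed.

End Socle.

Lemma maximal_regular_socle (s : seq R) :
  regular_seq s -> (forall x, x \in s -> m x) ->
  (forall x, m x -> ~ regular_seq (rcons s x)) ->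
  exists2 w, ~ ideal_gen s w & forall x, m x -> ideal_gen s (x * w).
Proof.
move=> [s1 sreg] sm smax; apply: socle_ex; first exact: ideal_gen_ideal.
move=> x mx; apply: contrapT => no; apply: (smax x mx); split.
  move=> h; apply: local_proper; apply: ideal_gen_min h; first exact: local_ideal.
  by move=> y; rewrite mem_rcons inE => /predU1P[->|/sm].
move=> i; rewrite size_rcons ltnS leq_eqVlt => /predU1P[->|lti] a.
  rewrite -cats1 take_size_cat // nth_cat ltnn subnn /= => h.
  by apply: contrapT => na; apply: no; exists a.
rewrite -cats1 takel_cat ?(ltnW lti) // nth_cat lti; exact: sreg.
Qed.

End Local.

(** * Ext modules of cyclic modules *)


Section Kernel.
Variables (R : comNzRingType) (V W : lmodType R) (f : {linear V -> W}).

Definition in_kernel : pred V := fun v => f v == 0.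
Lemma in_kernel_submod : submod_closed in_kernel.
Proof.
split=> [|a x y]; rewrite !unfold_in /in_kernel ?linear0 // => /eqP fx /eqP fy.
by rewrite linearP fx fy scaler0 addr0.
Qed.
HB.instance Definition _ :=
  GRing.isSubmodClosed.Build R V in_kernel in_kernel_submod.

Record kernel := Kernel { kernel_val : V; _ : in_kernel kernel_val }.
HB.instance Definition _ := [isSub for kernel_val].
HB.instance Definition _ := [Choice of kernel by <:].
HB.instance Definition _ := [SubChoice_isSubLmodule of kernel by <:].

End Kernel.

Lemma submodule_ex (R : comNzRingType) (V : lmodType R) (S : set V) : submod S ->
  exists (K : lmodType R) (f : {linear K -> V}),
    [/\ injective f, forall k, S (f k) & forall v, S v -> exists k, f k = v].
Proof.
move=> hS; have [Q [p [_ pE]]] := quotient_ex hS.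
have lv : linear (fun k : kernel p => val k) by move=> a x y; rewrite linearP.
exists (kernel p), (lin_of lv); split=> [|k|v /pE/eqP Sv]; first exact: val_inj.
  exact/pE/eqP/(valP k).
by exists (Kernel Sv).
Qed.

Section InjectiveSubmodule.
Variables (R : comNzRingType).

(** Injectivity of the submodule S, phrased inside V so that cocycles can stay subsets of the terms
    of a resolution. *)
Definition inj_sub (V : lmodType R) (S : set V) : Prop :=
  forall (A B : lmodType R) (f : {linear A -> B}) (g : {linear A -> V}),
    (forall a, f a = 0 -> g a = 0) -> (forall a, S (g a)) ->
    exists h : {linear B -> V}, (forall b, S (h b)) /\ forall a, h (f a) = g a.

Lemma inj_sub_setT (V : lmodType R) : injective_module V -> inj_sub (@setT V).
Proof. by move=> injV A B f g fg _; have [h hf] := inj_ext injV fg; exists h. Qed.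

Lemma scale_linear (V : lmodType R) (z : V) : linear (fun r : R^o => r *: z).
Proof. by move=> a x y; rewrite scalerDl scalerA. Qed.

(* Extending [r x |-> r z] along [R x -> R / a]. *)
Lemma inj_sub_divide (V : lmodType R) (S : set V) (a : set R) x z :
  inj_sub S -> submod S -> is_ideal a -> S z ->
  (forall r, a (r * x) -> r *: z = 0) ->
  exists z', [/\ S z', x *: z' = z & forall r, a r -> r *: z' = 0].
Proof.
move=> injS hS ha Sz az.
have [Q [p [psurj pE]]] := @quotient_ex R R^o a ha.
have lf : linear (fun r : R^o => p (r * x : R^o)).
  by move=> c u v; rewrite mulrDl -linearP -mulrA.
have [||h [Sh hf]] := injS _ _ (lin_of lf) (lin_of (scale_linear z)).
- by move=> r /pE/az.
- by move=> r; exact: submodZ.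
exists (h (p 1)); split=> //.
  have := hf 1; rewrite /= mul1r scale1r => <-.
  by rewrite -!linearZ; congr (h (p _)); rewrite /GRing.scale /= mulr1.
move=> r /pE ar; rewrite -!linearZ /= -[RHS](linear0 h) -ar; congr (h (p _)).
by rewrite /GRing.scale /= mulr1.
Qed.

End InjectiveSubmodule.

Section Resolution.
Variables (R : comNzRingType).
Variables (J : nat -> lmodType R) (d : forall j, {linear J j -> J j.+1}).
Hypotheses (dd0 : forall j x, d j.+1 (d j x) = 0)
  (exactJ : forall j w, d j.+1 w = 0 -> exists z, d j z = w)
  (injJ : forall j, injective_module (J j)).

(** The elements of V that correspond to Hom (R / a, V). *)
Definition killed (a : set R) (V : lmodType R) (z : V) : Prop :=
  forall r, a r -> r *: z = 0.

Lemma killed_submod a (V : lmodType R) : submod (@killed a V).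
Proof.
split=> [r _|c x y ax ay r ar]; first by rewrite scaler0.
by rewrite scalerDr scalerA mulrC -scalerA ax // ay // scaler0 addr0.
Qed.

Lemma killed_gen (s : seq R) (V : lmodType R) (z : V) :
  (forall r, r \in s -> r *: z = 0) -> killed (ideal_gen s) z.
Proof.
move=> sz; suff : (ideal_gen s `<=` [set r | r *: z = 0])%classic by [].
apply: ideal_gen_min => //; split=> [|a x y /= xz yz] /=; first by rewrite scale0r.
by rewrite scalerDl -scalerA xz yz scaler0 addr0.
Qed.

Definition coc j : set (J j) := [set w | d j w = 0]%classic.

Arguments coc : clear implicits.

Lemma coc_submod j : submod (coc j).
Proof.
split=> [|a x y /= dx dy]; rewrite /coc /= ?linear0 //.
by rewrite linearP dx dy scaler0 addr0.
Qed.

(* [Ext^(j+1)(R / a, N) = 0], where [J] is an injective resolution of [N]. *)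
Definition ext_vanish j (a : set R) : Prop :=
  forall w : J j.+1, d _ w = 0 -> killed a w -> exists2 z, killed a z & d j z = w.

Lemma inj_divide j (a : set R) x (z : J j) : is_ideal a ->
  (forall r, a (r * x) -> r *: z = 0) ->
  exists2 z', x *: z' = z & killed a z'.
Proof.
move=> ha az; have /(_ a x z) := inj_sub_divide (inj_sub_setT (injJ (j := j))).
by move=> [] // z' [_ ? ?]; exists z'.
Qed.

(** The quotient by [i] regular elements has projective dimension at most [i]. The induction chases
    elements in the long exact sequence of multiplication by the next member of [s]. *)
Lemma ext_vanish_regular (s : seq R) : regular_seq s ->
  forall i, (i <= size s)%N -> forall j, (i <= j)%N ->
  ext_vanish j (ideal_gen (take i s)).
Proof.
move=> [_ sreg]; elim=> [|i IH] lti j.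
  move=> _ w dw _; have [z dz] := exactJ dw; exists z => //.
  by rewrite take0; exact: killed_gen.
case: j => // j ij w dw aw.
have si : s`_i \in take i.+1 s by rewrite (take_nth 0) // mem_rcons mem_head.
have sub : (ideal_gen (take i s) `<=` ideal_gen (take i.+1 s))%classic.
  apply: ideal_gen_min => [|x xi]; first exact: ideal_gen_ideal.
  by apply: ideal_gen_mem; rewrite (take_nth 0) // mem_rcons inE xi orbT.
have [|z az dz] := IH (ltnW lti) j.+1 (ltnW ij) w dw; first by move=> r /sub; exact: aw.
have [||u au du] := IH (ltnW lti) j ij (s`_i *: z).
- by rewrite linearZ /= dz; apply: aw; exact: ideal_gen_mem.
- exact: (submodZ _ (killed_submod _ _) az).
(* As s_i is regular modulo the earlier elements, [u] can be divided by it; subtracting the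
   coboundary of the quotient makes s_i annihilate [z] too. *)
have [|u' uE au'] := @inj_divide j (ideal_gen (take i s)) s`_i u (ideal_gen_ideal _).
  by move=> r; rewrite mulrC => /(sreg i lti)/au.
exists (z - d j u'); last by rewrite linearB /= dd0 subr0.
apply: killed_gen => r; rewrite (take_nth 0) // mem_rcons inE => /predU1P[->|ri].
  by rewrite scalerBr -linearZ /= uE du subrr.
have ar : ideal_gen (take i s) r by exact: ideal_gen_mem.
by rewrite scalerBr az // -linearZ /= au' // linear0 subrr.
Qed.

(** The exact sequence 0 -> R / (a : x) -> R / a -> R / (a + R x) -> 0, whose first map is
    multiplication by [x]. *)
Lemma ext_vanish_extension j (a : set R) x : is_ideal a ->
  ext_vanish j (colon a x) ->
  ext_vanish j [set r | exists c e, a e /\ r = c * x + e]%classic ->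
  ext_vanish j a.
Proof.
move=> ha vcol vsum w dw aw.
have [||z cz dz] := vcol (x *: w).
- by rewrite linearZ /= dw scaler0.
- by move=> r; rewrite /colon /= scalerA => /aw.
have [|z' zE az'] := @inj_divide j a x z ha; first by move=> r; exact: cz.
have [||z'' sz dz''] := vsum (w - d j z').
- by rewrite linearB /= dw dd0 subrr.
- move=> _ [c [e [ae ->]]].
  have xz : x *: d j z' = x *: w by rewrite -linearZ /= zE.
  have ez : e *: d j z' = 0 by rewrite -linearZ /= az' // linear0.
  by rewrite scalerDl -scalerA !scalerBr xz subrr add0r aw // ez subrr.
exists (z' + z''); last by rewrite linearD /= dz'' addrC subrK.
apply: (submodD (killed_submod _ _) az').
by move=> r ar; apply: sz; exists 0, r; rewrite mul0r add0r.
Qed.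

End Resolution.
Arguments coc {R J} d j.

(** * Finite generation of Ext *)

Section FiniteExt.
Variables (R : comNzRingType) (R_noetherian : noetherian R).
Variables (J : nat -> lmodType R) (d : forall j, {linear J j -> J j.+1}).
Hypotheses (dd0 : forall j x, d j.+1 (d j x) = 0)
  (exactJ : forall j w, d j.+1 w = 0 -> exists z, d j z = w)
  (injJ : forall j, injective_module (J j)).
Variable (gens : seq (J 0%N)).
Hypothesis (gensP : forall w, d 0%N w = 0 -> lspan gens w).

Section Pairing.
Variables (V : lmodType R) (q : nat).
Implicit Types (b : 'rV[R]_q) (v : {ffun 'I_q -> V}).

(** A tuple [v] is a linear map R^q -> V, and the pairing is its value at [b]. *)
Definition pairing b v : V := \sum_l b 0 l *: v l.

Lemma pairing_linl v : linear (fun b => pairing b v).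
Proof.
move=> a b c; rewrite /pairing scaler_sumr -big_split /=; apply: eq_bigr => l _.
by rewrite !mxE scalerDl scalerA.
Qed.

Lemma pairing_linr b : linear (pairing b).
Proof.
move=> a v w; rewrite /pairing scaler_sumr -big_split /=; apply: eq_bigr => l _.
by rewrite !ffunE scalerDr !scalerA mulrC.
Qed.

Lemma pairing_delta l v : pairing (delta_mx 0 l) v = v l.
Proof.
rewrite /pairing (bigD1 l) //= mxE !eqxx scale1r big1 ?addr0 // => k /negPf kl.
by rewrite mxE kl andbF scale0r.
Qed.

End Pairing.

Lemma pairing_map (V W : lmodType R) (f : {linear V -> W}) q (b : 'rV[R]_q) (v : {ffun 'I_q -> V}) :
  f (pairing b v) = pairing b [ffun l => f (v l)].
Proof. by rewrite linear_sum; apply: eq_bigr => l _; rewrite linearZ ffunE. Qed.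

Definition combo r (t : seq 'rV[R]_r) (c : 'rV[R]_(size t)) : 'rV[R]_r :=
  \sum_l c 0 l *: t`_l.

Arguments combo {r} t c.

Lemma combo_linear r (t : seq 'rV[R]_r) : linear (@combo r t).
Proof.
move=> a b c; rewrite /combo scaler_sumr -big_split /=; apply: eq_bigr => l _.
by rewrite !mxE scalerDl scalerA.
Qed.

Lemma pairing_combo (V : lmodType R) r (t : seq 'rV[R]_r) c (z : {ffun 'I_r -> V}) :
  pairing (combo t c) z = pairing c [ffun l : 'I_(size t) => pairing t`_l z].
Proof.
have := linear_sum (lin_of (pairing_linl z)) (index_enum 'I_(size t)) xpredT
  (fun l => c 0 l *: t`_l).
rewrite /= -/(combo t c) => ->; apply: eq_bigr => l _.
by have /= -> := linearZ_LR (lin_of (pairing_linl z)) (c 0 l) t`_l; rewrite ffunE.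
Qed.

Lemma tuple_extend j r (t : seq 'rV[R]_r) (v : {ffun 'I_(size t) -> J j}) :
  (forall c, combo t c = 0 -> pairing c v = 0) ->
  exists z : {ffun 'I_r -> J j}, forall l : 'I_(size t), pairing t`_l z = v l.
Proof.
move=> tv.
have [h hE] := @inj_ext _ _ _ _ (lin_of (@combo_linear r t)) (lin_of (pairing_linl v)) (injJ (j:=j)) tv.
exists [ffun l => h (delta_mx 0 l)] => l.
have -> : t`_l = combo t (delta_mx 0 l).
  rewrite /combo (bigD1 l) //= mxE !eqxx scale1r big1 ?addr0 // => k /negPf kl.
  by rewrite mxE kl andbF scale0r.
rewrite -[RHS]pairing_delta -[RHS]hE /=.
rewrite [X in h X]row_sum_delta linear_sum; apply: eq_bigr => k _.
by rewrite linearZ ffunE.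
Qed.

(* For [A = R^r / B], the tuples in [cocycles B] are the linear maps from [A] to
   the kernel of [d j]. *)
Definition cocycles j r (B : set 'rV[R]_r) : set {ffun 'I_r -> J j} :=
  [set v : {ffun 'I_r -> J j} | (forall l, d j (v l) = 0) /\ forall b, B b -> pairing b v = 0]%classic.

(** [cocycles j B] modulo this set is Ext^j (R^r / B, N), N being the kernel of [d 0]; in degree 0
    nothing is divided out. *)
Definition coboundaries j r (B : set 'rV[R]_r) : set {ffun 'I_r -> J j} :=
  match j with
  | 0 => [set v : {ffun 'I_r -> J 0%N} | v = 0]%classic
  | j'.+1 => [set v : {ffun 'I_r -> J j'.+1} | exists2 z : {ffun 'I_r -> J j'},
      (forall b, B b -> pairing b z = 0) & v = [ffun l => d j' (z l)]]%classic
  end.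

Lemma row_span r : exists s : seq 'rV[R]_r, forall b, lspan s b.
Proof.
pose s := [seq delta_mx 0 l : 'rV[R]_r | l <- enum 'I_r].
exists s => b; rewrite [b]row_sum_delta; apply: submod_sum; first exact: lspan_submod.
move=> l; apply: submodZ; first exact: lspan_submod.
by apply: lspan_mem; apply: map_f; rewrite mem_enum.
Qed.

Lemma cocycles_submod j r B : submod (@cocycles j r B).
Proof.
split=> [|a x y [dx Bx] [dy By]].
  split=> [l|b _]; first by rewrite ffunE linear0.
  exact: (linear0 (lin_of (pairing_linr b))).
split=> [l|b Bb]; first by rewrite !ffunE linearP dx dy scaler0 addr0.
by rewrite pairing_linr Bx // By // scaler0 addr0.
Qed.

(** In degree 0, Hom (R^r / B, N) is a submodule of the finitely generated N^r. Then dimension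
    shift: with B' the relations among generators [t] of B, R^(size t) / B' is isomorphic to the
    syzygy B, and Ext^(j+1) (R^r / B, N) is a quotient of Ext^j (B, N). *)
Lemma ext_fin_gen j r (B : set 'rV[R]_r) : submod B ->
  exists2 s : seq {ffun 'I_r -> J j}, (forall v, v \in s -> cocycles B v) &
    forall v, cocycles B v -> exists2 u, coboundaries B u & lspan s (v - u).
Proof.
elim: j r B => [|j IH] r B hB.
  pose e (l : 'I_r) (x : J 0%N) : {ffun 'I_r -> J 0%N} := [ffun k => if k == l then x else 0].
  have el l : linear (e l).
    move=> a x y; apply/ffunP => k; rewrite !ffunE; case: eqP => // _.
    by rewrite scaler0 addr0.
  pose s := [seq e l x | l <- enum 'I_r, x <- gens].
  have [||t tE] := @noetherian_submod _ R_noetherian _ s (@cocycles 0 r B).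
  - exact: cocycles_submod.
  - move=> v [dv _].
    have -> : v = \sum_l e l (v l).
      apply/ffunP => k; rewrite sum_ffunE (bigD1 k) //= ffunE eqxx big1 ?addr0 //.
      by move=> l /negPf lk; rewrite ffunE eq_sym lk.
    apply: submod_sum => [|l]; first exact: lspan_submod.
    have [c ->] := (lspanE _ _).1 (gensP (dv l)).
    have /= -> := linear_sum (lin_of (el l)) (index_enum 'I_(size gens)) xpredT
      (fun i => c i *: gens`_i).
    apply: submod_sum => [|i]; first exact: lspan_submod.
    have /= -> := linearZ_LR (lin_of (el l)) (c i) gens`_i.
    apply: submodZ; first exact: lspan_submod.
    apply: lspan_mem; apply/allpairsP; exists (l, gens`_i).
    by rewrite mem_enum mem_nth.
  exists t => [v vt|v]; rewrite tE; first exact: lspan_mem.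
  by exists 0; rewrite ?subr0.
have [s0 s0P] := row_span r.
have [|t Bt] := @noetherian_submod _ R_noetherian _ s0 B hB; first by move=> b _.
have Bcombo b : B b -> exists c, b = combo t c.
  rewrite Bt => /lspanE[c ->]; exists (\row_l c l).
  by apply: eq_bigr => l _; rewrite mxE.
have tB l : (l < size t)%N -> B t`_l by move=> lt; rewrite Bt; apply/lspan_mem/mem_nth.
pose B' : set 'rV[R]_(size t) := [set c | combo t c = 0]%classic.
have hB' : submod B'.
  split=> [|a x y /= tx ty].
    exact: (linear0 (lin_of (@combo_linear r t))).
  by rewrite /B' /= combo_linear tx ty scaler0 addr0.
have [s sc sgen] := IH _ B' hB'.
have ext k (v : {ffun 'I_(size t) -> J k}) :
    exists z : {ffun 'I_r -> J k}, (forall c, B' c -> pairing c v = 0) ->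
      forall l : 'I_(size t), pairing t`_l z = v l.
  case: (pselect (forall c, B' c -> pairing c v = 0)) => [/tuple_extend[z zP]|no].
    by exists z.
  by exists 0 => /no.
have [E EP] := choice (ext j).
(* The connecting homomorphism on representatives: extend a cocycle from B to R^r and
   differentiate. *)
pose dE v : {ffun 'I_r -> J j.+1} := [ffun l => d j (E v l)].
exists [seq dE v | v <- s].
  move=> w /mapP[v vs ->]; have [dv Bv] := sc v vs.
  split=> [l|b /Bcombo[c ->]]; first by rewrite ffunE dd0.
  rewrite -pairing_map pairing_combo pairing_map [LHS]big1 // => l _.
  by rewrite ffunE ffunE EP // dv scaler0.
move=> w [dw Bw].
have [z0 z0P] := choice (fun l => exactJ (dw l)).
pose z : {ffun 'I_r -> J j} := [ffun l => z0 l].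
have dz : [ffun l => d j (z l)] = w by apply/ffunP => l; rewrite !ffunE z0P.
pose v : {ffun 'I_(size t) -> J j} := [ffun l : 'I_(size t) => pairing t`_l z].
have vc : cocycles B' v.
  split=> [l|c Bc]; first by rewrite ffunE pairing_map dz; exact/Bw/tB.
  rewrite -pairing_combo Bc; exact: (linear0 (lin_of (pairing_linl z))).
have [u uB /lspanE[c vu]] := sgen v vc.
(* The coboundary [u] on B extends to a cocycle [y] on R^r: zero for j = 0, and otherwise the
   differential of an extension of a primitive of [u]. *)
have [y yu dy] : exists2 y : {ffun 'I_r -> J j},
    (forall l : 'I_(size t), pairing t`_l y = u l) & forall l, d j (y l) = 0.
  case: (j) u uB {vu} => [|j'] u /=.
    move=> ->; exists 0 => l; last by rewrite ffunE linear0.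
    by rewrite ffunE; exact: (linear0 (lin_of (pairing_linr _))).
  move=> [x Bx ->]; have [x' x'E] := ext _ x.
  exists [ffun l => d j' (x' l)] => l; last by rewrite ffunE dd0.
  by rewrite -pairing_map x'E // ffunE.
(* [zz] vanishes on B, so its differential is a coboundary for R^r / B, and what is left of [w] is a
   combination of the chosen generators. *)
pose zz := z - \sum_i c i *: E s`_i - y.
exists [ffun l => d j (zz l)].
  exists zz => // b /Bcombo[e ->]; rewrite pairing_combo [LHS]big1 // => l _.
  rewrite ffunE.
  have lB (V : lmodType R) q b' (x1 x2 : {ffun 'I_q -> V}) : pairing b' (x1 - x2) = pairing b' x1 - pairing b' x2.
    exact: (linearB (lin_of (pairing_linr b'))).
  rewrite /zz !lB yu.
  have /= -> := linear_sum (lin_of (pairing_linr t`_l)) (index_enum 'I_(size s)) xpredT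
    (fun i => c i *: E s`_i).
  have -> : u l = v l - \sum_i c i *: s`_i l.
    have -> : \sum_i c i *: s`_i l = (\sum_i c i *: s`_i) l.
      by rewrite sum_ffunE; apply: eq_bigr => i _; rewrite ffunE.
    by rewrite -vu !ffunE opprB addrC subrK.
  rewrite [v l]ffunE opprB addrA [X in _ *: X]addrC !addrA addNr add0r addrC.
  rewrite -sumrB big1 ?scaler0 // => i _.
  have /= -> := linearZ_LR (lin_of (pairing_linr t`_l)) (c i) (E s`_i).
  rewrite EP ?subrr //.
  by move=> c' Bc'; apply: (sc _ _).2 => //; exact: mem_nth.
have -> : w - [ffun l => d j (zz l)] = \sum_i c i *: dE s`_i.
  apply/ffunP => l; rewrite -dz /zz; do !rewrite ffunE; rewrite !linearB /= dy !opprK addr0 addNKr.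
  rewrite !sum_ffunE linear_sum; apply: eq_bigr => i _.
  by rewrite !ffunE linearZ.
apply: submod_sum => [|i]; first exact: lspan_submod.
apply: submodZ; first exact: lspan_submod.
by apply: lspan_mem; apply: map_f; exact: mem_nth.
Qed.

End FiniteExt.

(** * Injectivity of the cocycles at the depth *)


Lemma lspan_map (R : comNzRingType) (V W : lmodType R) (f : {linear V -> W}) s v :
  lspan s v -> lspan (map f s) (f v).
Proof.
elim: s v => [|x s IH] v /=; first by move=> ->; exact: linear0.
by move=> [c [w [/IH sw ->]]]; exists c, (f w); rewrite linearP.
Qed.

Lemma ffun_eval_linear (R : comNzRingType) (V : lmodType R) (T : finType) (t : T) :
  linear (fun v : {ffun T -> V} => v t).
Proof. by move=> a x y; rewrite !ffunE. Qed.

Section BassFormula.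
Variables (R : comNzRingType) (m : set R).
Hypotheses (R_noetherian : noetherian R) (R_local : local_with m).
Variables (J : nat -> lmodType R) (d : forall j, {linear J j -> J j.+1}).
Hypotheses (dd0 : forall j x, d j.+1 (d j x) = 0)
  (exactJ : forall j w, d j.+1 w = 0 -> exists z, d j z = w)
  (injJ : forall j, injective_module (J j)).
Variable (gens : seq (J 0%N)).
Hypothesis (gensP : forall w, d 0%N w = 0 -> lspan gens w).
Variable (s : seq R).
Hypotheses (s_reg : regular_seq s) (sm : forall x, x \in s -> m x)
  (s_max : forall x, m x -> ~ regular_seq (rcons s x)).

Lemma ext_cyclic_fin_gen j (a : set R) : is_ideal a ->
  exists2 t : seq (J j.+1), (forall v, v \in t -> d _ v = 0 /\ killed a v) &
    forall v, d _ v = 0 -> killed a v ->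
      exists2 u, (exists2 z, killed a z & d j z = u) & lspan t (v - u).
Proof.
move=> ha; pose B : set 'rV[R]_1 := [set b : 'rV[R]_1 | a (b 0 0)]%classic.
have hB : submod B.
  split=> [|c x y ax ay]; rewrite /B /= !mxE; first exact: ha.1.
  exact: ha.2.
have pE (V : lmodType R) (b : 'rV[R]_1) (v : {ffun 'I_1 -> V}) : pairing b v = b 0 0 *: v 0.
  by rewrite /pairing big_ord1.
have BE (V : lmodType R) (v : {ffun 'I_1 -> V}) :
    (forall b, B b -> pairing b v = 0) <-> killed a (v 0).
  split=> [h r ar|h b Bb]; last by rewrite pE h.
  by have := h (const_mx r); rewrite pE !mxE /B /= !mxE; exact.
have [t tc tgen] := ext_fin_gen R_noetherian dd0 exactJ injJ gensP j.+1 hB.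
pose ev := lin_of (@ffun_eval_linear R (J j.+1) 'I_1 0).
exists (map ev t) => [w /mapP[v /tc[dv /BE Bv] ->]|v dv av].
  by split; first exact: dv.
have [|u [z Bz ->] tu] := tgen [ffun=> v].
  split=> [l|]; first by rewrite ffunE.
  by apply/BE; rewrite ffunE.
exists (d j (z 0)); first by exists (z 0) => //; exact/BE.
by have := lspan_map ev tu; rewrite /= !ffunE.
Qed.

(** Injectivity of the (j+1)-cocycles lets them extend along monomorphisms, so Ext^(j+1) (-, N)
    turns monomorphisms into surjections. Each case of the noetherian induction below uses this or
    an exact sequence. *)
Lemma ext_vanish_all j : (size s <= j)%N -> inj_sub (coc d j.+1) ->
  forall a, is_ideal a -> ext_vanish d j a.
Proof.
move=> sj injC; have hm := local_ideal R_local; have hs := ideal_gen_ideal s.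
have hC := coc_submod d j.+1.
have van_s : ext_vanish d j (ideal_gen s).
  by have := ext_vanish_regular dd0 exactJ injJ s_reg (leqnn _) sj; rewrite take_size.
apply: (noetherian_ind R_noetherian) => a ha IH.
case: (pselect (a 1)) => [a1 w dw aw|na1].
  by exists 0; [move=> r _; rewrite scaler0 | rewrite linear0 -(aw 1 a1) scale1r].
have am := proper_sub_local R_noetherian R_local ha na1.
(* The socle element [w0] embeds R / m in R / (s), whose Ext^(j+1) vanishes: divide [w] by [w0],
   find a primitive there and multiply back. *)
case: (pselect (a = m)) => [-> w dw mw|nam].
  have [w0 nw0 mw0] := maximal_regular_socle R_noetherian R_local s_reg sm s_max.
  have [r /= sr|w' [dw' wE kw']] := inj_sub_divide injC hC hs dw (x := w0).
    apply: mw; apply: (proper_sub_local R_noetherian R_local (colon_ideal hs w0)) sr.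
    by rewrite /colon /= mul1r.
  have [z' kz' dz'] := van_s w' dw' kw'; exists (w0 *: z').
    by move=> r mr; rewrite scalerA kz' //; exact: mw0.
  by rewrite linearZ /= dz'.
have [x mx nax] : exists2 x, m x & ~ a x.
  apply: contrapT => no; apply: nam; apply/seteqP; split=> // x mx.
  by apply: contrapT => nax; apply: no; exists x.
have hcol := colon_ideal ha x.
have acol : (a `<=` colon a x)%classic by move=> r ar; exact: (ideal_mulr x ha ar).
(* If [x] is a zero divisor on R / a, both a : x and a + R x are strictly larger than [a]. *)
case: (pselect (colon a x = a)) => [cola|ncola]; last first.
  apply: (ext_vanish_extension dd0 injJ ha (x := x)); first exact: IH.
  apply: IH.
  - split=> [|c u v [e [f [af ->]]] [e' [f' [af' ->]]]].
      by exists 0, 0; split; [exact: ha.1 | rewrite mul0r addr0].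
    exists (c * e + e'), (c * f + f'); split; first exact: ha.2.
    by ring.
  - by move=> r ar; exists 0, r; rewrite mul0r add0r.
  - move=> E; apply: nax; rewrite -E; exists 1, 0.
    by split; [exact: ha.1 | rewrite mul1r addr0].
move=> w dw aw; apply: contrapT => no.
have [t tS tgen] := ext_cyclic_fin_gen j ha.
pose S : set (J j.+1) := [set v | d _ v = 0 /\ killed a v]%classic.
pose U0 : set (J j.+1) := [set v | exists2 z, killed a z & d j z = v]%classic.
have hS : submod S.
  split=> [|c u v [du au] [dv av]]; split.
  - exact: hC.1.
  - exact: (killed_submod _ _).1.
  - exact: hC.2.
  - exact: (killed_submod _ _).2.
have hU : submod U0.
  split=> [|c u v [z az <-] [y ay <-]].
    by exists 0; [exact: (killed_submod _ _).1 | rewrite linear0].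
  by exists (c *: z + y); [exact: (killed_submod _ _).2 | rewrite linearP].
have [|||U [hU' UU [v Sv nUv] mU]] := nakayama R_noetherian R_local hS hU _ tS.
- by move=> _ [z az <-]; split=> // r ar; rewrite -linearZ /= az // linear0.
- by move=> v [dv av]; exact: tgen.
- by move=> /(_ w (conj dw aw))[z az dz]; apply: no; exists z.
apply: nUv; case: Sv => dv av.
(* Multiplication by [x] is injective on R / a, hence surjective on its cocycles: v = x v' lies in m
   S, which is inside U. *)
have [r|v' [dv' <- av']] := inj_sub_divide injC hC ha dv (x := x).
  by rewrite -[a (r * x)]/(colon a x r) cola; exact: av.
exact: mU.
Qed.

(** * Baer's criterion for cocycles *)

Section Baer.
Variable j : nat.
Hypothesis van : forall a, is_ideal a -> ext_vanish d j a.
Variables (A B : lmodType R) (f : {linear A -> B}) (psi : {linear B -> J j.+1}).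
Hypotheses (psi_f : forall a, psi (f a) = 0) (d_psi : forall b, d j.+1 (psi b) = 0).

(** Graphs of lifts of [psi] along [d j], defined on submodules of B and zero on the image of [f];
    as sets they are ordered by inclusion, as [Zorn_bigcup] requires. *)
Definition partial_lift (G : set (B * J j)) : Prop :=
  [/\ submod G, forall y, G (0, y) -> y = 0,
      forall b y, G (b, y) -> d j y = psi b & forall a, G (f a, 0)].

(** Let [h] extend the partial lift to B, by injectivity of J_j, and let [a] be the ideal of
    multipliers of [b0] into the domain. The error psi b0 - d (h b0) is a cocycle killed by [a], so
    it is d z with [z] killed by [a], and b0 |-> h b0 + z is consistent. *)
Lemma partial_lift_extend G b0 : partial_lift G ->
  exists G', [/\ partial_lift G', (G `<=` G')%classic & exists y, G' (b0, y)].
Proof.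
move=> [hG G0 Gd Gf].
case: (pselect (exists y, G (b0, y))) => [[y Gy]|nG].
  by exists G; split; [split | | exists y].
have [K [k [_ kG kS]]] := submodule_ex hG.
have [|h hE] := @inj_ext R B K (J j) (lin_of (@fst_linear R B (J j)) \o k)
    (lin_of (@snd_linear R B (J j)) \o k) (injJ (j := j)).
  move=> u /= ku; have := kG u; case: (k u) ku => b y /= -> /G0 //.
have hG' b y : G (b, y) -> h b = y by move=> /kS[u ku]; have := hE u; rewrite /= ku.
pose a : set R := [set r | exists y, G (r *: b0, y)]%classic.
have ha : is_ideal a.
  split=> [|c r r' [y Gy] [y' Gy']]; first by exists 0; rewrite scale0r; exact: hG.1.
  exists (c *: y + y'); rewrite scalerDl -scalerA.
  exact: (hG.2 c (r *: b0, y) (r' *: b0, y')).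
have [||z az dz] := @van a ha (psi b0 - d j (h b0)).
- by rewrite linearB /= dd0 d_psi subrr.
- move=> r [y Gy]; rewrite scalerBr -!linearZ /= -(Gd _ _ Gy) (hG' _ _ Gy) subrr //.
pose G' : set (B * J j) := [set p | exists r b y, G (b, y) /\
  p = (b + r *: b0, y + r *: (h b0 + z))]%classic.
exists G'; split.
- split.
  + split=> [|c _ _ [r [b [y [Gy ->]]]] [r' [b' [y' [Gy' ->]]]]].
      by exists 0, 0, 0; split; [exact: hG.1 | rewrite !scale0r !addr0].
    exists (c * r + r'), (c *: b + b'), (c *: y + y').
    split; first exact: (hG.2 c (b, y) (b', y')).
    by congr (_, _) => /=; rewrite scalerDr !scalerDl !scalerA addrACA.
  + move=> y [r [b [y' [Gy' [bE ->]]]]].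
    have GN : G (- b, - y').
      by have := submodZ (-1) hG Gy'; rewrite scaleN1r.
    have bN : r *: b0 = - b by apply/eqP; rewrite -addr_eq0 addrC -bE.
    have ar : a r by exists (- y'); rewrite bN.
    rewrite scalerDr az // addr0 -linearZ /= bN (hG' _ _ GN) subrr //.
  + move=> b y [r [b' [y' [Gy' [-> ->]]]]].
    have E : d j (h b0 + z) = psi b0 by rewrite linearD /= dz addrC subrK.
    by rewrite [LHS]linearD [RHS]linearD !linearZ /= E (Gd _ _ Gy').
  + by move=> u; exists 0, (f u), 0; rewrite !scale0r !addr0.
- by move=> [b y] Gy; exists 0, b, y; rewrite !scale0r !addr0.
- exists (h b0 + z), 1, 0, 0; split; first exact: hG.1.
  by rewrite !scale1r !add0r.
Qed.

Lemma lift_ex : exists sigma : {linear B -> J j},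
  (forall b, d j (sigma b) = psi b) /\ forall a, sigma (f a) = 0.
Proof.
pose P : set (set (B * J j)) := [set G | G = set0 \/ partial_lift G]%classic.
pose G0 : set (B * J j) := [set p | (exists a, f a = p.1) /\ p.2 = 0]%classic.
have PG0 : partial_lift G0.
  split=> [|y [] //|b y|a].
  - split=> [|c [b y] [b' y']]; rewrite /G0 /=.
      by split=> //; exists 0; rewrite linear0.
    move=> [[a <-] ->] [[a' <-] ->]; rewrite scaler0 addr0; split=> //.
    by exists (c *: a + a'); rewrite linearP.
  - by rewrite /G0 /= => -[[a <-] ->]; rewrite linear0 psi_f.
  - by rewrite /G0; split=> //; exists a.
have [|G [PG Gmax]] := @Zorn_bigcup _ P.
  move=> F FP Ftot.
  case: (pselect (exists G, F G /\ partial_lift G)) => [[G1 [FG1 PG1]]|no]; last first.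
    left; apply/seteqP; split=> // p [G FG Gp].
    by have [G0E|PG] := FP _ FG; [move: Gp; rewrite G0E | case: no; exists G].
  right; split.
  - split=> [|c p q [G FG Gp] [H FH Hq]]; first by exists G1 => //; case: PG1 => -[].
    have [GH|HG] := Ftot _ _ FG FH.
      exists H => //; have [HE|[hH _ _ _]] := FP _ FH; first by move: Hq; rewrite HE.
      by apply: hH.2 => //; exact: GH.
    exists G => //; have [HE|[hH _ _ _]] := FP _ FG; first by move: Gp; rewrite HE.
    by apply: hH.2 => //; exact: HG.
  - move=> y [G FG Gy]; have [GE|[_ h _ _]] := FP _ FG; first by move: Gy; rewrite GE.
    exact: h.
  - move=> b y [G FG Gy]; have [GE|[_ _ h _]] := FP _ FG; first by move: Gy; rewrite GE.
    exact: h.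
  - by move=> a; exists G1 => //; case: PG1.
have {}PG : partial_lift G.
  case: PG => // GE; case: (Gmax G0); last by right.
  rewrite GE; split=> [p //|/(_ (0, 0))]; apply.
  by split=> //; exists 0; rewrite linear0.
have dom b : exists y, G (b, y).
  have [G' [PG' GG' [y Gy]]] := partial_lift_extend b PG.
  case: (pselect (G' `<=` G)%classic) => [G'G|nG]; first by exists y; exact: G'G.
  by case: (Gmax G'); [split | right].
have [g gP] := choice dom; case: PG => hG Ginj Gd Gf.
have Gfun b y y' : G (b, y) -> G (b, y') -> y = y'.
  move=> Gy Gy'; apply/subr0_eq/Ginj.
  by have := submodB hG Gy Gy'; rewrite -[_ - _]/(b - b, y - y') subrr.
have lg : linear g.
  move=> c b b'; apply: Gfun (gP _) _.
  exact: (hG.2 c (b, g b) (b', g b')).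
exists (lin_of lg); split=> [b|a] /=; first exact: Gd.
exact: Gfun (gP _) (Gf a).
Qed.

End Baer.

(** Extend [g] to [h] with values in J_j, then subtract a lift of d h that vanishes on the image of
    [f]. *)
Lemma coc_inj_sub j : (forall a, is_ideal a -> ext_vanish d j a) -> inj_sub (coc d j).
Proof.
move=> van A B f g fg dg.
have [h hf] := inj_ext (injJ (j := j)) fg.
have [||sigma [ds sf]] := lift_ex van (f := f) (psi := d j \o h).
- by move=> a /=; rewrite hf dg.
- by move=> b /=; rewrite dd0.
have lh : linear (fun b => h b - sigma b).
  by move=> c x y; rewrite !linearP scalerDr addrACA.
exists (lin_of lh); split=> [b|a] /=; last by rewrite sf hf subr0.
by rewrite /coc /= linearB /= ds subrr.
Qed.

(** Descending induction to [size s] from a degree beyond the end of the resolution, where the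
    cocycles are zero. *)
Lemma coc_injective n : (forall j, (n < j)%N -> forall x : J j, x = 0) ->
  inj_sub (coc d (size s)).
Proof.
move=> J0.
have H k : (size s <= k)%N -> inj_sub (coc d k.+1) -> inj_sub (coc d k).
  by move=> sk /(ext_vanish_all sk); exact: coc_inj_sub.
have top : inj_sub (coc d (maxn n.+1 (size s))).
  move=> A B f g fg _; exists (lin_of (@zero_linear R B _)); split=> [b|a] /=.
    exact: (coc_submod _ _).1.
  by rewrite [RHS]J0 // leq_maxl.
move: (leq_maxr n.+1 (size s)) top; move: (maxn _ _) => k.
elim: k => [|k IH] sk; first by move: sk; rewrite leqn0 => /eqP ->.
move: sk; rewrite leq_eqVlt => /predU1P[<- //|sk] /(H _ sk); exact: IH.
Qed.

End BassFormula.

(** * Homology classes and mapping cones *)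


(** Differentials land in degrees of the form i - 1, the only ones where [boundaryE] applies; this
    brings any degree into that form. *)
Lemma int_pred_ind (P : int -> Prop) : (forall i, P (i - 1)) -> forall i, P i.
Proof. by move=> H i; have := H (i + 1); rewrite addrK. Qed.

Section HomologyClasses.
Variable R : comNzRingType.
Implicit Types A B C M : complex R.

Definition cls M i (z : M i) (dz : diff M i z = 0) : homology M i :=
  \pi_(quotmod (is_boundary_submod M i)) (Cycle (introT eqP dz : is_cycle z)).

Lemma cls_ind M i (P : homology M i -> Prop) :
  (forall z (dz : diff M i z = 0), P (cls dz)) -> forall x, P x.
Proof.
move=> h x; elim/quot_ind: x => z.
have := h (val z) (eqP (valP z)); rewrite /cls.
by congr (P (\pi _)); apply: val_inj.
Qed.

Lemma cls_eq M i (z w : M i) (dz : diff M i z = 0) (dw : diff M i w = 0) :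
  cls dz = cls dw <-> boundary (z - w).
Proof. exact: homology_eqP. Qed.

Lemma cls_lin M i (z w : M i) a (dz : diff M i z = 0) (dw : diff M i w = 0)
    (dzw : diff M i (a *: z + w) = 0) :
  a *: cls dz + cls dw = cls dzw.
Proof.
rewrite /cls [_ *: _](pi_scale (is_boundary_submod M i)) -pi_addE.
by congr (\pi _); apply: val_inj.
Qed.

Lemma cls_eq0 M i (z : M i) (dz : diff M i z = 0) : cls dz = 0 <-> boundary z.
Proof.
have d0 : diff M i 0 = 0 by rewrite linear0.
have -> : 0 = cls d0.
  have d00 : diff M i ((-1) *: 0 + 0) = 0 by rewrite scaler0 addr0.
  have := cls_lin d0 d0 d00; rewrite scaleN1r addNr => ->.
  by apply/cls_eq; rewrite scaler0 addr0 subrr; exact: boundary0.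
by split=> [/cls_eq|bz]; [|apply/cls_eq]; rewrite subr0.
Qed.

Lemma clsZ M i (z : M i) a (dz : diff M i z = 0) (daz : diff M i (a *: z) = 0) :
  a *: cls dz = cls daz.
Proof.
have d0 : diff M i 0 = 0 by rewrite linear0.
have daz0 : diff M i (a *: z + 0) = 0 by rewrite addr0.
rewrite -[LHS]addr0 -((cls_eq0 d0).2 (boundary0 _ _)) (cls_lin _ _ daz0).
by apply/cls_eq; rewrite addr0 subrr; exact: boundary0.
Qed.

(** The degrees may differ, so that single components of shifts and of cone projections qualify. *)
Lemma homology_lift A B i j (F : {linear A i -> B j}) :
  (forall z, diff A i z = 0 -> diff B j (F z) = 0) ->
  (forall z, boundary z -> boundary (F z)) ->
  exists G : {linear homology A i -> homology B j},
    forall z (dz : diff A i z = 0) (dFz : diff B j (F z) = 0), G (cls dz) = cls dFz.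
Proof.
move=> FZ FB.
pose g (x : homology A i) : homology B j :=
  \pi_(quotmod (is_boundary_submod B j)) (Cycle (introT eqP (FZ _ (eqP (valP (repr x)))) : is_cycle _)).
have gE z (dz : diff A i z = 0) (dFz : diff B j (F z) = 0) : g (cls dz) = cls dFz.
  apply/cls_eq; rewrite -linearB; apply: FB.
  apply: (iffLR (homology_eqP (repr (cls dz)) (Cycle (introT eqP dz : is_cycle z)))).
  by rewrite reprK.
have lg : linear g.
  move=> a; elim/cls_ind => z dz; elim/cls_ind => w dw.
  have dzw : diff A i (a *: z + w) = 0 by rewrite linearP dz dw scaler0 addr0.
  rewrite (cls_lin _ _ dzw) (gE _ _ (FZ _ dz)) (gE _ _ (FZ _ dw)) (gE _ _ (FZ _ dzw)).
  have dFzw : diff B j (a *: F z + F w) = 0 by rewrite -linearP; exact: (FZ _ dzw).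
  rewrite (cls_lin _ _ dFzw); apply/cls_eq.
  by rewrite linearP subrr; exact: boundary0.
by exists (lin_of lg) => z dz dFz /=; exact: gE.
Qed.

Lemma homology_retract A B i j (F : {linear A i -> B j}) :
  (forall z, diff A i z = 0 -> diff B j (F z) = 0) ->
  (forall z, boundary z -> boundary (F z)) ->
  (forall z, diff A i z = 0 -> boundary (F z) -> boundary z) ->
  (forall w, diff B j w = 0 -> exists2 z, diff A i z = 0 & boundary (F z - w)) ->
  retract (homology A i) (homology B j) /\ retract (homology B j) (homology A i).
Proof.
move=> FZ FB Finj Fsurj; have [G GE] := homology_lift FZ FB.
apply: (@bij_ker0_retract _ _ _ G) => [|].
  elim/cls_ind => z dz; rewrite (GE _ _ (FZ _ dz)) => /cls_eq0 /Finj h.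
  by apply/cls_eq0; exact: h.
elim/cls_ind => w dw; have [z dz bz] := Fsurj w dw.
by exists (cls dz); rewrite (GE _ _ (FZ _ dz)); apply/cls_eq.
Qed.

Lemma cmap_cycle A B (f : chain_map A B) i z : diff A i z = 0 -> diff B i (f i z) = 0.
Proof. by move=> dz; rewrite -cmapP dz linear0. Qed.

Lemma hmap_cls A B (f : chain_map A B) i z (dz : diff A i z = 0) (dfz : diff B i (f i z) = 0) :
  homology_map f (cls dz) = cls dfz.
Proof. by rewrite /cls homology_map_pi; congr (\pi _); apply: val_inj. Qed.

Lemma hmap_linear A B (f : chain_map A B) i : linear (@homology_map R A B f i).
Proof.
move=> a; elim/cls_ind => z dz; elim/cls_ind => w dw.
have dzw : diff A i (a *: z + w) = 0 by rewrite linearP dz dw scaler0 addr0.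
rewrite (cls_lin _ _ dzw) (hmap_cls _ (cmap_cycle f dz)) (hmap_cls _ (cmap_cycle f dw)).
rewrite (hmap_cls _ (cmap_cycle f dzw)).
have dfzw : diff B i (a *: f i z + f i w) = 0.
  by rewrite -linearP; exact: cmap_cycle.
rewrite (cls_lin _ _ dfzw); apply/cls_eq.
by rewrite linearP subrr; exact: boundary0.
Qed.

Definition hmap A B (f : chain_map A B) i : {linear homology A i -> homology B i} :=
  lin_of (@hmap_linear A B f i).

Lemma hmapE A B (f : chain_map A B) i z (dz : diff A i z = 0) (dfz : diff B i (f i z) = 0) :
  hmap f i (cls dz) = cls dfz.
Proof. exact: hmap_cls. Qed.

Lemma hmap_eq A B (f g : chain_map A B) : (forall i z, boundary (f i z - g i z)) ->
  forall i, hmap f i =1 hmap g i.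
Proof.
move=> fg i; elim/cls_ind => z dz.
by rewrite (hmapE _ (cmap_cycle f dz)) (hmapE _ (cmap_cycle g dz)); apply/cls_eq.
Qed.

Lemma hmap_ext A B (f g : chain_map A B) : (forall i z, f i z = g i z) ->
  forall i, hmap f i =1 hmap g i.
Proof. by move=> fg; apply: hmap_eq => i z; rewrite fg subrr; exact: boundary0. Qed.

Lemma hmap_comp A B C (g : chain_map B C) (f : chain_map A B) i x :
  hmap (ccomp g f) i x = hmap g i (hmap f i x).
Proof.
elim/cls_ind: x => z dz; rewrite (hmapE _ (cmap_cycle f dz)).
rewrite (hmapE _ (cmap_cycle g (cmap_cycle f dz))).
exact: hmapE.
Qed.

Lemma hmap_id A i x : hmap (cid_map A) i x = x.
Proof.
elim/cls_ind: x => z dz; rewrite (hmapE _ (cmap_cycle (cid_map A) dz)).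
by apply/cls_eq; rewrite subrr; exact: boundary0.
Qed.

Lemma hmap_homotopic A B (f g : chain_map A B) : homotopic f g ->
  forall i, hmap f i =1 hmap g i.
Proof.
move=> [h hP]; apply: int_pred_ind => i.
elim/cls_ind => z dz.
rewrite (hmapE _ (cmap_cycle f dz)) (hmapE _ (cmap_cycle g dz)); apply/cls_eq.
by rewrite hP dz linear0 addr0; exact: Boundary.
Qed.

Lemma hmap_qis_inj A B (f : chain_map A B) i : quasi_iso f -> injective (hmap f i).
Proof. by move=> /(_ i) /bij_inj. Qed.

Lemma hmap_qis_surj A B (f : chain_map A B) i : quasi_iso f ->
  forall y, exists x, hmap f i x = y.
Proof. by move=> /(_ i)[g _ gK] y; exists (g y); exact: gK. Qed.

Lemma bij_qis A B (f : chain_map A B) :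
  (forall i, injective (hmap f i)) -> (forall i y, exists x, hmap f i x = y) -> quasi_iso f.
Proof.
move=> finj fsurj i; have [g gK] := choice (fsurj i).
by exists g => [x|//]; apply: finj; exact: gK.
Qed.

Lemma qis_ext A B (f g : chain_map A B) : (forall i z, f i z = g i z) ->
  quasi_iso f -> quasi_iso g.
Proof.
move=> fg qf; have e i := hmap_ext fg (i := i).
apply: bij_qis => [i x y|i y].
  by rewrite -!e => /(hmap_qis_inj qf).
by have [x <-] := hmap_qis_surj (i := i) qf y; exists x; rewrite e.
Qed.

Lemma qis_cancel_l A B C (g : chain_map B C) (f : chain_map A B) :
  quasi_iso g -> quasi_iso (ccomp g f) -> quasi_iso f.
Proof.
move=> qg qgf; apply: bij_qis => [i x y e|i y].
  by apply: (hmap_qis_inj (i := i) qgf); rewrite !hmap_comp e.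
have [x xE] := hmap_qis_surj (i := i) qgf (hmap g i y); exists x.
by apply: (hmap_qis_inj qg); rewrite -hmap_comp.
Qed.

Lemma homotopic_refl A B (f g : chain_map A B) : (forall i z, f i z = g i z) -> homotopic f g.
Proof.
move=> fg; exists (fun i => lin_of (@zero_linear R _ _)) => i x /=.
by rewrite fg subrr linear0 addr0.
Qed.

Lemma iso_qis A B (f : chain_map A B) :
  (forall i x, f i x = 0 -> x = 0) -> (forall i y, exists x, f i x = y) -> quasi_iso f.
Proof.
move=> f0 fsurj.
have finj i : injective (f i).
  by move=> x y e; apply/subr0_eq/f0; rewrite linearB e subrr.
apply/quasi_isoP; apply: int_pred_ind => i; split=> [z dz /boundaryE[y yE]|w dw].
  have [x xE] := fsurj i y; apply/boundaryE; exists x.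
  by apply: finj; rewrite cmapP xE.
have [z zE] := fsurj (i - 1) w; exists z; last by rewrite zE subrr; exact: boundary0.
by apply: finj; rewrite cmapP zE dw linear0.
Qed.

End HomologyClasses.

Section ConeMaps.
Variable R : comNzRingType.
Implicit Types A B C M : complex R.

Section ConeMap.
Variables (A B A' B' : complex R) (phi : chain_map A B) (phi' : chain_map A' B').
Variables (a : chain_map A A') (b : chain_map B B').
Hypothesis comm : forall i z, b i (phi i z) = phi' i (a i z).

Lemma cone_map_linear i : linear (fun p : A (i - 1) * B i =>
  (a (i - 1) p.1, b i p.2) : A' (i - 1) * B' i).
Proof. by move=> c [x y] [z t] /=; rewrite !linearP. Qed.

Program Definition cone_map : chain_map (cone phi) (cone phi') :=
  @ChainMap R (cone phi) (cone phi') (fun i => lin_of (@cone_map_linear i)) _.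
Next Obligation. by rewrite linearN !linearD /= !cmapP comm. Qed.

(** The five lemma for the long exact sequences of the two cones, on elements. *)
Lemma cone_map_qis : quasi_iso a -> quasi_iso b -> quasi_iso cone_map.
Proof.
move=> /quasi_isoP qa /quasi_isoP qb; apply/quasi_isoP; apply: int_pred_ind => i.
have [ai as2] := qa (i - 1 - 1); have [bi bs] := qb (i - 1).
have [_ as1] := qa (i - 1); have [bi2 _] := qb (i - 1 - 1).
split=> [[p y] [/eqP dp dy] /boundaryE[[p1 y1] [/= ap yb]]|[p' y'] [/eqP dp' dy']].
  rewrite oppr_eq0 in dp; move/eqP: dp => dp.
  have /boundaryE[p2 p2E] : boundary p.
    apply: ai => //; rewrite -ap; apply/boundaryE; exists (- p1).
    by rewrite linearN.
  have [|p4 dp4 /boundaryE[p5 p5E]] := as1 (p1 + a _ p2).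
    by rewrite linearD -cmapP p2E -ap subrr.
  have /boundaryE[y3 y3E] : boundary (y + phi _ p2 - phi _ p4).
    apply: bi; first by rewrite linearB linearD -!cmapP p2E dp4 linear0 subr0.
    apply/boundaryE; exists (y1 - phi' _ p5).
    rewrite linearB -cmapP p5E !(linearB, linearD) /= !comm -yb.
    by rewrite !opprK [- phi' _ _ + _]addrC !addrA.
  apply/boundaryE; exists (p4 - p2, y3) => /=; congr (_, _).
    by rewrite linearB /= dp4 p2E sub0r opprK.
  by rewrite y3E linearB /= addrA subrK addrK.
rewrite oppr_eq0 in dp'; move/eqP: dp' => dp'.
move/eqP: dy'; rewrite /= addr_eq0 => /eqP dy'.
have [p dp /boundaryE[p1 p1E]] := as2 p' dp'.
have /boundaryE[y0 y0E] : boundary (phi _ p).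
  apply: bi2; first by rewrite -cmapP dp linear0.
  apply/boundaryE; exists (phi' _ p1 - y').
  by rewrite linearB -cmapP p1E comm linearB /= dy' opprK subrK.
have [|v1 dv1 /boundaryE[v2 v2E]] := bs (- b _ y0 - y' + phi' _ p1).
  rewrite linearD linearB linearN -!cmapP y0E p1E comm linearB /= dy' opprK.
  by rewrite addrACA addNr subrr addr0.
exists (p, - y0 - v1) => /=.
  by rewrite dp oppr0 linearB linearN /= y0E dv1 subr0 addNr.
apply/boundaryE; exists (- p1, - v2) => /=; congr (_, _).
  by rewrite linearN /= opprK p1E.
have zE (V : zmodType) (x y z t : V) : - (x - (- y - z + t)) - t = - y - x - z.
  by rewrite opprB addrAC addrK addrAC.
rewrite /= (linearN (diff B' i)) (linearN (phi' _)) v2E (linearB (b _)) (linearN (b _)); exact: zE.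
Qed.

End ConeMap.
End ConeMaps.

(** * Iterated Koszul cones *)


Section Koszul.
Variable R : comNzRingType.
Implicit Types A B C M : complex R.

Lemma homothety_linear (V : lmodType R) (x : R) : linear (fun v : V => x *: v).
Proof. by move=> a u v; rewrite scalerDr !scalerA mulrC. Qed.

Program Definition homothety (x : R) A : chain_map A A :=
  @ChainMap R A A (fun i => lin_of (@homothety_linear (A i) x)) _.
Next Obligation. by rewrite linearZ. Qed.

Definition koszul1 (x : R) A : complex R := cone (homothety x A).

Lemma homothety_comm x A B (f : chain_map A B) i z :
  f i (homothety x A i z) = homothety x B i (f i z).
Proof. by rewrite /= linearZ. Qed.

Definition koszul1_map x A B (f : chain_map A B) : chain_map (koszul1 x A) (koszul1 x B) :=
  cone_map (homothety_comm x f).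

Lemma koszul1_homotopic x A B (f g : chain_map A B) :
  homotopic f g -> homotopic (koszul1_map x f) (koszul1_map x g).
Proof.
move=> [h hP].
have lk i : linear (fun p : A (i - 1 - 1) * A (i - 1) => (- h (i - 1) p.1, h i p.2) : B (i - 1) * B i).
  move=> c [u v] [u' v'] /=; congr (_, _); last by rewrite linearP.
  by rewrite linearP opprD -scalerN.
exists (fun i => lin_of (lk i)) => i [p q] /=; congr (_, _) => /=.
  by rewrite hP (linearN (diff B (i - 1))) (linearN (h (i - 1 - 1))) !opprK.
rewrite hP (linearD (h (i - 1))) (linearZ_LR (h (i - 1))) scalerN /=.
have zE (V : zmodType) (u v w : V) : u + v = u - w + (v + w).
  by rewrite addrACA addNr addr0.
exact: zE.
Qed.

Lemma koszul1_in_zero x A :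
  (forall i (y : homology A i), exists y', x *: y' = y) ->
  forall i y, hmap (cone_in (homothety x A)) i y = 0.
Proof.
move=> xs; apply: int_pred_ind => i; elim/cls_ind => z dz.
have [y'] := xs (i - 1) (cls dz); elim/cls_ind: y' => z' dz' e.
have dxz : diff A (i - 1) (x *: z') = 0 by rewrite linearZ /= dz' scaler0.
move: e; rewrite (clsZ _ dxz) => /esym/cls_eq/boundaryE[y yE].
rewrite (hmapE _ (cmap_cycle (cone_in (homothety x A)) dz)); apply/cls_eq0/boundaryE.
by exists (z', y) => /=; rewrite dz' oppr0 yE subrK.
Qed.

(** Injectivity over the quotient ring R / (l), expressed with R-modules: extensions are asked only
    into modules B killed by [l]. *)
Definition injective_over (l : seq R) (V : lmodType R) : Prop :=
  (forall c, c \in l -> forall v : V, c *: v = 0) /\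
  forall (A B : lmodType R) (f : {linear A -> B}) (g : {linear A -> V}),
    (forall a, f a = 0 -> g a = 0) -> (forall c, c \in l -> forall b : B, c *: b = 0) ->
    exists h : {linear B -> V}, forall a, h (f a) = g a.

Lemma injective_over_nil V : injective_module V -> injective_over [::] V.
Proof. by move=> injV; split=> // A B f g fg _; exact: inj_ext. Qed.

(** Extend r |-> r v along multiplication by [x], which is injective on R / (l); the image of 1 is
    the quotient of [v] by [x]. *)
Lemma injective_over_surj (l : seq R) x V : injective_over l V ->
  (forall a, ideal_gen l (x * a) -> ideal_gen l a) ->
  forall v : V, exists v', x *: v' = v.
Proof.
move=> [lV injV] xreg v.
have hl := ideal_gen_ideal l.
have [Q [p [psurj pE]]] := @quotient_ex R R^o (ideal_gen l) hl.
have lf : linear (fun r : R^o => p (x * r : R^o)).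
  by move=> c u w; rewrite mulrDr mulrCA -linearP.
have [||h hf] := injV _ _ (lin_of lf) (lin_of (scale_linear v)).
- move=> r /pE/xreg; move: r; suff: (ideal_gen l `<=` [set r | r *: v = 0])%classic by [].
  exact: (@killed_gen R l V v (fun r rl => lV r rl v)).
- move=> c cl q; have [r <-] := psurj q.
  rewrite -linearZ; apply/pE; rewrite /GRing.scale /= mulrC.
  by apply: ideal_mull => //; exact: ideal_gen_mem.
exists (h (p 1)); have := hf 1; rewrite /= mulr1 scale1r => <-.
by rewrite -!linearZ; congr (h (p _)); rewrite /GRing.scale /= mulr1.
Qed.

(** W is the [x]-torsion of V: an extension into V from a module killed by [x] takes its values
    there. *)
Lemma injective_over_sub (l : seq R) x (V W : lmodType R) (G : {linear W -> V}) :
  injective_over l V -> injective G -> (forall w, x *: G w = 0) ->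
  (forall v, x *: v = 0 -> exists w, G w = v) ->
  injective_over (rcons l x) W.
Proof.
move=> [lV injV] injG xG imG; split=> [c|A B f g fg lB].
  rewrite mem_rcons inE => cl w; apply: injG; rewrite linear0 linearZ /=.
  by case/predU1P: cl => [->|/lV].
have [||h hf] := injV A B f (G \o g).
- by move=> a /fg /= ->; rewrite linear0.
- by move=> c cl; apply: lB; rewrite mem_rcons inE cl orbT.
have xh b : x *: h b = 0 by rewrite -linearZ /= lB ?linear0 // mem_rcons mem_head.
have [k kE] := choice (fun b => imG (h b) (xh b)).
have lk : linear k by move=> c u v; apply: injG; rewrite linearP !kE linearP.
by exists (lin_of lk) => a /=; apply: injG; rewrite kE hf.
Qed.

(** As [x] acts surjectively on homology, the long exact sequence of the cone identifies H_i of it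
    with the [x]-torsion of H_(i-1) A; the projection of the cone realizes this. *)
Lemma koszul1_injective_over (l : seq R) x A :
  (forall i, injective_over l (homology A i)) ->
  (forall i (y : homology A i), exists y', x *: y' = y) ->
  forall i, injective_over (rcons l x) (homology (koszul1 x A) i).
Proof.
move=> lA xs; apply: int_pred_ind => i.
pose F : {linear koszul1 x A (i - 1) -> A (i - 1 - 1)} := lin_of (@cone_out_linear R A A (i - 1)).
have FZ z : diff (koszul1 x A) (i - 1) z = 0 -> diff A (i - 1 - 1) (F z) = 0.
  by case: z => p q [/eqP]; rewrite oppr_eq0 => /eqP.
have FB z : boundary z -> boundary (F z).
  move=> /boundaryE[[p q] <-]; apply/boundaryE; exists (- p).
  by rewrite linearN.
have [G GE] := homology_lift FZ FB.
have xsurj j (z : A j) : diff A j z = 0 -> exists2 z', diff A j z' = 0 & boundary (z - x *: z').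
  move=> dz; have [y'] := xs j (cls dz); elim/cls_ind: y' => z' dz' e; exists z' => //.
  have dxz : diff A j (x *: z') = 0 by rewrite linearZ /= dz' scaler0.
  by move: e; rewrite (clsZ _ dxz) => /esym/cls_eq.
have xzero j (z : A j) (dz : diff A j z = 0) : x *: cls dz = 0 <-> boundary (x *: z).
  have dxz : diff A j (x *: z) = 0 by rewrite linearZ /= dz scaler0.
  by rewrite (clsZ _ dxz); exact: cls_eq0.
apply: (injective_over_sub (G := G) (lA (i - 1 - 1))).
- suff G0 y : G y = 0 -> y = 0 by move=> u v e; apply/subr0_eq/G0; rewrite linearB e subrr.
  elim/cls_ind: y => -[p q] dz; rewrite (GE _ _ (FZ _ dz)) => /cls_eq0/boundaryE[p2 /= p2E].
  case: (dz) => _ dq; apply/cls_eq0.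
  have [|q' dq' /boundaryE[q1 q1E]] := xsurj (i - 1) (q + x *: p2).
    by rewrite linearD linearZ /= p2E.
  apply/boundaryE; exists (q' - p2, q1) => /=; congr (_, _).
    by rewrite linearB /= dq' p2E sub0r opprK.
  rewrite q1E scalerBr.
  have zE (V : zmodType) (u v w : V) : u + v - w + (w - v) = u by rewrite addrA subrK addrK.
  exact: zE.
- elim/cls_ind => -[p q] dz; rewrite (GE _ _ (FZ _ dz)); apply/xzero.
  case: (dz) => _ /eqP; rewrite addr_eq0 => /eqP dq.
  by apply/boundaryE; exists (- q); rewrite linearN /= dq opprK.
- elim/cls_ind => p dp /xzero/boundaryE[q qE].
  have dz : diff (koszul1 x A) (i - 1) (p, - q) = 0.
    by rewrite /= dp oppr0 linearN /= qE addNr.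
  by exists (cls dz); rewrite (GE _ _ (FZ _ dz)); apply/cls_eq; rewrite subrr; exact: boundary0.
Qed.

Section Iterated.
Variable x : nat -> R.

Fixpoint koszul n M : complex R :=
  if n is n'.+1 then koszul1 (x n') (koszul n' M) else M.

Fixpoint koszul_map n A B (f : chain_map A B) : chain_map (koszul n A) (koszul n B) :=
  if n is n'.+1 then koszul1_map (x n') (koszul_map n' f) else f.

Fixpoint koszul_in n M : chain_map M (koszul n M) :=
  if n is n'.+1 then ccomp (cone_in (homothety (x n') (koszul n' M))) (koszul_in n' M)
  else cid_map M.

Lemma koszul_map_comp n A B C (g : chain_map B C) (f : chain_map A B) i z :
  koszul_map n (ccomp g f) i z = koszul_map n g i (koszul_map n f i z).
Proof. by elim: n i z => //= n IH i [p q]; rewrite /= !IH. Qed.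

Lemma koszul_map_id n A i z : koszul_map n (cid_map A) i z = z.
Proof. by elim: n i z => //= n IH i [p q]; rewrite /= !IH. Qed.

Lemma koszul_map_homotopic n A B (f g : chain_map A B) :
  homotopic f g -> homotopic (koszul_map n f) (koszul_map n g).
Proof. by elim: n => //= n IH fg; apply/koszul1_homotopic/IH. Qed.

Lemma koszul_map_qis n A B (f : chain_map A B) : quasi_iso f -> quasi_iso (koszul_map n f).
Proof. by elim: n => //= n IH qf; apply: cone_map_qis; exact: IH. Qed.

Lemma koszul_in_natural n A B (f : chain_map A B) i z :
  koszul_map n f i (koszul_in n A i z) = koszul_in n B i (f i z).
Proof. by elim: n z => //= n IH z; rewrite /= linear0 IH. Qed.

Section Swap.
Variables (y : R) (A B : complex R) (phi : chain_map A B).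

Lemma swap_linear i : linear
  (fun p : (A (i - 1 - 1) * B (i - 1)) * (A (i - 1) * B i) =>
    ((- p.1.1, p.2.1), (p.1.2, p.2.2)) : (A (i - 1 - 1) * A (i - 1)) * (B (i - 1) * B i)).
Proof. by move=> c [[a b] [a' b']] [[d e] [d' e']] /=; rewrite opprD -scalerN. Qed.

(** The two cone constructions commute; the sign on the doubly shifted summand makes the exchange
    compatible with the differentials. *)
Program Definition koszul1_cone : chain_map (koszul1 y (cone phi)) (cone (koszul1_map y phi)) :=
  @ChainMap R (koszul1 y (cone phi)) (cone (koszul1_map y phi)) (fun i => lin_of (@swap_linear i)) _.
Next Obligation.
congr ((_, _), (_, _)).
- by rewrite /= (linearN (diff A _)).
- by rewrite /= opprD scalerN opprK.
- by rewrite /= opprD (linearN (phi _)).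
- by rewrite /= addrAC.
Qed.

End Swap.

(** Compatibility with the inclusions is what transports the vanishing of a class to the cone of
    [koszul_map n phi], where [cone_exact] applies. *)
Lemma koszul_cone n A B (phi : chain_map A B) :
  exists th : chain_map (koszul n (cone phi)) (cone (koszul_map n phi)),
    forall i z, th i (koszul_map n (cone_in phi) i z) = cone_in (koszul_map n phi) i z.
Proof.
elim: n => [|n [th thE]]; first by exists (cid_map _).
exists (ccomp (koszul1_cone (x n) (koszul_map n phi)) (koszul1_map (x n) th)) => i [p q].
by rewrite /= !thE /= oppr0.
Qed.

End Iterated.

Lemma cone_exact A B (phi : chain_map A B) i y :
  hmap (cone_in phi) i y = 0 -> exists u, hmap phi i u = y.
Proof.
move: i y; apply: int_pred_ind => i; elim/cls_ind => z dz.
rewrite (hmapE _ (cmap_cycle (cone_in phi) dz)) => /cls_eq0/boundaryE[[a b] [/eqP da zE]].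
rewrite oppr_eq0 in da; move/eqP: da => da.
exists (cls da); rewrite (hmapE _ (cmap_cycle phi da)); apply/cls_eq.
apply/boundaryE; exists (- b).
by rewrite -zE linearN /= opprD addrCA subrr addr0.
Qed.

End Koszul.

(** * The ghost lemma *)


Section DerivedKoszul.
Variables (R : comNzRingType) (x : nat -> R).
Implicit Types A B C M X Y Z : complex R.

Definition kmap n A B (f : chain_map A B) i :
  {linear homology (koszul x n A) i -> homology (koszul x n B) i} :=
  hmap (koszul_map x n f) i.

Lemma kmap_comp n A B C (g : chain_map B C) (f : chain_map A B) i z :
  kmap n (ccomp g f) i z = kmap n g i (kmap n f i z).
Proof. by rewrite /kmap -hmap_comp; apply: hmap_ext => j y; exact: koszul_map_comp. Qed.

Lemma kmap_id n A i z : kmap n (cid_map A) i z = z.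
Proof.
rewrite -[RHS]hmap_id; apply: hmap_ext => j y; exact: koszul_map_id.
Qed.
Arguments kmap_id n {A i} z.

Lemma kmap_homotopic n A B (f g : chain_map A B) : homotopic f g ->
  forall i, kmap n f i =1 kmap n g i.
Proof. by move=> fg i; apply/hmap_homotopic/koszul_map_homotopic. Qed.
Arguments kmap_homotopic n {A B f g} _ i _.

Lemma kmap_surj n A B (f : chain_map A B) i : quasi_iso f ->
  forall y, exists z, kmap n f i z = y.
Proof. by move=> qf; exact: hmap_qis_surj (koszul_map_qis x n qf). Qed.

Lemma kmap_inj n A B (f : chain_map A B) i : quasi_iso f -> injective (kmap n f i).
Proof. by move=> qf; exact: hmap_qis_inj (koszul_map_qis x n qf). Qed.

(** The left leg is bijective on Koszul homology, so the right leg factors through it. *)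
Lemma dmap_ex n X Y (f : dmor X Y) i :
  exists g : {linear homology (koszul x n X) i -> homology (koszul x n Y) i},
    forall u, g (kmap n (left_leg f) i u) = kmap n (right_leg f) i u.
Proof.
apply: surj_factor; first exact: kmap_surj (left_legP f).
move=> u e; rewrite -[RHS](linear0 (kmap n (right_leg f) i)); congr (kmap _ _ _ _).
by apply: (kmap_inj (left_legP f)); rewrite e linear0.
Qed.

Definition dmap n X Y (f : dmor X Y) i := projT1 (cid (dmap_ex n f i)).

Lemma dmapE n X Y (f : dmor X Y) i u :
  dmap n f i (kmap n (left_leg f) i u) = kmap n (right_leg f) i u.
Proof. exact: (projT2 (cid (dmap_ex n f i))). Qed.
Arguments dmapE n {X Y} f {i} u.

Lemma dmap_eq n X Y (f g : dmor X Y) i : dmor_eq f g -> dmap n f i =1 dmap n g i.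
Proof.
move=> [W [u [v [qu hl hr]]]] z; have [w <-] := kmap_surj qu z.
rewrite {2}(kmap_homotopic n hl) !kmap_comp !dmapE -!kmap_comp.
exact: kmap_homotopic.
Qed.
Arguments dmap_eq n {X Y f g} i _ _.

Lemma dmap_comp n X Y Z (g : dmor Y Z) (f : dmor X Y) (h : dmor X Z) i z :
  dmor_comp g f h -> dmap n h i z = dmap n g i (dmap n f i z).
Proof.
move=> [W [t [k [qt [hom eqh]]]]]; rewrite (dmap_eq n i eqh).
have [w <-] := kmap_surj (quasi_iso_comp (left_legP f) qt) z.
rewrite [LHS](dmapE n (DMor (ccomp (right_leg g) k) (quasi_iso_comp (left_legP f) qt)) w).
rewrite -[LHS]/(kmap n (ccomp (right_leg g) k) i w).
by rewrite !kmap_comp dmapE -(kmap_comp (right_leg f)) (kmap_homotopic n hom) kmap_comp dmapE.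
Qed.
Arguments dmap_comp n {X Y Z g f h} i z _.

Lemma dmap_of n A B (f : chain_map A B) i z : dmap n (dmor_of f) i z = kmap n f i z.
Proof. by rewrite -{1}(kmap_id n z) (dmapE n (dmor_of f)). Qed.

Lemma dmap_iso n X Y (f : dmor X Y) i : dmor_iso f ->
  injective (dmap n f i) /\ forall y, exists z, dmap n f i z = y.
Proof.
move=> [g [gf fg]].
have K z : dmap n g i (dmap n f i z) = z.
  by rewrite -(dmap_comp n i z gf) dmap_of kmap_id.
split=> [u v e|y]; first by rewrite -(K u) e K.
by exists (dmap n g i y); rewrite -(dmap_comp n i y fg) dmap_of kmap_id.
Qed.
Arguments dmap_iso n {X Y f} i _.

Lemma dmap_square n X Y X' Y' (f : dmor X Y) (f' : dmor X' Y') (a : dmor X X') (b : dmor Y Y') i z :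
  dsquare f f' a b -> dmap n b i (dmap n f i z) = dmap n f' i (dmap n a i z).
Proof. by move=> [h [hbf hfa]]; rewrite -(dmap_comp n i z hbf) (dmap_comp n i z hfa). Qed.
Arguments dmap_square n {X Y X' Y' f f' a b} i z _.

Lemma distinguished_exact n X Y Z (f : dmor X Y) (g : dmor Y Z) (h : dmor Z (shift X)) i y :
  distinguished f g h -> dmap n g i y = 0 -> exists u, dmap n f i u = y.
Proof.
move=> [A [B [phi [a [b [c [[_ isob isoc] [sq1 sq2 _]]]]]]]].
have [y' <-] := (dmap_iso n i isob).2 y.
rewrite -(dmap_square n i y' sq2) dmap_of => e.
have {}e : kmap n (cone_in phi) i y' = 0.
  by apply: (dmap_iso n i isoc).1; rewrite e linear0.
have [th thE] := koszul_cone x n phi.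
have [u uE] : exists u, hmap (koszul_map x n phi) i u = y'.
  apply: cone_exact; have <- := hmap_ext (f := ccomp th (koszul_map x n (cone_in phi))) thE.
  by rewrite hmap_comp -/(kmap n (cone_in phi) i) e linear0.
by exists (dmap n a i u); rewrite -(dmap_square n i u sq1) dmap_of -uE.
Qed.

Lemma dmap_cone_in n X Y (f : dmor X Y) i z :
  dmap n.+1 f i (hmap (cone_in (homothety (x n) (koszul x n X))) i z) =
  hmap (cone_in (homothety (x n) (koszul x n Y))) i (dmap n f i z).
Proof.
have [w <-] := kmap_surj (left_legP f) z.
have nat A B (e : chain_map A B) v :
    hmap (cone_in (homothety (x n) (koszul x n B))) i (kmap n e i v) =
    kmap n.+1 e i (hmap (cone_in (homothety (x n) (koszul x n A))) i v).
  rewrite /kmap -!hmap_comp; apply: hmap_ext => j y /=.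
  by rewrite linear0.
by rewrite nat !dmapE nat.
Qed.

Lemma hmap_koszul_inS n M i z : hmap (koszul_in x n.+1 M) i z =
  hmap (cone_in (homothety (x n) (koszul x n M))) i (hmap (koszul_in x n M) i z).
Proof. exact: hmap_comp. Qed.

Lemma dmap_koszul_in n X Y (f : dmor X Y) i z :
  dmap n f i (hmap (koszul_in x n X) i z) = hmap (koszul_in x n Y) i (dmap 0 f i z).
Proof.
elim: n => [|n IH]; first by rewrite [hmap _ i z]hmap_id [RHS]hmap_id.
by rewrite !hmap_koszul_inS dmap_cone_in IH.
Qed.

End DerivedKoszul.

Section Sums.
Variable R : comNzRingType.
Variables A B : complex R.

Program Definition csum_fst : chain_map (csum A B) A :=
  @ChainMap R (csum A B) A (fun i => lin_of (@fst_linear R (A i) (B i))) _.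
Program Definition csum_snd : chain_map (csum A B) B :=
  @ChainMap R (csum A B) B (fun i => lin_of (@snd_linear R (A i) (B i))) _.

Lemma inl_linear i : linear (fun a : A i => (a, 0) : A i * B i).
Proof. by move=> c u v; congr (_, _); rewrite /= scaler0 addr0. Qed.
Lemma inr_linear i : linear (fun b : B i => (0, b) : A i * B i).
Proof. by move=> c u v; congr (_, _); rewrite /= scaler0 addr0. Qed.

Program Definition csum_inl : chain_map A (csum A B) :=
  @ChainMap R A (csum A B) (fun i => lin_of (@inl_linear i)) _.
Next Obligation. by rewrite linear0. Qed.
Program Definition csum_inr : chain_map B (csum A B) :=
  @ChainMap R B (csum A B) (fun i => lin_of (@inr_linear i)) _.
Next Obligation. by rewrite linear0. Qed.

Lemma homology_csum i : retract (homology (csum A B) i) (homology A i * homology B i)%type.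
Proof.
exists (lin_of (pair_linear (hmap csum_fst i) (hmap csum_snd i))).
exists (lin_of (copair_linear (hmap csum_inl i) (hmap csum_inr i))).
elim/cls_ind => -[a b] dz.
have /= Ef := hmapE dz (cmap_cycle csum_fst dz).
have /= Es := hmapE dz (cmap_cycle csum_snd dz).
have /= El := hmapE _ (cmap_cycle csum_inl (cmap_cycle csum_fst dz)).
have /= Er := hmapE _ (cmap_cycle csum_inr (cmap_cycle csum_snd dz)).
rewrite /= Ef Es El Er.
rewrite -[X in X + _]scale1r.
have dd : diff (csum A B) i (1 *: (a, 0) + (0, b)) = 0.
  rewrite scale1r; case: (dz) => da' db'; congr (_, _) => /=.
    by rewrite addr0.
  by rewrite add0r.
rewrite (cls_lin _ _ dd); apply/cls_eq.
have -> : 1 *: (a, 0) + (0, b) - (a, b) = 0 :> csum A B i.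
  by rewrite scale1r; congr (_, _); rewrite /= ?addr0 ?add0r subrr.
exact: boundary0.
Qed.

Lemma homology_summand i : retract (homology A i) (homology (csum A B) i).
Proof.
exists (hmap csum_inl i), (hmap csum_fst i) => z.
by rewrite -hmap_comp -[RHS]hmap_id; apply: hmap_ext.
Qed.

End Sums.

Section LowerBound.
Variables (R : comNzRingType).
Implicit Types M X Y : complex R.

Lemma homology_shift X i :
  retract (homology (shift X) i) (homology X (i - 1)) /\
  retract (homology X (i - 1)) (homology (shift X) i).
Proof.
apply: (@homology_retract R (shift X) X i (i - 1) idfun) => [z /eqP|z /shift_boundary //|z _ /shift_boundary //|w dw].
  by rewrite oppr_eq0 => /eqP.
by exists w; [rewrite /= dw oppr0 | rewrite subrr; exact: boundary0].
Qed.

Lemma homology_stalk (N : lmodType R) i :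
  retract (homology (stalk N) i) N /\ (i != 0 -> forall y : homology (stalk N) i, y = 0).
Proof.
have bd0 k (z : stalk N k) : boundary z -> z = 0 by case.
case: (eqVneq i 0) => [->|i0].
  split=> //.
  have lc : linear (fun z : N => @cls R (stalk N) 0 z erefl).
    by move=> a u v; apply/esym/cls_lin.
  have [||_ //] := @bij_ker0_retract R _ _ (lin_of lc).
    by move=> v /cls_eq0/bd0.
  elim/cls_ind => z dz; exists z; apply/cls_eq.
  by rewrite subrr; exact: boundary0.
have H0 : forall y : homology (stalk N) i, y = 0.
  elim/cls_ind => z dz; apply/cls_eq0.
  have -> : z = 0 by move: i i0 z {dz} => [[|k]|k] // _ z; exact: thinmx0.
  exact: boundary0.
split=> //.
exists (lin_of (@zero_linear R _ _)), (lin_of (@zero_linear R _ _)) => y.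
by rewrite [RHS]H0.
Qed.

Lemma thick1_homology_injective X : thick1 (@injectives R) X ->
  forall i, injective_module (homology X i).
Proof.
elim=> {X} [X [I [injI ->]]|X Y [f isof] _ IH|X _ IH|X _ IH||X Y _ IHX _ IHY|X Y _ IH] i.
- exact: retract_injective (homology_stalk I i).1 injI.
(* At n = 0 [dmap] acts on plain homology, so any sequence will do. *)
- have [finj fsurj] := dmap_iso (fun=> 0) 0 i isof.
  exact: retract_injective (lin_bij_retract finj fsurj).2 (IH i).
- exact: retract_injective (homology_shift X i).1 (IH _).
- move: i; apply: int_pred_ind => i.
  exact: retract_injective (homology_shift X i).2 (IH _).
- apply: retract_injective (homology_stalk _ i).1 _; apply: zero_injective => v.
  exact: thinmx0.
- exact: retract_injective (homology_csum X Y i) (prod_injective (IHX i) (IHY i)).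
- exact: retract_injective (homology_summand X Y i) (IH i).
Qed.

Lemma koszul_injective_over (s : seq R) X : regular_seq s ->
  (forall i, injective_module (homology X i)) ->
  forall n, (n <= size s)%N -> forall i, injective_over (take n s) (homology (koszul (nth 0 s) n X) i).
Proof.
move=> [_ sreg] injX; elim=> [_ i|n IH ns i].
  by rewrite take0; exact: injective_over_nil.
rewrite (take_nth 0 ns); apply: koszul1_injective_over => j; first exact/IH/ltnW.
exact: injective_over_surj (IH (ltnW ns) j) (sreg n ns).
Qed.

Lemma thick1_koszul_in_zero (s : seq R) X n : regular_seq s -> thick1 (@injectives R) X ->
  (n < size s)%N ->
  forall i y, hmap (cone_in (homothety s`_n (koszul (nth 0 s) n X))) i y = 0.
Proof.
move=> sreg /thick1_homology_injective injX ns; apply: koszul1_in_zero => i.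
by apply: injective_over_surj (koszul_injective_over sreg injX (ltnW ns) i) (sreg.2 n ns).
Qed.

(* The ghost lemma, for the chain of ghosts [koszul j M -> koszul j.+1 M]. *)
Lemma thick_koszul_in_zero (s : seq R) n M : regular_seq s -> (n <= size s)%N ->
  thick (@injectives R) n M -> forall i y, hmap (koszul_in (nth 0 s) n M) i y = 0.
Proof.
move=> sreg; elim: n M => [|n IH] M ns.
  move=> [f isof] i y; rewrite [LHS]hmap_id.
  apply: (dmap_iso (nth 0 s) 0 i isof).1; rewrite linear0.
  apply: (retract_zero (homology_stalk _ i).1); exact: thinmx0.
(* [thick] treats 1 apart from larger levels, hence a second case split. *)
suff H : forall M, (n < size s)%N -> thick (@injectives R) n.+1 M ->
    forall i y, hmap (koszul_in (nth 0 s) n.+1 M) i y = 0 by exact: H.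
case: n IH ns => [|n] IH ns {}M _.
  move=> tM i y; rewrite hmap_koszul_inS; exact: (thick1_koszul_in_zero sreg tM ns).
move=> [K [L [N [f [g [h [dist tK tN]]]]]]] i y.
rewrite -[y]hmap_id.
(* The triangle contains M only as a summand: [y] is pushed into the sum with L and projected back
   at the end. *)
have yE : hmap (cid_map M) i y = hmap (csum_snd L M) i (hmap (csum_inr L M) i y).
  by rewrite -hmap_comp; apply: hmap_ext.
rewrite yE; set w := hmap (csum_inr L M) i y.
have nat A B (e : chain_map A B) v : hmap (koszul_in (nth 0 s) n.+2 B) i (hmap e i v)
    = kmap (nth 0 s) n.+2 e i (hmap (koszul_in (nth 0 s) n.+2 A) i v).
  by rewrite /kmap -!hmap_comp; apply: hmap_ext => j z; exact: (esym (koszul_in_natural (nth 0 s) n.+2 e z)).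
rewrite nat hmap_koszul_inS.
(* N has level at most n + 1, so the first n + 1 ghosts kill the image of [w] in N. By exactness the
   class of [w] then comes from K, which the last ghost kills. *)
have [u uE] : exists u, dmap (nth 0 s) n.+1 f i u = hmap (koszul_in (nth 0 s) n.+1 (csum L M)) i w.
  apply: distinguished_exact dist _; rewrite dmap_koszul_in.
  by apply: IH => //; exact: ltnW.
rewrite -uE -dmap_cone_in (thick1_koszul_in_zero sreg tK) //.
by rewrite !linear0.
Qed.

End LowerBound.

(** * The lower bound *)


Section LowestDegree.
Variables (R : comNzRingType) (m : set R).
Hypotheses (R_noetherian : noetherian R) (R_local : local_with m).
Implicit Types A M : complex R.

Lemma koszul1_in_surj x A i : (forall y : homology A (i - 1), y = 0) ->
  forall w, exists y, hmap (cone_in (homothety x A)) i y = w.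
Proof.
move: i; apply: int_pred_ind => i A0; elim/cls_ind => -[p q] dz.
case: (dz) => /eqP dp dq; rewrite oppr_eq0 in dp; move/eqP: dp => dp.
have /cls_eq0/boundaryE[p2 p2E] := A0 (cls dp).
have dq' : diff A (i - 1) (q + x *: p2) = 0 by rewrite linearD linearZ /= p2E.
exists (cls dq'); rewrite (hmapE _ (cmap_cycle (cone_in (homothety x A)) dq')).
apply/cls_eq/boundaryE; exists (p2, 0) => /=; congr (_, _) => /=.
  by rewrite p2E sub0r.
by rewrite linear0 add0r addrAC subrr add0r.
Qed.

Lemma koszul1_in_kernel x A i (y : homology A i) :
  hmap (cone_in (homothety x A)) i y = 0 -> exists u, y = x *: u.
Proof.
move=> /cone_exact[u <-]; exists u; elim/cls_ind: u => z dz.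
rewrite (hmapE _ (cmap_cycle (homothety x A) dz)).
by apply/esym; exact: clsZ.
Qed.

Variables (s : seq R) (M : complex R) (i0 : int).
Hypothesis sm : forall x, x \in s -> m x.
Hypothesis low : forall (k : nat) (y : homology M (i0 - 1 - k%:Z)), y = 0.

Lemma koszul_low n (k : nat) (y : homology (koszul (nth 0 s) n M) (i0 - 1 - k%:Z)) : y = 0.
Proof.
elim: n k y => [|n IH] k y; first exact: low.
have [|y' <-] := koszul1_in_surj (x := s`_n) (A := koszul (nth 0 s) n M) (i := i0 - 1 - k%:Z) _ y.
  have -> : i0 - 1 - k%:Z - 1 = i0 - 1 - k.+1%:Z by lia.
  exact: IH.
by rewrite (IH _ y') linear0.
Qed.

Lemma koszul_in_surj n y : exists z, hmap (koszul_in (nth 0 s) n M) i0 z = y.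
Proof.
elim: n y => [|n IH] y; first by exists y; exact: hmap_id.
have [|y' <-] := koszul1_in_surj (x := s`_n) (A := koszul (nth 0 s) n M) (i := i0) _ y.
  by have := @koszul_low n 0; rewrite subr0.
by have [z <-] := IH y'; exists z; exact: hmap_koszul_inS.
Qed.

(** A class killed by the last inclusion is s_n u, and [u] lifts to some [v] in H_i0 M; then z - s_n
    v dies one stage earlier, while s_n v is in U. *)
Lemma koszul_in_kernel (U : set (homology M i0)) n : submod U ->
  (forall a z, m a -> U (a *: z)) -> (n <= size s)%N ->
  forall z, hmap (koszul_in (nth 0 s) n M) i0 z = 0 -> U z.
Proof.
move=> hU mU; elim: n => [|n IH] ns z.
  by rewrite [hmap _ _ _]hmap_id => ->; exact: hU.1.
rewrite hmap_koszul_inS => /koszul1_in_kernel[u uE].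
have [v vE] := koszul_in_surj u.
rewrite -[z](subrK (s`_n *: v)); apply: submodD => //; last first.
  by apply: mU; apply: sm; exact: mem_nth.
apply: IH; first exact: ltnW.
by rewrite linearB linearZ_LR vE uE subrr.
Qed.

End LowestDegree.

Lemma thick_regular_lt (R : comNzRingType) (m : set R) (M : complex R) (s : seq R) n :
  noetherian R -> local_with m -> bounded_fg_homology M ->
  (exists (i : int) (x : homology M i), x <> 0) ->
  regular_seq s -> (forall x, x \in s -> m x) ->
  thick (@injectives R) n M -> (size s < n)%N.
Proof.
move=> R_noeth R_loc [[b Mb] Mfg] Mnz sreg sm tM; rewrite ltnNge; apply/negP => ns.
have [i0 [low [x0 x0nz]]] : exists i0, (forall (k : nat) (y : homology M (i0 - 1 - k%:Z)), y = 0)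
    /\ exists x : homology M i0, x <> 0.
  (* Translation by [b] makes all nonzero degrees natural numbers, so that a least one exists. *)
  pose P k := `[< exists x : homology M (k%:Z - b%:Z), x <> 0 >].
  have exP : exists k, P k.
    case: Mnz => i [x xnz]; have ib : - b%:Z <= i.
      by rewrite leNgt; apply/negP => ib; apply: xnz; apply: Mb; lia.
    exists (absz (i + b%:Z)); apply/asboolP.
    have e : (absz (i + b%:Z))%:Z - b%:Z = i by lia.
    by rewrite e; exists x.
  have [k0 /asboolP k0P k0min] := ex_minnP exP.
  exists (k0%:Z - b%:Z); split=> // k y; case: (ltnP k k0) => kk; last first.
    by apply: Mb; lia.
  apply: contrapT => ynz.
  suff /k0min : P (k0 - k.+1)%N by lia.
  apply/asboolP.
  have e : (k0 - k.+1)%N%:Z - b%:Z = k0%:Z - b%:Z - 1 - k%:Z by lia.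
  by rewrite e; exists y.
have [gens gensE] := Mfg i0.
have gen v : lspan gens v by apply/lspanE; exact: gensE.
have [||||||U [hU _ [v _ nUv] mU]] := @nakayama R m R_noeth R_loc (homology M i0) setT [set 0]%classic gens.
- by [].
- by split=> // a x y -> ->; rewrite scaler0 addr0.
- by [].
- by [].
- by move=> v _; exists 0 => //; rewrite subr0.
- by move=> /(_ x0 I).
apply: nUv; apply: (koszul_in_kernel sm low hU (n := n)) => //.
  by move=> a z ma; exact: mU.
exact: thick_koszul_in_zero.
Qed.

(** * Desuspension and the Ore condition *)


Section Unshift.
Variable R : comNzRingType.
Implicit Types A B M X Y : complex R.

(** [i + 1 - 1] and [i] are not convertible; the casts caused by desuspension are confined to
    [degcast] and its lemmas. *)
Definition degcast Y i j (e : i = j) : {linear Y i -> Y j} :=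
  match e in _ = k return {linear Y i -> Y k} with erefl => idfun end.

Lemma degcast_comp Y i j k (e : i = j) (f : j = k) x :
  degcast Y f (degcast Y e x) = degcast Y (etrans e f) x.
Proof. by case: _ / f. Qed.

Lemma degcast_diff Y i j (e : i = j) (f : i - 1 = j - 1) x :
  degcast Y f (diff Y i x) = diff Y j (degcast Y e x).
Proof. by case: _ / e f => f; rewrite (eq_axiomK f). Qed.

Lemma degcast_inj Y i j (e : i = j) x : degcast Y e x = 0 -> x = 0.
Proof. by case: _ / e. Qed.

Lemma degcast_surj Y i j (e : i = j) y : exists x, degcast Y e x = y.
Proof. by case: _ / e y => y; exists y. Qed.

Section UnshiftComplex.
Variable Y : complex R.

Lemma unshift_deg (i : int) : i + 1 - 1 = i - 1 + 1.
Proof. by rewrite addrK subrK. Qed.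

Lemma unshift_linear i : linear (fun x : Y (i + 1) =>
  - degcast Y (unshift_deg i) (diff Y (i + 1) x)).
Proof. by move=> a x y; rewrite !linearP. Qed.

Program Definition unshift : complex R :=
  @Complex R (fun i => Y (i + 1)) (fun i => lin_of (@unshift_linear i)) _.
Next Obligation.
rewrite linearN linearN opprK.
rewrite -(degcast_diff (unshift_deg i) (congr1 (fun j => j - 1) (unshift_deg i))).
by rewrite diffK !linear0.
Qed.

Program Definition unshiftK : chain_map (shift unshift) Y :=
  @ChainMap R (shift unshift) Y (fun i => degcast Y (subrK 1 i)) _.
Next Obligation.
rewrite opprK degcast_comp; exact: degcast_diff.
Qed.

Program Definition unshiftV : chain_map Y (shift unshift) :=
  @ChainMap R Y (shift unshift) (fun i => degcast Y (esym (subrK 1 i))) _.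
Next Obligation.
rewrite opprK -(degcast_diff _ (congr1 (fun j => j - 1) (esym (subrK 1 i)))).
rewrite degcast_comp; congr (degcast Y _ _); exact: Prop_irrelevance.
Qed.

Lemma unshiftV_qis : quasi_iso unshiftV.
Proof.
by apply: iso_qis => [i x|i y]; [exact: (@degcast_inj Y _ _ (esym (subrK 1 i)) x) | exact: (degcast_surj (esym (subrK 1 i)) y)].
Qed.

Lemma unshiftK_qis : quasi_iso unshiftK.
Proof.
by apply: iso_qis => [i x|i y]; [exact: degcast_inj | exact: (degcast_surj (subrK 1 i) y)].
Qed.

End UnshiftComplex.

Lemma shift_full A B (F : chain_map (shift A) (shift B)) :
  exists G : chain_map A B, forall i x, G (i - 1) x = F i x.
Proof.
pose P j := {linear A j -> B j}.
pose G j : P j := ecast k (P k) (addrK 1 j) (F (j + 1)).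
have GE i : G (i - 1) = F i.
  rewrite /G; move: (addrK 1 (i - 1)); move: (subrK 1 i).
  by move: (i - 1 + 1) => k -> e; rewrite (eq_axiomK e).
have Gd : forall i x, G (i - 1) (diff A i x) = diff B i (G i x).
  apply: int_pred_ind => i x; rewrite !GE.
  have /= := cmapP F (x : shift A i); rewrite linearN => /oppr_inj e; exact: e.
by exists (ChainMap Gd) => i x /=; rewrite GE.
Qed.

Lemma quasi_iso_unshift A B (f : chain_map A B) : quasi_iso (shift_map f) -> quasi_iso f.
Proof.
move=> /quasi_isoP qf; apply/quasi_isoP; apply: int_pred_ind => i; have [fi fs] := qf i.
split=> [z dz bz|w dw].
  by apply/shift_boundary/fi; [rewrite /= dz oppr0 | apply/shift_boundary].
have [|z /= dz bz] := fs w; first by rewrite /= dw oppr0.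
exists z; first by apply/eqP; rewrite -oppr_eq0 dz.
exact/shift_boundary.
Qed.

Section Ore.
Variables (K M X : complex R) (psi : chain_map K X) (s : chain_map M X).

Lemma ore_linear i : linear (fun p : K i * M i => psi i p.1 - s i p.2).
Proof. by move=> a [x y] [z t] /=; rewrite !linearP scalerDr addrACA. Qed.

(** Its cone, desuspended, is the homotopy pullback of [psi] and [s]. *)
Program Definition ore_map : chain_map (csum K M) X :=
  @ChainMap R (csum K M) X (fun i => lin_of (@ore_linear i)) _.
Next Obligation. by rewrite linearB !cmapP. Qed.

Definition ore_proj : chain_map (cone ore_map) (shift K) :=
  ccomp (shift_map (csum_fst K M)) (cone_out ore_map).

Lemma ore_proj_qis : quasi_iso s -> quasi_iso ore_proj.
Proof.
move=> /quasi_isoP qs; apply/quasi_isoP; apply: int_pred_ind => i.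
have [si2 ss2] := qs (i - 1 - 1); have [_ ss1] := qs (i - 1).
split=> [[[k n] x] [/eqP dk /eqP dn] /= dx /boundaryE[k1 /= k1E]|k].
  rewrite oppr_eq0 in dk; move/eqP: dk => dk; rewrite oppr_eq0 in dn; move/eqP: dn => dn.
  have {}dk1 : diff K (i - 1) k1 = - k by rewrite -k1E opprK.
  have sn : s _ n = diff X (i - 1) (x - psi _ k1).
    move/eqP: dx; rewrite addr_eq0 opprB => /eqP dx.
    by rewrite linearB /= dx -cmapP dk1 linearN opprK subrK.
  have /boundaryE[n1 n1E] : boundary n.
    by apply: si2 => //; rewrite sn; exact: Boundary.
  have [|n2 dn2 /boundaryE[x1 x1E]] := ss1 (x - psi _ k1 - s _ n1).
    by rewrite linearB -sn -cmapP n1E subrr.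
  apply/boundaryE; exists ((k1, - (n1 + n2)), - x1) => /=; congr ((_, _), _).
  - by rewrite dk1 opprK.
  - by rewrite (linearN (diff M _)) opprK linearD dn2 addr0.
  - rewrite (linearN (diff X i)) (linearN (s _)) opprK x1E (linearD (s _)).
    have zE (V : zmodType) (a b c d : V) : - (a - (b - c - d)) + (c + (d + a)) = b.
      have e : b - c - d - a = b - (c + (d + a)) by rewrite !opprD !addrA.
      by rewrite opprB e subrK.
    exact: zE.
rewrite /= => /eqP; rewrite oppr_eq0 => /eqP dk.
have [|n dn /boundaryE[x xE]] := ss2 (psi _ k); first by rewrite -cmapP dk linear0.
exists ((k, n), x) => /=; last by rewrite subrr; exact: boundary0.
by rewrite dk dn !oppr0 xE addrC subrKA subrr.
Qed.

Lemma ore : quasi_iso s ->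
  exists W (t : chain_map W K) (k : chain_map W M),
    quasi_iso t /\ homotopic (ccomp psi t) (ccomp s k).
Proof.
move=> qs; pose th := unshiftK (cone ore_map).
have [t tE] := shift_full (ccomp ore_proj th).
have [k kE] := shift_full (ccomp (ccomp (shift_map (csum_snd K M)) (cone_out ore_map)) th).
exists (unshift (cone ore_map)), t, k; split.
  apply: quasi_iso_unshift; apply: (@qis_ext R _ _ (ccomp ore_proj th)).
    by move=> i z; rewrite /= tE.
  by apply: quasi_iso_comp; [exact: ore_proj_qis | exact: unshiftK_qis].
(* The homotopy is minus the X-component of the cone; the X-component of the chain map equation for
   [th] is the required identity. *)
have lh i : linear (fun x : shift (unshift (cone ore_map)) i => - (th i x).2).
  by move=> a x y; rewrite linearP opprD scalerN.
exists (fun i => lin_of (lh i)) => i x.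
have := cmapP th (x : shift _ i); set y := th i x => /(congr1 snd).
rewrite [in X in X -> _]/= -/y linearN /= => e.
have zE (V : zmodType) (z a b : V) : - z = a + b -> b = - a - z by move=> ->; rewrite addKr.
rewrite /= tE kE /= -/y -/th (linearN (diff X i)); exact: zE e.
Qed.

End Ore.
End Unshift.

(** * The upper bound *)


Section Triangles.
Variable R : comNzRingType.
Implicit Types A B M X Y K N Z C : complex R.

Lemma strictly_equal_legs X Y (f g : dmor X Y) W (u : chain_map W (apex f)) (v : chain_map W (apex g)) :
  quasi_iso u ->
  (forall i z, left_leg f i (u i z) = left_leg g i (v i z)) ->
  (forall i z, right_leg f i (u i z) = right_leg g i (v i z)) ->
  [/\ quasi_iso (ccomp (left_leg f) u),
      homotopic (ccomp (left_leg f) u) (ccomp (left_leg g) v) &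
      homotopic (ccomp (right_leg f) u) (ccomp (right_leg g) v)].
Proof.
move=> qu hl hr; split; first exact: quasi_iso_comp (left_legP f) qu.
  exact: homotopic_refl.
exact: homotopic_refl.
Qed.

Lemma roof_iso X Y (f : dmor X Y) : quasi_iso (right_leg f) -> dmor_iso f.
Proof.
move=> qr; exists (DMor (left_leg f) qr); split.
  exists (apex f), (cid_map _), (cid_map _), (quasi_iso_id _); split.
    exact: homotopic_refl.
  exists (apex f), (left_leg f), (cid_map _); apply: strictly_equal_legs => //; exact: left_legP.
exists (apex f), (cid_map _), (cid_map _), (quasi_iso_id _); split.
  exact: homotopic_refl.
by exists (apex f), (right_leg f), (cid_map _); apply: strictly_equal_legs.
Qed.

Lemma qis_diso A B (f : chain_map A B) : quasi_iso f -> diso A B /\ diso B A.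
Proof.
move=> qf; split; first by exists (dmor_of f); exact: roof_iso.
by exists (DMor (cid_map A) qf); apply: roof_iso; exact: quasi_iso_id.
Qed.

Lemma csum_inr_qis A B : (forall i (a : A i), a = 0) -> quasi_iso (csum_inr A B).
Proof.
move=> A0; apply: iso_qis => [i b [] //|i [a b]].
by exists b; rewrite (A0 i a).
Qed.

Lemma zero_complex_zero i (z : (zero_complex R) i) : z = 0.
Proof. by move: i z => [[|k]|k] z; exact: thinmx0. Qed.

(** [psi] ends in X, while the definition wants a morphism into L + M with M quasi-isomorphic to X:
    the Ore condition moves [psi] back along [s]. Here L = 0. *)
Lemma thick_of_triangle (Cs : complex R -> Prop) n K X N M
    (psi : chain_map K X) (q : chain_map (cone psi) N) (s : chain_map M X) :
  quasi_iso q -> quasi_iso s -> thick1 Cs K -> thick Cs n.+1 N -> thick Cs n.+2 M.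
Proof.
move=> qq qs tK tN; set L := zero_complex R.
have [W [t [k [qt hom]]]] := ore psi qs.
have qinr := csum_inr_qis M zero_complex_zero.
exists K, L, N, (DMor (ccomp (csum_inr L M) k) qt),
  (dmor_of (ccomp (ccomp (ccomp q (cone_in psi)) s) (csum_snd L M))),
  (DMor (cone_out psi) qq); split=> //.
exists K, X, psi, (dmor_id K), (DMor (csum_inr L M) qs), (dmor_of q); split; split.
- exact/roof_iso/quasi_iso_id.
- exact: roof_iso.
- exact: roof_iso.
- exists (DMor (ccomp (csum_inr L M) k) qt); split.
    exists W, t, k, qt; split=> //.
    exists W, (cid_map _), (cid_map _); apply: strictly_equal_legs => //; exact: quasi_iso_id.
  exists W, t, (cid_map _), qt; split; first exact: homotopic_refl.
  exists W, (cid_map _), (cid_map _); apply: strictly_equal_legs => //; exact: quasi_iso_id.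
- exists (DMor (ccomp (ccomp q (cone_in psi)) s) qs); split.
    exists X, (cid_map _), (cone_in psi), (quasi_iso_id _); split; first exact: homotopic_refl.
    exists M, (cid_map _), s; apply: strictly_equal_legs => //; exact: quasi_iso_id.
  exists M, (cid_map _), (csum_inr L M), (quasi_iso_id _); split; first exact: homotopic_refl.
  exists M, (cid_map _), (cid_map _); apply: strictly_equal_legs => //; exact: quasi_iso_id.
- exists (dmor_of (cone_out psi)); split.
    exists (cone psi), (cid_map _), (cone_out psi), (quasi_iso_id _); split; first exact: homotopic_refl.
    exists (cone psi), (cid_map _), (cid_map _); apply: strictly_equal_legs => //; exact: quasi_iso_id.
  exists (cone psi), (cid_map _), (cid_map _), (quasi_iso_id _); split; first exact: homotopic_refl.
  exists (cone psi), (cid_map _), (cid_map _); apply: strictly_equal_legs => //; exact: quasi_iso_id.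
Qed.

Section ConeOfInclusion.
Variables (Z C : complex R) (psi : chain_map Z C).

Lemma cone_in_out_linear i : linear (fun p : C (i - 1) * (Z (i - 1) * C i) => p.2.1).
Proof. by []. Qed.

Program Definition cone_in_out : chain_map (cone (cone_in psi)) (shift Z) :=
  @ChainMap R (cone (cone_in psi)) (shift Z) (fun i => lin_of (@cone_in_out_linear i)) _.
Next Obligation. by rewrite addr0. Qed.

Lemma cone_in_out_qis : quasi_iso cone_in_out.
Proof.
apply/quasi_isoP; apply: int_pred_ind => i; split.
  move=> [c [z c']] [/eqP dc dz dc'] /boundaryE[z1 /= z1E].
  rewrite oppr_eq0 in dc; move/eqP: dc => dc.
  apply/boundaryE; exists (c' - psi _ z1, (z1, 0)) => /=; congr (_, (_, _)).
  - rewrite linearB -cmapP -[diff Z _ z1]opprK z1E linearN opprK.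
    have zE (V : zmodType) (a b e : V) : a + b + e = 0 -> - (a + b) = e.
      by move=> /eqP; rewrite addrC addr_eq0 => /eqP ->.
    exact: zE.
  - by rewrite /= addr0.
  - have zE (V : zmodType) (a b e : V) : a = 0 -> a + b + (e - b) = e.
      by move=> ->; rewrite add0r addrC subrK.
    by rewrite /=; apply: zE; rewrite linear0.
move=> z /= /eqP; rewrite oppr_eq0 => /eqP dz.
exists (- psi _ z, (z, 0)) => /=; last by rewrite subrr; exact: boundary0.
congr (_, (_, _)) => /=.
- by rewrite (linearN (diff C _)) opprK -cmapP dz linear0.
- by rewrite /= dz oppr0 addr0.
- by rewrite /= linear0 add0r subrr.
Qed.
End ConeOfInclusion.

Section ConeOfComposite.
Variables (K Z C N : complex R) (psi : chain_map Z C) (kappa : chain_map K C).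
Variables (q : chain_map (cone kappa) N).

Lemma cone_swap_linear i : linear (fun p : K (i - 1) * (Z (i - 1) * C i) =>
  (p.2.1, (p.1, p.2.2)) : Z (i - 1) * (K (i - 1) * C i)).
Proof. by []. Qed.

(** The octahedral axiom in strict form: both iterated cones have the same three summands, and only
    their order differs. *)
Program Definition cone_swap :
    chain_map (cone (ccomp (cone_in psi) kappa)) (cone (ccomp (cone_in kappa) psi)) :=
  @ChainMap R (cone (ccomp (cone_in psi) kappa)) (cone (ccomp (cone_in kappa) psi))
    (fun i => lin_of (@cone_swap_linear i)) _.
Next Obligation.
by congr (_, (_, _)); rewrite /= ?addr0 ?oppr0 ?add0r // addrAC.
Qed.

Lemma cone_swap_qis : quasi_iso cone_swap.
Proof.
apply: iso_qis => [i [k [z c]] [-> -> ->] //|i [z [k c]]].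
by exists (k, (z, c)).
Qed.

Program Definition cone_descend :
    chain_map (cone (ccomp (cone_in kappa) psi)) (cone (ccomp q (ccomp (cone_in kappa) psi))) :=
  @cone_map R _ _ _ _ (ccomp (cone_in kappa) psi) (ccomp q (ccomp (cone_in kappa) psi))
    (cid_map Z) q _.

Lemma cone_descend_qis : quasi_iso q -> quasi_iso cone_descend.
Proof. by move=> qq; apply: cone_map_qis => //; exact: quasi_iso_id. Qed.

End ConeOfComposite.

Section Tower.
Variable Cs : complex R -> Prop.

Fixpoint tower n X : Prop :=
  if n is n'.+1 then
    exists Z C (psi : chain_map Z C), [/\ X = cone psi, thick1 Cs Z & tower n' C]
  else thick1 Cs X.

(* [tower] splits off an object of [thick1] as a quotient, [thick] as a subobject. *)
Lemma tower_reassoc n X : tower n.+1 X ->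
  exists K N (psi : chain_map K X) (q : chain_map (cone psi) N),
    [/\ thick1 Cs K, tower n N & quasi_iso q].
Proof.
elim: n X => [|n IH] _ [Z [C [psi [-> tZ tC]]]].
  exists C, (shift Z), (cone_in psi), (cone_in_out psi); split=> //.
    exact: thick1_shift.
  exact: cone_in_out_qis.
(* K, the first piece of C, is also the first piece of [cone psi]; the rest becomes the cone of Z ->
   N, again a tower of height n + 1. *)
have [K [N [kappa [q [tK tN qq]]]]] := IH C tC.
exists K, (cone (ccomp q (ccomp (cone_in kappa) psi))), (ccomp (cone_in psi) kappa).
exists (ccomp (cone_descend psi q) (cone_swap psi kappa)); split=> //.
  by exists Z, N, (ccomp q (ccomp (cone_in kappa) psi)).
apply: quasi_iso_comp; first exact: cone_descend_qis.
exact: cone_swap_qis.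
Qed.

Lemma tower_thick n X M (s : chain_map M X) : quasi_iso s -> tower n X -> thick Cs n.+1 M.
Proof.
elim: n X M s => [|n IH] X M s qs.
  by move=> tX; apply: thick1_iso tX; exact: (qis_diso qs).2.
move=> /tower_reassoc[K [N [psi [q [tK tN qq]]]]].
apply: (thick_of_triangle (q := q) qq qs tK).
exact: IH (quasi_iso_id N) tN.
Qed.

End Tower.
End Triangles.

(** * Complexes with zero differential *)

Section ZeroDifferential.
Variable R : comNzRingType.

Definition zero_diff (I : int -> lmodType R) : complex R :=
  @Complex R I (fun i => lin_of (@zero_linear R _ _)) (fun _ _ => erefl).

Lemma zero_diff_diso (A B : complex R) :
  (forall i x, diff A i x = 0) -> (forall i x, diff B i x = 0) ->
  (forall i, exists f : {linear A i -> B i},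
    (forall x, f x = 0 -> x = 0) /\ forall y, exists x, f x = y) ->
  diso A B.
Proof.
move=> dA dB ex.
pose f i := projT1 (cid (ex i)).
have fP i : (forall x, f i x = 0 -> x = 0) /\ forall y, exists x, f i x = y.
  exact: (projT2 (cid (ex i))).
have fd i x : f (i - 1) (diff A i x) = diff B i (f i x) by rewrite dA dB linear0.
by have [] := qis_diso (iso_qis (f := ChainMap fd) (fun i => (fP i).1) (fun i => (fP i).2)).
Qed.

Definition off0 (I : int -> lmodType R) (i : int) : lmodType R :=
  if i is Posz 0 then 'rV[R]_0 else I i.

(** Degree 0 is split off as a stalk, and the remainder is shifted up into a shorter window; the
    half-open window is empty for b = 0. *)
Lemma thick1_window (b : nat) (I : int -> lmodType R) :
  (forall i, injective_module (I i)) ->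
  (forall i : int, ~~ (- b%:Z < i <= 0) -> forall x : I i, x = 0) ->
  thick1 (@injectives R) (zero_diff I).
Proof.
elim: b I => [|b IH] I injI I0.
  have {}I0 i (x : I i) : x = 0 by apply: I0; lia.
  apply: thick1_iso (thick1_zero _); apply: zero_diff_diso => // i.
  exists (lin_of (@zero_linear R _ _)); split=> [x _|y]; first exact: zero_complex_zero.
  by exists 0; rewrite [RHS]I0.
have iso1 : diso (csum (stalk (I 0)) (zero_diff (off0 I))) (zero_diff I).
  apply: zero_diff_diso => // -[[|k]|k].
  - exists (lin_of (@fst_linear R _ _)); split=> [[x y] /= ->|y]; last by exists (y, 0).
    by congr (_, _); exact: thinmx0.
  - exists (lin_of (@snd_linear R _ _)); split=> [[x y] /= ->|y]; last by exists (0, y).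
    by congr (_, _); exact: thinmx0.
  - exists (lin_of (@snd_linear R _ _)); split=> [[x y] /= ->|y]; last by exists (0, y).
    by congr (_, _); exact: thinmx0.
apply: thick1_iso iso1 _; apply: thick1_sum.
  by apply: thick1_in; exists (I 0).
apply: thick1_unshift; apply: (@thick1_iso _ _ (zero_diff (fun i => off0 I (i - 1)))).
  apply: zero_diff_diso => [//|i x|i]; first exact: oppr0.
  by exists idfun; split=> // y; exists y.
apply: IH => i.
  case: (i - 1) => [[|k]|k]; [|exact: injI|exact: injI].
  by apply: zero_injective; exact: thinmx0.
move=> ib; have : ~~ (- b.+1%:Z < i - 1 <= 0) \/ i - 1 = 0 by lia.
case=> [h|->]; last exact: thinmx0.
have {}h := I0 _ h; case: (i - 1) h => [[|k]|k] //= _; exact: thinmx0.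
Qed.

Lemma thick1_zero_diff (b : nat) (I : int -> lmodType R) :
  (forall i, injective_module (I i)) ->
  (forall i : int, (b < `|i|)%N -> forall x : I i, x = 0) ->
  thick1 (@injectives R) (zero_diff I).
Proof.
suff H c b' (J : int -> lmodType R) : (forall i, injective_module (J i)) ->
    (forall i : int, ~~ (- b'%:Z < i <= c%:Z) -> forall x : J i, x = 0) ->
    thick1 (@injectives R) (zero_diff J).
  move=> injI I0; apply: (H b b.+1) => // i hi; apply: I0; lia.
elim: c b' J => [|c IH] b' J injJ J0; first exact: thick1_window J0.
apply: (@thick1_iso _ _ (shift (zero_diff (fun i => J (i + 1))))).
  apply: zero_diff_diso => [i x|//|i]; first exact: oppr0.
  exists (degcast (zero_diff J) (subrK 1 i)); split=> [x|y].
    exact: degcast_inj.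
  exact: (degcast_surj (Y := zero_diff J) (subrK 1 i) y).
apply: thick1_shift; apply: (IH b'.+1) => // i hi; apply: J0; lia.
Qed.

End ZeroDifferential.

Section UpperBound.
Variable R : comNzRingType.
Implicit Types M X : complex R.

Definition bounded_homology M : Prop :=
  exists n : nat, forall i : int, (n < `|i|)%N -> forall x : homology M i, x = 0.

(** Injectivity of [phi] on homology cuts the long exact sequence of the cone into short ones,
    leaving the cokernel in each degree. *)
Lemma cone_zero_diff_homology M (I : int -> lmodType R) (phi : chain_map M (zero_diff I)) i
    (C : lmodType R) (p : {linear I i -> C}) :
  (forall j, injective (hmap phi j)) -> (forall c, exists y, p y = c) ->
  (forall y : I i, p y = 0 <-> exists2 z, diff M i z = 0 & phi i z = y) ->
  retract (homology (cone phi) i) C.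
Proof.
move: i C p; apply: int_pred_ind => i C p phi_inj psurj pE.
have bd0 j (z : I j) : @boundary R (zero_diff I) j z -> z = 0 by case.
have dq (y : I (i - 1)) : diff (cone phi) (i - 1) (0, y) = 0.
  by congr (_, _); rewrite /= ?linear0 ?oppr0 ?addr0.
have lq : linear (fun y : I (i - 1) => cls (dq y)).
  move=> a u v; have d' : diff (cone phi) (i - 1) (a *: (0, u) + (0, v)) = 0.
    by rewrite linearP !dq scaler0 addr0.
  rewrite (cls_lin _ _ d'); apply/cls_eq.
  have -> : (0, a *: u + v) - (a *: (0, u) + (0, v)) = 0 :> cone phi (i - 1).
    by congr (_, _); rewrite /= ?scaler0 ?addr0 subrr.
  exact: boundary0.
apply: (@cokernel_retract _ _ _ _ p (lin_of lq)) => //.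
  elim/cls_ind => -[u y] dz; case: (dz) => /eqP du phiu; rewrite oppr_eq0 in du; move/eqP: du => du.
  have /boundaryE[v vE] : boundary u.
    apply/(cls_eq0 du)/(phi_inj (i - 1 - 1)); rewrite linear0.
    rewrite (hmapE _ (cmap_cycle phi du)); apply/cls_eq0.
    by move: phiu; rewrite /= add0r => ->; exact: boundary0.
  exists (y + phi _ v); apply/cls_eq/boundaryE; exists (v, 0) => /=.
  by congr (_, _); rewrite /= ?vE ?sub0r // add0r addrAC subrr add0r.
move=> y; rewrite pE /=; split=> [[z dz <-]|/cls_eq0/boundaryE[[v y'] [/eqP dv yE]]].
  apply/cls_eq0/boundaryE; exists (z, 0) => /=.
  by congr (_, _); rewrite /= ?dz ?oppr0 // add0r.
rewrite oppr_eq0 in dv; exists v; first exact/eqP.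
by rewrite -yE add0r.
Qed.

(** Bundles modules and maps into one type, so that [cid] can choose them degree by degree. *)
Record embedding (V : lmodType R) := Embedding {
  emb_inj : lmodType R; emb_coker : lmodType R;
  emb : {linear V -> emb_inj}; emb_quo : {linear emb_inj -> emb_coker} }.

(** Cycles map to homology and then to I_i; injectivity extends this to M_i. The result kills
    boundaries, which is the chain map condition. *)
Lemma extend_to_zero_diff M (I : int -> lmodType R) (e : forall i, {linear homology M i -> I i}) :
  (forall i, injective_module (I i)) ->
  exists phi : chain_map M (zero_diff I),
    forall i z (dz : diff M i z = 0), phi i z = e i (cls dz).
Proof.
move=> injI.
have ext i : exists f : {linear M i -> I i}, forall z (dz : diff M i z = 0), f z = e i (cls dz).
  have lv : linear (fun z : cycle M i => val z) by move=> a x y; rewrite linearP.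
  have lp : linear (fun z : cycle M i => \pi_(quotmod (is_boundary_submod M i)) z).
    by move=> a x y; rewrite pi_addE -pi_scale.
  have [|f fE] := @inj_ext R _ _ _ (lin_of lv) (e i \o lin_of lp) (injI i).
    move=> z /= z0; have -> : z = 0 by exact: val_inj.
    by have /= -> := linear0 (lin_of lp); exact: linear0.
  by exists f => z dz; have := fE (Cycle (introT eqP dz : is_cycle z)).
pose f i := projT1 (cid (ext i)).
have fE i z (dz : diff M i z = 0) : f i z = e i (cls dz) by exact: (projT2 (cid (ext i))).
have fd i x : f (i - 1) (diff M i x) = diff (zero_diff I) i (f i x).
  rewrite (fE _ _ (diffK x)) -[RHS](linear0 (e (i - 1))); congr (e _ _).
  by apply/cls_eq0; exact: Boundary.
by exists (@ChainMap R M (zero_diff I) f fd) => i z dz; exact: fE.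
Qed.

Lemma zero_diff_boundary (I : int -> lmodType R) j (z : zero_diff I j) : boundary z -> z = 0.
Proof. by case. Qed.

Lemma extend_injective M (I : int -> lmodType R) (e : forall i, {linear homology M i -> I i})
    (phi : chain_map M (zero_diff I)) :
  (forall i z (dz : diff M i z = 0), phi i z = e i (cls dz)) ->
  (forall i, injective (e i)) -> forall j, injective (hmap phi j).
Proof.
move=> phiE injE j; suff K y : hmap phi j y = 0 -> y = 0.
  by move=> x y exy; apply/subr0_eq/K; rewrite linearB exy subrr.
elim/cls_ind: y => z dz; rewrite (hmapE _ (cmap_cycle phi dz)) => /cls_eq0/zero_diff_boundary.
by rewrite (phiE _ _ dz) -[RHS](linear0 (e j)) => /injE.
Qed.

Lemma adams_step M n : bounded_homology M -> (forall i, id_le n.+1 (homology M i)) ->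
  exists (Z : complex R) (phi : chain_map M Z),
    [/\ thick1 (@injectives R) Z, bounded_homology (cone phi) &
        forall i, id_le n (homology (cone phi) i)].
Proof.
move=> [b Mb] Mid.
have data i : exists D : embedding (homology M i),
    [/\ injective_module (emb_inj D), injective (emb D), forall c, exists y, emb_quo D y = c,
      forall y, emb_quo D y = 0 <-> exists v, emb D v = y & id_le n (emb_coker D)] /\
    ((forall v : homology M i, v = 0) -> forall y : emb_inj D, y = 0).
  have [I [C [e [p h]]]] := id_le_step (Mid i).
  by exists (Embedding e p).
pose D i := projT1 (cid (data i)).
have DP i := projT2 (cid (data i)); rewrite -/(D _) in DP.
have [phi phiE] := extend_to_zero_diff (fun i => emb (D i)) (fun i => let: conj (And5 h _ _ _ _) _ := DP i in h).
have ret i : retract (homology (cone phi) i) (emb_coker (D i)).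
  have [[_ _ psurj pE _] _] := DP i.
  apply: (cone_zero_diff_homology (p := emb_quo (D i))) => //.
    by apply: (extend_injective phiE) => j; case: (DP j) => -[].
  move=> y; rewrite pE; split=> [[v <-]|[z dz <-]].
    by elim/cls_ind: v => z dz; exists z => //; exact: phiE.
  by exists (cls dz); rewrite (phiE _ _ dz).
exists (zero_diff (fun i => emb_inj (D i))), phi; split.
- apply: (thick1_zero_diff (b := b)) => [i|i ib]; first by case: (DP i) => -[].
  by apply: (DP i).2; exact: Mb.
- exists b => i ib; apply: (retract_zero (ret i)) => c.
  have [[_ _ psurj _ _] z] := DP i; have [y <-] := psurj c.
  by rewrite (z (Mb i ib) y) linear0.
- move=> i; apply: id_le_retract (ret i) _; by case: (DP i) => -[].
Qed.

Section Rotate.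
Variables (U Z : complex R) (phi : chain_map U Z).

Lemma rotate_linear i : linear (fun u : U (i - 1) =>
  (- phi (i - 1) u, (u, 0)) : Z (i - 1) * (U (i - 1) * Z i)).
Proof.
move=> a u v; congr (_, (_, _)); last by rewrite /= scaler0 addr0.
by rewrite /= linearP opprD -scalerN.
Qed.

(** A strict section of [cone_in_out]: it supplies the chain map out of the shift of U that [adams]
    needs. *)
Program Definition rotate : chain_map (shift U) (cone (cone_in phi)) :=
  @ChainMap R (shift U) (cone (cone_in phi)) (fun i => lin_of (@rotate_linear i)) _.
Next Obligation.
congr (_, (_, _)); rewrite /=.
- by rewrite (linearN (phi _)) (linearN (diff Z _)) cmapP.
- by rewrite addr0.
- by rewrite linear0 add0r subrr.
Qed.

Lemma rotate_qis : quasi_iso rotate.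
Proof.
apply: (@qis_cancel_l R _ _ _ (cone_in_out phi)); first exact: cone_in_out_qis.
by apply: (@qis_ext R _ _ (cid_map (shift U))) => //; exact: quasi_iso_id.
Qed.

End Rotate.

(** The embedding step is applied to the desuspension U of M: from U -> Z one gets M itself, up to
    quasi-isomorphism, as the cone of Z -> cone phi, and the homology of [cone phi] has smaller
    injective dimension. *)
Lemma adams M n : bounded_homology M -> (forall i, id_le n (homology M i)) ->
  exists X (s : chain_map M X), quasi_iso s /\ tower (@injectives R) n X.
Proof.
elim: n M => [|n IH] M [b Mb] Mid.
  (* With injective homology, the identity of homology extends to a quasi-isomorphism from M to its
     homology. *)
  have [phi phiE] := @extend_to_zero_diff M _ (fun i => idfun) Mid.
  exists (zero_diff (homology M)), phi; split; last exact: thick1_zero_diff Mb.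
  apply: bij_qis => [i|i]; first by apply: (extend_injective phiE) => j; exact: inj_id.
  elim/cls_ind => w dw; exists w; elim/cls_ind: w dw => z dz dw.
  rewrite (hmapE _ (cmap_cycle phi dz)); apply/cls_eq.
  by rewrite (phiE _ _ dz) subrr; exact: boundary0.
pose U := unshift M.
have ret i : retract (homology U (i - 1)) (homology M i).
  have qU := unshiftK_qis M.
  have [r1 [s1 r1K]] := (homology_shift U i).2.
  have [r2 [s2 r2K]] := (lin_bij_retract (hmap_qis_inj (i := i) qU) (hmap_qis_surj (i := i) qU)).1.
  by exists (r2 \o r1), (s1 \o s2) => z /=; rewrite r2K r1K.
have Ub : bounded_homology U.
  exists b.+1; apply: int_pred_ind => i ib; apply: (retract_zero (ret i)); apply: Mb; lia.
have Uid i : id_le n.+1 (homology U i).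
  move: i; apply: int_pred_ind => i; exact: id_le_retract (ret i) (Mid i).
have [Z [phi [tZ Cb Cid]]] := adams_step Ub Uid.
have [X [s [qs tX]]] := IH _ Cb Cid.
have comm i z : s i (cone_in phi i z) = ccomp s (cone_in phi) i (cid_map Z i z) by [].
exists (cone (ccomp s (cone_in phi))).
exists (ccomp (cone_map comm) (ccomp (rotate phi) (unshiftV M))); split.
  apply: quasi_iso_comp; first exact: (cone_map_qis comm (quasi_iso_id Z) qs).
  apply: quasi_iso_comp; [exact: rotate_qis | exact: unshiftV_qis].
by exists Z, X, (ccomp s (cone_in phi)).
Qed.

Lemma thick_of_id_le M n : bounded_homology M -> (forall i, id_le n (homology M i)) ->
  thick (@injectives R) n.+1 M.
Proof. by move=> Mb /(adams Mb)[X [s [qs tX]]]; exact: tower_thick qs tX. Qed.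

End UpperBound.

(** * The theorem *)


Section DirectSumFinGen.
Variables (R : comNzRingType) (T : eqType) (V : T -> lmodType R).

Definition dsum_in_val i (x : V i) k : V k :=
  if i =P k is ReflectT e then ecast k (V k) e x else 0.

Lemma dsum_in_val_id i (x : V i) : dsum_in_val x i = x.
Proof. by rewrite /dsum_in_val; case: eqP => // e; rewrite (eq_axiomK e). Qed.

Lemma dsum_in_val_neq i (x : V i) k : i != k -> dsum_in_val x k = 0.
Proof. by rewrite /dsum_in_val; case: eqP. Qed.

Lemma dsum_in_finite i (x : V i) :
  exists s : seq T, forall k, k \notin s -> dsum_in_val x k = 0.
Proof.
by exists [:: i] => k; rewrite inE eq_sym; exact: dsum_in_val_neq.
Qed.

Definition dsum_in i (x : V i) : dsum V := DSum (dsum_in_finite x).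

Lemma dsum_in_linear i : linear (@dsum_in i).
Proof.
move=> a x y; apply: dsum_eq => k /=.
case: (eqVneq i k) => [<-|ik]; first by rewrite !dsum_in_val_id.
by rewrite !dsum_in_val_neq // scaler0 addr0.
Qed.

Lemma dsum_proj_linear i : linear (fun x : dsum V => x i).
Proof. by []. Qed.

Lemma dsum_retract i : retract (V i) (dsum V).
Proof.
by exists (lin_of (@dsum_in_linear i)), (lin_of (@dsum_proj_linear i)) => x /=; exact: dsum_in_val_id.
Qed.

Lemma dsum_fin_gen (s : seq T) : uniq s ->
  (forall i, i \notin s -> forall x : V i, x = 0) ->
  (forall i, fin_gen (V i)) -> exists g, forall v : dsum V, lspan g v.
Proof.
move=> us s0 fg.
have fg' i : exists g : seq (V i), forall v, lspan g v.
  by have [g gE] := fg i; exists g => v; apply/lspanE; exact: gE.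
pose g i := projT1 (cid (fg' i)).
have gP i v : lspan (g i) v by exact: (projT2 (cid (fg' i))).
exists (flatten [seq map (@dsum_in i) (g i) | i <- s]) => v.
have -> : v = \sum_(i <- s) dsum_in (v i).
  apply: dsum_eq => k.
  have /= -> := linear_sum (lin_of (@dsum_proj_linear k)) s xpredT (fun i => dsum_in (v i)).
  case: (boolP (k \in s)) => ks.
    rewrite (bigD1_seq k) //= dsum_in_val_id big1 ?addr0 // => i ik.
    exact: dsum_in_val_neq.
  rewrite (s0 k ks (v k)) big_seq big1 // => i is_.
  by apply: dsum_in_val_neq; apply: contraNneq ks => <-.
rewrite big_seq; elim/big_ind: _ => [|x y|i is_]; first exact: (lspan_submod _).1.
  exact: submodD (lspan_submod _).
have := lspan_map (lin_of (@dsum_in_linear i)) (gP i (v i)).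
apply: lspan_sub => x xg; apply/flattenP.
by exists (map (@dsum_in i) (g i)) => //; apply: map_f.
Qed.

End DirectSumFinGen.

Section FromResolution.
Variables (R : comNzRingType).

(** N is the module of cocycles in degree [j], and its cosyzygy in J_j is that of degree j + 1; the
    k-th cosyzygy is injective by hypothesis. *)
Lemma id_le_of_cocycles (J : nat -> lmodType R) (d : forall j, {linear J j -> J j.+1}) :
  (forall j x, d j.+1 (d j x) = 0) ->
  (forall j w, d j.+1 w = 0 -> exists z, d j z = w) ->
  (forall j, injective_module (J j)) ->
  forall k j (N : lmodType R) (e : {linear N -> J j}), injective e ->
    (forall v, d j (e v) = 0) -> (forall y, d j y = 0 -> exists v, e v = y) ->
    inj_sub (coc d (j + k)%N) -> id_le k N.
Proof.
move=> dd0 exactJ injJ; elim=> [|k IH] j N e inje ez es.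
  rewrite addn0 => injC A B f g injf.
  have [|a|h [hz hf]] := injC A B f (e \o g).
  - by move=> a fa; have -> : a = 0 by [apply: injf; rewrite fa linear0]; rewrite linear0.
  - exact: ez.
  have [k kE] := choice (fun b => es _ (hz b)).
  have lk : linear k by move=> a x y; apply: inje; rewrite linearP !kE linearP.
  by exists (lin_of lk) => a /=; apply: inje; rewrite kE hf.
rewrite addnS -addSn => injC.
have [K [i [inji iz is_]]] := submodule_ex (coc_submod d j.+1).
have [p pE] := choice (fun y => is_ _ (dd0 j y)).
have lp : linear p by move=> a x y; apply: inji; rewrite linearP !pE linearP.
exists (J j), K, e, (lin_of lp); split=> //=.
- by move=> c; have [y yE] := exactJ j _ (iz c); exists y; apply: inji; rewrite pE.
- move=> y; split=> [py|[v <-]]; first by apply: es; rewrite -pE py linear0.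
  by apply: inji; rewrite pE ez linear0.
- exact: (IH j.+1 K i).
Qed.

(** Built by iterating [- 1], so that the differential of [I] has the type of a cochain map without
    casts. *)
Fixpoint coh_deg (j : nat) : int := if j is j'.+1 then coh_deg j' - 1 else 0.

Lemma coh_degE j : coh_deg j = - j%:Z.
Proof. by elim: j => //= j ->; lia. Qed.

Lemma stalk_zero (N : lmodType R) i (z : stalk N i) : i != 0 -> z = 0.
Proof. by move: i z => [[|k]|k] // z _; exact: thinmx0. Qed.

Lemma resolution_cochain (N : lmodType R) (I : complex R) n :
  injective_resolution N I n ->
  let d j : {linear I (coh_deg j) -> I (coh_deg j.+1)} := diff I (coh_deg j) in
  [/\ forall j w, d j.+1 w = 0 -> exists z, d j z = w,
      forall j, injective_module (I (coh_deg j)),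
      forall j, (n < j)%N -> forall x : I (coh_deg j), x = 0 &
      exists e : {linear N -> I (coh_deg 0)}, [/\ injective e,
        forall v, d 0%N (e v) = 0 & forall y, d 0%N y = 0 -> exists v, e v = y]].
Proof.
move=> [[e /quasi_isoP qe] Iinj] d; split.
- move=> j w dw; have [_ /(_ w dw)[z _]] := qe (coh_deg j.+1).
  have -> : z = 0 by apply: stalk_zero; rewrite coh_degE; lia.
  rewrite linear0 sub0r => /boundaryE[y yE].
  by exists (- y); rewrite linearN /= /d yE opprK.
- by move=> j; exact: (Iinj _).1.
- by move=> j nj; apply: (Iinj _).2; rewrite coh_degE; lia.
(* The resolution is zero in degree 1, so nothing bounds in degree 0. *)
have bd0 (z : I 0) : boundary z -> z = 0.
  move=> /(@boundaryE R I 1 z)[y <-].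
  have -> : y = 0 by apply: (Iinj 1).2; lia.
  exact: linear0.
have [i0 s0] := qe 0; exists (e 0); split.
- suff K z : e 0 z = 0 -> z = 0 by move=> x y exy; apply/subr0_eq/K; rewrite linearB exy subrr.
  move=> ez; have : boundary (z : stalk N 0).
    by apply: i0 => //; rewrite ez; exact: boundary0.
  by case.
- by move=> v; have /= <- := cmapP e (v : stalk N 0); exact: linear0.
- move=> y dy; have [z _ /bd0/subr0_eq] := s0 y dy; by exists z.
Qed.

End FromResolution.

Lemma einfE (P : nat -> Prop) n : P n -> (forall k, P k -> (n <= k)%N) -> einf P = Some n.
Proof.
move=> Pn Pmin; rewrite /einf; case: pselect => [h|no]; last first.
  by case: no; exists n; exact/asboolP.
congr Some; case: ex_minnP => k /asboolP Pk kmin; apply/eqP.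
by rewrite eqn_leq kmin ?Pmin //; exact/asboolP.
Qed.

Theorem theoremC (R : comNzRingType) (m : set R)
    (R_noetherian : noetherian R) (R_local : local_with m)
    (M : complex R)
    (M_Dbf : bounded_fg_homology M)
    (M_nonzero : exists (i : int) (x : homology M i), x <> 0%R)
    (M_id : inj_dim (total_homology M) <> None) :
  level (@injectives R) M = esucc (depth m).
Proof.
have [n [I IP]] : exists n I, injective_resolution (total_homology M) I n.
  apply: contrapT => no; apply: M_id; rewrite /inj_dim /einf; case: pselect => // h.
  by case: no; case: h => n /asboolP[I IP]; exists n, I.
have [exactJ injJ J0 [e [inje ez es]]] := resolution_cochain IP.
have dd0 j (x : I (coh_deg j)) : diff I (coh_deg j.+1) (diff I (coh_deg j) x) = 0.
  exact: diffK.
have id_of k : inj_sub (coc (J := fun j => I (coh_deg j)) (fun j => diff I (coh_deg j)) k) ->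
    thick (@injectives R) k.+1 M.
  move=> injC; apply: thick_of_id_le => [|i]; first exact: M_Dbf.1.
  apply: id_le_retract (dsum_retract (homology M) i) _.
  exact: (id_le_of_cocycles dd0 exactJ injJ inje ez es injC).
have [b Mb] := M_Dbf.1.
have [gens gensP] : exists g, forall v : total_homology M, lspan g v.
  pose s := [seq (k%:Z - b%:Z)%R | k <- iota 0 (b + b).+1].
  apply: (@dsum_fin_gen _ _ _ s); last exact: M_Dbf.2.
    by rewrite map_inj_uniq ?iota_uniq // => x y; lia.
  move=> i /negP si x; apply: Mb; rewrite ltnNge; apply/negP => ib; apply: si.
  apply/mapP; exists (absz (i + b%:Z)); first by rewrite mem_iota; lia.
  lia.
have reg_lt (s : seq R) k : regular_seq s -> (forall x, x \in s -> m x) ->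
    thick (@injectives R) k M -> (size s < k)%N.
  exact: (thick_regular_lt R_noetherian R_local M_Dbf M_nonzero).
pose P k := `[< exists s : seq R, [/\ size s = k, forall x, x \in s -> m x & regular_seq s] >].
have exP : exists k, P k.
  exists 0%N; apply/asboolP; exists [::]; split=> //; split=> //.
  by case=> c /esym /eqP; rewrite big_ord0 eq_sym oner_eq0.
(* The depth is finite: J_(n+1) = 0 places M in [thick] at n + 2, and the lower bound limits all
   regular sequences. *)
have Pmax k : P k -> (k <= n.+1)%N.
  move=> /asboolP[s [<- sm sreg]]; rewrite -ltnS; apply: reg_lt => //.
  apply: id_of => A B f g fg _.
  exists (lin_of (@zero_linear R B _)); split=> [v|a] /=; first exact: linear0.
  exact: (esym (J0 n.+1 (ltnSn n) (g a))).
have [d /asboolP[s [sd sm sreg]] dmax] := ex_maxnP exP Pmax.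
(* A regular sequence of maximal length cannot be prolonged, as the vanishing of Ext for R / m
   requires. *)
have smax x : m x -> ~ regular_seq (rcons s x).
  move=> mx reg; have /dmax : P d.+1; last by rewrite ltnn.
  apply/asboolP; exists (rcons s x); split; rewrite ?size_rcons ?sd //.
  by move=> y; rewrite mem_rcons inE => /predU1P[->|/sm].
have thick_d : thick (@injectives R) d.+1 M.
  apply: id_of; rewrite -sd.
  have gens0 (w : I (coh_deg 0)) : diff I (coh_deg 0) w = 0 -> lspan (map e gens) w.
    by move=> /es[v <-]; exact: lspan_map.
  exact: (coc_injective R_noetherian R_local dd0 exactJ injJ gens0 sreg sm smax J0).
have -> : depth m = Some d.
  apply: einfE => [k [t [<- tm treg]]|k].
    by apply: dmax; apply/asboolP; exists t.
  by apply; exists s.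
apply: einfE => // k tk; have := reg_lt s k sreg sm tk; by rewrite sd.
Qed.
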